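(* Let $\Omega\subset\mathbb C$ be a convex domain with $\Omega\neq\mathbb C$, and let $P$ be a conformal map of the unit disk $\mathbb D$ onto $\Omega$. Let $n\in\mathbb N\cup\{0\}$, $j\in\{-1,0,1,2,\ldots\}$, $c=(c_0,\ldots,c_n)\in\operatorname{Int}\mathcal C(n)$, and let $\gamma=(\gamma_0,\ldots,\gamma_n)$ be the Schur parameter of $c$. Then for each fixed $z_0\in\mathbb D\setminus\{0\}$, $Q_{\gamma,j}(z_0,\varepsilon)$ is a convex univalent function of $\varepsilon\in\overline{\mathbb D}$, and $$V_\Omega^j(z_0,c)=Q_{\gamma,j}(z_0,\overline{\mathbb D}):=\{Q_{\gamma,j}(z_0,\varepsilon):\varepsilon\in\overline{\mathbb D}\}.$$ Furthermore, for $g\in\mathcal F_\Omega(c)$ and $\varepsilon\in\partial\mathbb D$, the equality $$\int_0^{z_0}\zeta^j\{g(\zeta)-g(0)\}\,d\zeta=Q_{\gamma,j}(z_0,\varepsilon)$$ holds if and only if $g(z)\equiv P(\omega_{\gamma,\varepsilon}(z))$ in $\mathbb D$.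
   Context: $\mathbb D=\{z\in\mathbb C:|z|<1\}$. $H_1^\infty(\mathbb D)$ is the set of analytic functions $\omega$ on $\mathbb D$ with $\sup_{\mathbb D}|\omega|\le 1$. $\mathcal C(n)\subset\mathbb C^{n+1}$ is the set of $c=(c_0,\ldots,c_n)$ for which there is $\omega\in H_1^\infty(\mathbb D)$ with $\omega(z)=c_0+c_1z+\cdots+c_nz^n+\cdots$ (Taylor expansion at $0$); $\operatorname{Int}\mathcal C(n)$ is its interior in $\mathbb C^{n+1}$. Schur parameter of $c\in\operatorname{Int}\mathcal C(n)$: put $c^{(0)}=c$, $\gamma_0=c_0^{(0)}=c_0$, and recursively, given $c^{(i)}=(c^{(i)}_0,\ldots,c^{(i)}_{n-i})$ with $\gamma_i=c_0^{(i)}$, $|\gamma_i|<1$ and $i<n$, define $c^{(i+1)}=(c_0^{(i+1)},\ldots,c_{n-i-1}^{(i+1)})$ by $$c_0^{(i+1)}=\frac{c_1^{(i)}}{1-|\gamma_i|^2},\qquad c_p^{(i+1)}=\frac{c_{p+1}^{(i)}+\overline{\gamma_i}\sum_{\ell=1}^p c_{p-\ell}^{(i+1)}c_\ell^{(i)}}{1-|\gamma_i|^2}\quad(1\le p\le n-i-1),$$ and $\gamma_{i+1}=c_0^{(i+1)}$. For $c\in\operatorname{Int}\mathcal C(n)$ all $|\gamma_0|,\ldots,|\gamma_n|$ are $<1$ (a theorem of Schur), so $\gamma=(\gamma_0,\ldots,\gamma_n)$ is well defined. For $a\in\mathbb D$, $\sigma_a(z)=\dfrac{z+a}{1+\overline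 a z}$. For $\varepsilon\in\overline{\mathbb D}$ and $z\in\mathbb D$, $$\omega_{\gamma,\varepsilon}(z)=\sigma_{\gamma_0}(z\sigma_{\gamma_1}(\cdots z\sigma_{\gamma_n}(\varepsilon z)\cdots)),\qquad Q_{\gamma,j}(z,\varepsilon)=\int_0^z\zeta^j\{P(\omega_{\gamma,\varepsilon}(\zeta))-P(c_0)\}\,d\zeta.$$ $\mathcal F_\Omega(c)$ is the set of analytic $g$ on $\mathbb D$ with $g(\mathbb D)\subset\Omega$ and $(P^{-1}\circ g)(z)=c_0+c_1z+\cdots+c_nz^n+\cdots$ in $\mathbb D$, and $$V_\Omega^j(z_0,c)=\left\{\int_0^{z_0}\zeta^j(g(\zeta)-g(0))\,d\zeta:\ g\in\mathcal F_\Omega(c)\right\}.$$ (For $j=-1$ the integrands have a removable singularity at $0$.) A convex univalent function of $\varepsilon\in\overline{\mathbb D}$ means an analytic function that is injective on $\overline{\mathbb D}$ and maps $\mathbb D$ onto a convex domain. *)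

(* Defs.v *)
From Stdlib Require Import Reals ZArith ClassicalEpsilon.
From Coquelicot Require Export Coquelicot.

Open Scope R_scope.

Definition disk (z : C) : Prop := Cmod z < 1.
Definition cdisk (z : C) : Prop := Cmod z <= 1.

Definition analytic_at (f : C -> C) (z0 : C) : Prop :=
  exists (a : nat -> C) (r : R), 0 < r /\
    forall z : C, Cmod (z - z0)%C < r ->
      is_pseries (K := C_AbsRing) (V := C_NormedModule) a (z - z0)%C (f z).

(* Each point comes with a full neighbourhood on which [f] is a power series,
   so on a set [A] that is not open this is analyticity on an open set
   containing [A]. *)
Definition analytic_on (A : C -> Prop) (f : C -> C) : Prop :=
  forall z : C, A z -> analytic_at f z.

Definition injective_on (A : C -> Prop) (f : C -> C) : Prop :=
  forall z w : C, A z -> A w -> f z = f w -> z = w.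

Definition image (f : C -> C) (A : C -> Prop) (w : C) : Prop :=
  exists z : C, A z /\ f z = w.

Definition convex_set (A : C -> Prop) : Prop :=
  forall (z w : C) (t : R), A z -> A w -> 0 <= t <= 1 ->
    A (RtoC (1 - t) * z + RtoC t * w)%C.

(* Connectedness is implied by convexity. *)
Definition convex_domain (A : C -> Prop) : Prop :=
  open A /\ (exists z : C, A z) /\ convex_set A.

Definition conformal_map (P : C -> C) (Omega : C -> Prop) : Prop :=
  analytic_on disk P /\ injective_on disk P /\
  forall w : C, image P disk w <-> Omega w.

(* The inverse [Omega -> disk] of a conformal map [P] of [disk] onto [Omega];
   unspecified outside [Omega]. *)
Definition disk_inv (P : C -> C) (w : C) : C :=
  epsilon (inhabits (RtoC 0)) (fun z : C => disk z /\ P z = w).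

Definition convex_univalent (f : C -> C) : Prop :=
  analytic_on cdisk f /\ injective_on cdisk f /\ convex_domain (image f disk).

(* A point (c_0, ..., c_n) of C^(n+1) is represented by [c : nat -> C], whose
   values beyond index [n] are irrelevant to every notion below. *)

(* f(z) = c_0 + c_1 z + ... + c_n z^n + ... in the unit disk *)
Definition taylor_on_disk (n : nat) (c : nat -> C) (f : C -> C) : Prop :=
  exists a : nat -> C,
    (forall k : nat, (k <= n)%nat -> a k = c k) /\
    forall z : C, disk z ->
      is_pseries (K := C_AbsRing) (V := C_NormedModule) a z (f z).

Definition H1_infty (w : C -> C) : Prop :=
  analytic_on disk w /\ forall z : C, disk z -> Cmod (w z) <= 1.

Definition coeff_body (n : nat) (c : nat -> C) : Prop :=
  exists w : C -> C, H1_infty w /\ taylor_on_disk n c w.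

Definition Int_coeff_body (n : nat) (c : nat -> C) : Prop :=
  exists delta : R, 0 < delta /\
    forall c' : nat -> C,
      (forall k : nat, (k <= n)%nat -> Cmod (c' k - c k)%C < delta) ->
      coeff_body n c'.

(* [d i p] is c^(i)_p, for i <= n and p <= n - i. *)
Definition schur_parameter (n : nat) (c gamma : nat -> C) : Prop :=
  exists d : nat -> nat -> C,
    (forall p : nat, (p <= n)%nat -> d 0%nat p = c p) /\
    (forall i : nat, (i <= n)%nat -> gamma i = d i 0%nat) /\
    (forall i : nat, (i < n)%nat ->
       d (S i) 0%nat = (d i 1%nat / RtoC (1 - Cmod (gamma i) ^ 2))%C) /\
    (forall i p : nat, (i < n)%nat -> (1 <= p <= n - i - 1)%nat ->
       d (S i) p =
         ((d i (S p) +
             Cconj (gamma i) *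
               sum_n_m (fun l : nat => d (S i) (p - l)%nat * d i l)%C 1 p)
            / RtoC (1 - Cmod (gamma i) ^ 2))%C).

Definition sigma (a z : C) : C := ((z + a) / (1 + Cconj a * z))%C.

Fixpoint omega (n : nat) (gamma : nat -> C) (eps z : C) : C :=
  match n with
  | O => sigma (gamma 0%nat) (eps * z)%C
  | S m => sigma (gamma 0%nat)
             (z * omega m (fun i : nat => gamma (S i)) eps z)%C
  end.

Definition Cpowz (z : C) (j : Z) : C :=
  match j with
  | Z0 => RtoC 1
  | Zpos p => Cpow z (Pos.to_nat p)
  | Zneg p => (/ Cpow z (Pos.to_nat p))%C
  end.

(* Integral from 0 to [z] along the segment: the integrands are analytic in
   the disk, so the path is immaterial. *)
Definition int_from_0 (f : C -> C) (z : C) : C :=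
  RInt (V := C_R_CompleteNormedModule)
    (fun t : R => (f (RtoC t * z) * z)%C) 0 1.

(* For j = -1 the value taken by the integrand at the removable singularity 0
   does not affect the integral. *)
Definition weighted_int (j : Z) (g : C -> C) (g0 z : C) : C :=
  int_from_0 (fun zeta : C => (Cpowz zeta j * (g zeta - g0))%C) z.

Definition Q (P : C -> C) (n : nat) (c gamma : nat -> C) (j : Z)
    (z eps : C) : C :=
  weighted_int j (fun zeta : C => P (omega n gamma eps zeta)) (P (c 0%nat)) z.

Definition F_class (Omega : C -> Prop) (P : C -> C) (n : nat) (c : nat -> C)
    (g : C -> C) : Prop :=
  analytic_on disk g /\ (forall z : C, disk z -> Omega (g z)) /\
  taylor_on_disk n c (fun z : C => disk_inv P (g z)).

Definition V_region (Omega : C -> Prop) (P : C -> C) (n : nat) (c : nat -> C)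
    (j : Z) (z0 w : C) : Prop :=
  exists g : C -> C,
    F_class Omega P n c g /\ w = weighted_int j g (g (RtoC 0)) z0.

(* Main.v *)
From Stdlib Require Import Reals ZArith Lra Lia ClassicalEpsilon Classical.
From Coquelicot Require Import Coquelicot.
Require Import Defs.
Open Scope R_scope.

(** By the Schur algorithm the functions of the class are [g = P (omega_{gamma,w}(z))] with an
    arbitrary [w] in the unit ball of H^infinity.  For fixed [z] the map
    [e |-> P (omega_{gamma,e}(z))] is convex univalent (Study's theorem, iterated), so
    [P (omega_{gamma,w(z)}(z)) - P (omega_{gamma,e}(z))], divided by [e] times the derivative in [e],
    has negative real part when [|w(z)| <= |e|].  The numerator and the denominator are [R'/z^j] and
    [H'/z^j] for [R(z) = int_0^z zeta^j (g - P omega_{gamma,e})] and [H = e dQ/de], and [H] is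
    starlike in [z], so that [Re (R/H) < 0] as well (Sakaguchi-Libera).  At [z0] this says that the
    value of [g] lies strictly inside the tangent half-plane of [Q(z0, .)] at [e].  Injectivity and
    convexity of [Q(z0, .)], the equality [V = Q(z0, closed disk)] (by a nearest-point argument) and
    the uniqueness statement are all read off from this inequality.

    Starlikeness of [H] reduces to [Re (z d/dz log (P'(omega) d omega/d e)) > 0], which is
    proved by induction along the Schur chain from [|(1-|u|^2) P''/P'(u) - 2 conj u| <= 2]. *)

(** * Moduli *)

(** The quotients that matter are all [0/0] at the origin. The increment of [P (omega)] in [e]
    vanishes there to order [n + 1], and integration against [zeta^j] raises this to [n + j + 2].
    With [J = j + 1], a natural number, the power [z^(n+J+1)] is divided out at once, so that
    numerators, denominators and their means along rays are holomorphic in the whole disk, also for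
    [j = -1], and Jack's lemma applies to their quotients. Strict inequality is carried through
    every stage, since injectivity and uniqueness rest on it. It could fail only if the Schur
    remainder [w] of [g] took the value [e]; for [|e| = 1] this makes [w] constant, which is exactly
    the case of equality. Analyticity on the closed disk of parameters holds because, for fixed
    [z0], the integrals make sense for [e] in a disc of radius larger than [1]. That [c] is interior
    enters through a function with these coefficients and supremum below [1]: this property passes
    to all its Schur transforms, and so every parameter has modulus below [1]. *)

Lemma Cmod_sym (x y : C) : Cmod (x - y) = Cmod (y - x).
Proof. rewrite <- Cmod_opp. f_equal. ring. Qed.

Lemma Cmod_minus_le (x y : C) : Cmod (x - y) <= Cmod x + Cmod y.
Proof. unfold Cminus. rewrite <- (Cmod_opp y). apply Cmod_triangle. Qed.

Lemma Cmod_tri3 (x y z : C) : Cmod (x - z) <= Cmod (x - y) + Cmod (y - z).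
Proof. replace (x - z)%C with ((x - y) + (y - z))%C by ring. apply Cmod_triangle. Qed.

Lemma Cmod_tri_sub (x y : C) : Cmod x <= Cmod y + Cmod (x - y).
Proof. replace x with (y + (x - y))%C at 1 by ring. apply Cmod_triangle. Qed.

Lemma Cmod_RtoC_pos (x : R) : 0 <= x -> Cmod (RtoC x) = x.
Proof. intro H. rewrite Cmod_R. now apply Rabs_pos_eq. Qed.

Lemma Cmod2_conj_mult (z : C) : (z * Cconj z)%C = RtoC (Cmod z ^ 2).
Proof. rewrite <- Cmod2_conj. now rewrite RtoC_pow. Qed.

Lemma Cmod_sqr (z : C) : Cmod z ^ 2 = Re z ^ 2 + Im z ^ 2.
Proof. apply Cmod2_alt. Qed.

Lemma Re_mult (x y : C) : Re (x * y) = Re x * Re y - Im x * Im y.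
Proof. reflexivity. Qed.
Lemma Im_mult (x y : C) : Im (x * y) = Re x * Im y + Im x * Re y.
Proof. reflexivity. Qed.
Lemma Re_plus (x y : C) : Re (x + y) = Re x + Re y.
Proof. reflexivity. Qed.
Lemma Im_plus (x y : C) : Im (x + y) = Im x + Im y.
Proof. reflexivity. Qed.
Lemma Re_minus (x y : C) : Re (x - y) = Re x - Re y.
Proof. reflexivity. Qed.
Lemma Im_minus (x y : C) : Im (x - y) = Im x - Im y.
Proof. reflexivity. Qed.
Lemma Re_opp (x : C) : Re (- x) = - Re x.
Proof. reflexivity. Qed.
Lemma Im_opp (x : C) : Im (- x) = - Im x.
Proof. reflexivity. Qed.
Lemma Re_RtoC (x : R) : Re (RtoC x) = x.
Proof. reflexivity. Qed.
Lemma Im_RtoC (x : R) : Im (RtoC x) = 0.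
Proof. reflexivity. Qed.
Lemma Re_conj (x : C) : Re (Cconj x) = Re x.
Proof. reflexivity. Qed.
Lemma Im_conj (x : C) : Im (Cconj x) = - Im x.
Proof. reflexivity. Qed.
Lemma Re_scal (x : R) (y : C) : Re (RtoC x * y) = x * Re y.
Proof. rewrite Re_mult, Re_RtoC, Im_RtoC. ring. Qed.
Lemma Im_scal (x : R) (y : C) : Im (RtoC x * y) = x * Im y.
Proof. rewrite Im_mult, Re_RtoC, Im_RtoC. ring. Qed.

#[global] Hint Rewrite Re_mult Im_mult Re_plus Im_plus Re_minus Im_minus Re_opp Im_opp
  Re_RtoC Im_RtoC Re_conj Im_conj : reim.

Lemma C_ext (x y : C) : Re x = Re y -> Im x = Im y -> x = y.
Proof. destruct x, y; simpl; intros; subst; reflexivity. Qed.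

Lemma Cmod_le_Re_Im (z : C) : Cmod z <= Rabs (Re z) + Rabs (Im z).
Proof.
  replace z with (RtoC (Re z) + RtoC (Im z) * Ci)%C at 1.
  2:{ apply C_ext; autorewrite with reim; simpl; ring. }
  eapply Rle_trans; [apply Cmod_triangle|].
  rewrite Cmod_mult, Cmod_Ci, !Cmod_R. lra.
Qed.

Lemma Re_le_Cmod (z : C) : Re z <= Cmod z.
Proof. eapply Rle_trans; [apply Rle_abs|apply re_le_Cmod]. Qed.

Lemma Im_le_Cmod (z : C) : Rabs (Im z) <= Cmod z.
Proof. generalize (Rmax_Cmod z); intro H. unfold Im. eapply Rle_trans; [apply Rmax_r|exact H]. Qed.

Lemma Cmod_lt_of_sqr (z : C) (r : R) : 0 <= r -> Re z ^ 2 + Im z ^ 2 < r ^ 2 -> Cmod z < r.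
Proof. intros Hr H. rewrite <- Cmod_sqr in H. generalize (Cmod_ge_0 z). nra. Qed.

Lemma Cmult_cancel_l (x y z : C) : x <> (RtoC 0) -> (x * y)%C = (x * z)%C -> y = z.
Proof.
  intros Hx H. replace y with (/ x * (x * y))%C by (field; exact Hx).
  rewrite H. field. exact Hx.
Qed.

Lemma Rmin_lt (x a b : R) : x < Rmin a b -> x < a /\ x < b.
Proof. generalize (Rmin_l a b) (Rmin_r a b). lra. Qed.

Lemma Cminus_0_r (x : C) : (x - 0)%C = x.
Proof. ring. Qed.

Lemma Cmod_small_eq (x y : C) : (forall e, 0 < e -> Cmod (x - y) <= e) -> x = y.
Proof.
  intro H. replace x with ((x - y) + y)%C by ring.
  replace (x - y)%C with (RtoC 0); [ring|].
  symmetry. apply Cmod_eq_0. apply Rle_antisym; [|apply Cmod_ge_0].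
  apply Rnot_lt_le. intro Hl. specialize (H (Cmod (x - y) / 2)). lra.
Qed.

(** * Continuity and complex derivatives *)

Definition ccont (f : C -> C) (z : C) : Prop :=
  forall e, 0 < e -> exists d, 0 < d /\
    forall w, Cmod (w - z) < d -> Cmod (f w - f z) < e.

Lemma ccont_const (k z : C) : ccont (fun _ => k) z.
Proof.
  intros e He. exists 1. split; [lra|]. intros w _.
  replace (k - k)%C with (RtoC 0) by ring. now rewrite Cmod_0.
Qed.

Lemma ccont_id (z : C) : ccont (fun w => w) z.
Proof. intros e He. exists e. auto. Qed.

Lemma ccont_plus f g z : ccont f z -> ccont g z -> ccont (fun w => f w + g w)%C z.
Proof.
  intros Hf Hg e He.
  destruct (Hf (e / 2)) as [d1 [Hd1 H1]]; [lra|].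
  destruct (Hg (e / 2)) as [d2 [Hd2 H2]]; [lra|].
  exists (Rmin d1 d2). split; [now apply Rmin_pos|]. intros w Hw.
  replace (f w + g w - (f z + g z))%C with ((f w - f z) + (g w - g z))%C by ring.
  eapply Rle_lt_trans; [apply Cmod_triangle|].
  assert (Cmod (w - z) < d1) by (eapply Rlt_le_trans; [apply Hw|apply Rmin_l]).
  assert (Cmod (w - z) < d2) by (eapply Rlt_le_trans; [apply Hw|apply Rmin_r]).
  specialize (H1 w H). specialize (H2 w H0). lra.
Qed.

Lemma ccont_mult f g z : ccont f z -> ccont g z -> ccont (fun w => f w * g w)%C z.
Proof.
  intros Hf Hg e He.
  set (A := Cmod (f z) + 1). set (B := Cmod (g z) + 1).
  assert (HA : 0 < A) by (unfold A; generalize (Cmod_ge_0 (f z)); lra).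
  assert (HB : 0 < B) by (unfold B; generalize (Cmod_ge_0 (g z)); lra).
  destruct (Hf (Rmin 1 (e / (2 * B)))) as [d1 [Hd1 H1]].
  { apply Rmin_pos; [lra|]. apply Rdiv_lt_0_compat; lra. }
  destruct (Hg (e / (2 * A))) as [d2 [Hd2 H2]].
  { apply Rdiv_lt_0_compat; lra. }
  exists (Rmin d1 d2). split; [now apply Rmin_pos|]. intros w Hw.
  destruct (Rmin_lt _ _ _ Hw) as [Hw1 Hw2].
  specialize (H1 w Hw1). specialize (H2 w Hw2).
  replace (f w * g w - f z * g z)%C with (f w * (g w - g z) + (f w - f z) * g z)%C by ring.
  eapply Rle_lt_trans; [apply Cmod_triangle|]. rewrite !Cmod_mult.
  assert (HfA : Cmod (f w) <= A).
  { unfold A. eapply Rle_trans; [apply (Cmod_tri_sub _ (f z))|].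
    generalize (Rmin_l 1 (e / (2 * B))). lra. }
  assert (Cmod (f w - f z) < e / (2 * B)) by (generalize (Rmin_r 1 (e / (2 * B))); lra).
  assert (Cmod (f w) * Cmod (g w - g z) <= A * Cmod (g w - g z)).
  { apply Rmult_le_compat_r; [apply Cmod_ge_0|exact HfA]. }
  assert (Cmod (f w - f z) * Cmod (g z) <= Cmod (f w - f z) * B).
  { apply Rmult_le_compat_l; [apply Cmod_ge_0|unfold B; lra]. }
  assert (A * Cmod (g w - g z) < e / 2).
  { replace (e / 2) with (A * (e / (2 * A))) by (field; lra). now apply Rmult_lt_compat_l. }
  assert (Cmod (f w - f z) * B < e / 2).
  { replace (e / 2) with (e / (2 * B) * B) by (field; lra). now apply Rmult_lt_compat_r. }
  lra.
Qed.

Lemma ccont_comp f g z : ccont g z -> ccont f (g z) -> ccont (fun w => f (g w)) z.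
Proof.
  intros Hg Hf e He. destruct (Hf e He) as [d [Hd H]].
  destruct (Hg d Hd) as [d' [Hd' H']]. exists d'. split; [exact Hd'|]. auto.
Qed.

Lemma ccont_ext_loc f g z d : 0 < d -> (forall w, Cmod (w - z) < d -> f w = g w) ->
  ccont f z -> ccont g z.
Proof.
  intros Hd Heq Hf e He. destruct (Hf e He) as [d' [Hd' H']].
  exists (Rmin d d'). split; [now apply Rmin_pos|]. intros w Hw.
  rewrite <- (Heq w), <- (Heq z).
  - apply H'. eapply Rlt_le_trans; [apply Hw|apply Rmin_r].
  - replace (z - z)%C with (RtoC 0) by ring. now rewrite Cmod_0.
  - eapply Rlt_le_trans; [apply Hw|apply Rmin_l].
Qed.

Lemma ccont_neq f z k : ccont f z -> f z <> k ->
  exists d, 0 < d /\ forall w, Cmod (w - z) < d -> f w <> k.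
Proof.
  intros Hf Hk. destruct (Hf (Cmod (f z - k))) as [d [Hd H]].
  { apply Cmod_gt_0. intro E. apply Hk. replace (f z) with ((f z - k) + k)%C by ring.
    rewrite E. ring. }
  exists d. split; [exact Hd|]. intros w Hw E. specialize (H w Hw). rewrite E in H.
  rewrite Cmod_sym in H. lra.
Qed.

Lemma ccont_inv z : z <> (RtoC 0) -> ccont Cinv z.
Proof.
  intros Hz e He. assert (Hm : 0 < Cmod z) by now apply Cmod_gt_0.
  set (m := Cmod z) in *.
  exists (Rmin (m / 2) (e * (m * m) / 2)). split.
  { apply Rmin_pos; [lra|]. assert (0 < e * (m * m)) by (repeat apply Rmult_lt_0_compat; lra). lra. }
  intros w Hw.
  assert (H1 : Cmod (w - z) < m / 2) by (eapply Rlt_le_trans; [apply Hw|apply Rmin_l]).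
  assert (H2 : Cmod (w - z) < e * (m * m) / 2) by (eapply Rlt_le_trans; [apply Hw|apply Rmin_r]).
  assert (H3 : m / 2 < Cmod w).
  { generalize (Cmod_tri_sub z w). rewrite Cmod_sym. fold m. lra. }
  assert (Hw0 : w <> (RtoC 0)) by (apply Cmod_gt_0; lra).
  replace (/ w - / z)%C with ((z - w) / (w * z))%C by (field; auto).
  rewrite Cmod_div by (now apply Cmult_neq_0). rewrite Cmod_mult, Cmod_sym. fold m.
  apply Rmult_lt_reg_r with (Cmod w * m); [apply Rmult_lt_0_compat; lra|].
  unfold Rdiv. rewrite Rmult_assoc, Rinv_l, Rmult_1_r by (apply Rgt_not_eq, Rmult_lt_0_compat; lra).
  eapply Rlt_le_trans; [apply H2|].
  assert (0 < e * m) by (apply Rmult_lt_0_compat; lra).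
  replace (e * (m * m) / 2) with (e * m * (m / 2)) by field.
  replace (e * (Cmod w * m)) with (e * m * Cmod w) by ring.
  apply Rmult_le_compat_l; lra.
Qed.

(* Caratheodory's formulation: the difference quotient extends continuously by [l]. *)
Definition cderiv (f : C -> C) (z l : C) : Prop :=
  exists phi : C -> C, phi z = l /\ ccont phi z /\
    exists d, 0 < d /\ forall w, Cmod (w - z) < d -> f w = (f z + phi w * (w - z))%C.

Lemma cderiv_cont f z l : cderiv f z l -> ccont f z.
Proof.
  intros [phi [_ [Hc [d [Hd H]]]]].
  apply ccont_ext_loc with (fun w => f z + phi w * (w - z))%C d; [exact Hd| |].
  { intros w Hw. now rewrite (H w Hw). }
  apply ccont_plus; [apply ccont_const|]. apply ccont_mult; [exact Hc|].
  unfold Cminus. apply ccont_plus; [apply ccont_id|apply ccont_const].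
Qed.

Lemma cderiv_const k z : cderiv (fun _ => k) z 0.
Proof.
  exists (fun _ => (RtoC 0)). repeat split; [apply ccont_const|].
  exists 1; split; [lra|]. intros; ring.
Qed.

Lemma cderiv_id z : cderiv (fun w => w) z 1.
Proof.
  exists (fun _ => (RtoC 1)). repeat split; [apply ccont_const|].
  exists 1; split; [lra|]. intros; ring.
Qed.

Lemma cderiv_ext_loc f g z l d : 0 < d -> (forall w, Cmod (w - z) < d -> f w = g w) ->
  cderiv f z l -> cderiv g z l.
Proof.
  intros Hd E [phi [H1 [H2 [d' [Hd' H]]]]]. exists phi. split; [exact H1|]. split; [exact H2|].
  exists (Rmin d d'). split; [now apply Rmin_pos|]. intros w Hw.
  rewrite <- (E w), <- (E z).
  - apply H. eapply Rlt_le_trans; [apply Hw|apply Rmin_r].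
  - replace (z - z)%C with (RtoC 0) by ring. now rewrite Cmod_0.
  - eapply Rlt_le_trans; [apply Hw|apply Rmin_l].
Qed.

Lemma cderiv_plus f g z l m : cderiv f z l -> cderiv g z m ->
  cderiv (fun w => f w + g w)%C z (l + m).
Proof.
  intros [p [H1 [H2 [d [Hd H]]]]] [q [K1 [K2 [d' [Hd' K]]]]].
  exists (fun w => p w + q w)%C. split; [now rewrite H1, K1|].
  split; [now apply ccont_plus|].
  exists (Rmin d d'). split; [now apply Rmin_pos|]. intros w Hw.
  rewrite (H w), (K w); [ring| |].
  - eapply Rlt_le_trans; [apply Hw|apply Rmin_r].
  - eapply Rlt_le_trans; [apply Hw|apply Rmin_l].
Qed.

Lemma cderiv_mult f g z l m : cderiv f z l -> cderiv g z m ->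
  cderiv (fun w => f w * g w)%C z (l * g z + f z * m).
Proof.
  intros Hf [q [K1 [K2 [d' [Hd' K]]]]]. generalize (cderiv_cont _ _ _ Hf); intro Cf.
  destruct Hf as [p [H1 [H2 [d [Hd H]]]]].
  exists (fun w => p w * g z + f w * q w)%C. split; [now rewrite H1, K1|].
  split.
  { apply ccont_plus; apply ccont_mult; auto. apply ccont_const. }
  exists (Rmin d d'). split; [now apply Rmin_pos|]. intros w Hw.
  destruct (Rmin_lt _ _ _ Hw) as [H3 H4].
  rewrite (K w H4). rewrite (H w H3). ring.
Qed.

Lemma cderiv_comp f g z l m : cderiv g z m -> cderiv f (g z) l ->
  cderiv (fun w => f (g w)) z (l * m).
Proof.
  intros Hg [p [H1 [H2 [d [Hd H]]]]]. generalize (cderiv_cont _ _ _ Hg); intro Cg.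
  destruct Hg as [q [K1 [K2 [d' [Hd' K]]]]].
  exists (fun w => p (g w) * q w)%C. split; [now rewrite H1, K1|].
  split. { apply ccont_mult; [|exact K2]. now apply ccont_comp. }
  destruct (Cg d Hd) as [d2 [Hd2 G]].
  exists (Rmin d2 d'). split; [now apply Rmin_pos|]. intros w Hw.
  destruct (Rmin_lt _ _ _ Hw) as [H3 H4].
  rewrite (H (g w) (G w H3)). rewrite (K w H4) at 2. ring.
Qed.

Lemma cderiv_inv z : z <> (RtoC 0) -> cderiv Cinv z (- / (z * z)).
Proof.
  intros Hz. exists (fun w => - / (w * z))%C. split; [reflexivity|]. split.
  { apply (ccont_ext_loc (fun w => (- (1)) * / (w * z))%C) with 1; [lra|intros; ring|].
    apply ccont_mult; [apply ccont_const|].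
    apply (ccont_comp Cinv (fun w => w * z)%C).
    - apply ccont_mult; [apply ccont_id|apply ccont_const].
    - apply ccont_inv. now apply Cmult_neq_0. }
  destruct (ccont_neq (fun w => w) z 0 (ccont_id z) Hz) as [d [Hd H]].
  exists d. split; [exact Hd|]. intros w Hw. field. split; [exact Hz|exact (H w Hw)].
Qed.

Lemma cderiv_eq f z l m : l = m -> cderiv f z l -> cderiv f z m.
Proof. now intros ->. Qed.

Lemma cderiv_scal k f z l : cderiv f z l -> cderiv (fun w => k * f w)%C z (k * l).
Proof.
  intro H. eapply cderiv_eq; [|apply cderiv_mult; [apply cderiv_const|exact H]]. cbv beta; ring.
Qed.

Lemma cderiv_opp f z l : cderiv f z l -> cderiv (fun w => - f w)%C z (- l).
Proof.
  intro H. apply (cderiv_ext_loc (fun w => (- (1)) * f w)%C _ _ _ 1); [lra|intros; ring|].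
  eapply cderiv_eq; [|apply cderiv_scal; exact H]. ring.
Qed.

Lemma cderiv_minus f g z l m : cderiv f z l -> cderiv g z m ->
  cderiv (fun w => f w - g w)%C z (l - m).
Proof. intros. apply cderiv_plus; [assumption|]. now apply cderiv_opp. Qed.

Lemma cderiv_div f g z l m : cderiv f z l -> cderiv g z m -> g z <> (RtoC 0) ->
  cderiv (fun w => f w / g w)%C z ((l * g z - f z * m) / (g z * g z)).
Proof.
  intros Hf Hg Hz. unfold Cdiv at 1.
  eapply cderiv_eq; [|apply cderiv_mult; [exact Hf|]].
  2:{ apply (cderiv_comp Cinv g); [exact Hg|]. now apply cderiv_inv. }
  cbv beta; field. exact Hz.
Qed.

Lemma cderiv_pow f z l k : cderiv f z l ->
  cderiv (fun w => f w ^ S k)%C z (RtoC (INR (S k)) * f z ^ k * l).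
Proof.
  intro H. induction k as [|k IH].
  - apply (cderiv_ext_loc f _ _ _ 1); [lra|intros; simpl; ring|].
    eapply cderiv_eq; [|exact H]. simpl. ring.
  - apply (cderiv_ext_loc (fun w => f w * f w ^ S k)%C _ _ _ 1); [lra|intros; simpl; ring|].
    eapply cderiv_eq; [|apply cderiv_mult; [exact H|exact IH]].
    rewrite (S_INR (S k)), RtoC_plus. simpl Cpow. ring.
Qed.

Lemma cderiv_bound f z l : cderiv f z l ->
  forall e, 0 < e -> exists d, 0 < d /\ forall h, Cmod h < d ->
    Cmod (f (z + h)%C - f z - l * h) <= e * Cmod h.
Proof.
  intros [p [H1 [H2 [d [Hd H]]]]] e He. destruct (H2 e He) as [d' [Hd' H']].
  exists (Rmin d d'). split; [now apply Rmin_pos|]. intros h Hh.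
  assert (E : (z + h - z)%C = h) by ring.
  destruct (Rmin_lt _ _ _ Hh) as [H3 H4].
  rewrite (H (z + h)%C) by now rewrite E.
  replace (f z + p (z + h)%C * (z + h - z) - f z - l * h)%C with ((p (z + h)%C - p z) * h)%C
    by (rewrite H1; ring).
  rewrite Cmod_mult. apply Rmult_le_compat_r; [apply Cmod_ge_0|].
  left. apply H'. now rewrite E.
Qed.

Lemma cderiv_of_bound f z l :
  (forall e, 0 < e -> exists d, 0 < d /\ forall h, Cmod h < d ->
    Cmod (f (z + h)%C - f z - l * h) <= e * Cmod h) -> cderiv f z l.
Proof.
  intros H.
  exists (fun w => if excluded_middle_informative (w = z) then l else (f w - f z) / (w - z))%C.
  split. { destruct (excluded_middle_informative (z = z)); congruence. }
  split.
  - intros e He. destruct (H (e / 2)) as [d [Hd Hb]]; [lra|]. exists d. split; [exact Hd|].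
    intros w Hw. destruct (excluded_middle_informative (z = z)); [|congruence].
    destruct (excluded_middle_informative (w = z)).
    + replace (l - l)%C with (RtoC 0) by ring. now rewrite Cmod_0.
    + assert (Hn : (w - z)%C <> (RtoC 0)).
      { intro E. apply n. replace w with ((w - z) + z)%C by ring. rewrite E. ring. }
      specialize (Hb (w - z)%C Hw). replace (z + (w - z))%C with w in Hb by ring.
      replace ((f w - f z) / (w - z) - l)%C with ((f w - f z - l * (w - z)) / (w - z))%C
        by (field; exact Hn).
      rewrite Cmod_div by exact Hn. assert (0 < Cmod (w - z)) by now apply Cmod_gt_0.
      apply Rmult_lt_reg_r with (Cmod (w - z)); [assumption|].
      unfold Rdiv. rewrite Rmult_assoc, Rinv_l, Rmult_1_r by lra.
      eapply Rle_lt_trans; [exact Hb|]. apply Rmult_lt_compat_r; lra.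
  - exists 1. split; [lra|]. intros w _.
    destruct (excluded_middle_informative (w = z)) as [->|n]; [ring|].
    field. intro E. apply n. replace w with ((w - z) + z)%C by ring. rewrite E. ring.
Qed.

Lemma cderiv_unique f z l m : cderiv f z l -> cderiv f z m -> l = m.
Proof.
  intros H K. apply Cmod_small_eq. intros e He.
  destruct (cderiv_bound _ _ _ H (e / 2)) as [d1 [Hd1 H1]]; [lra|].
  destruct (cderiv_bound _ _ _ K (e / 2)) as [d2 [Hd2 H2]]; [lra|].
  set (t := Rmin d1 d2 / 2).
  assert (Ht : 0 < t) by (unfold t; generalize (Rmin_pos _ _ Hd1 Hd2); lra).
  assert (Hm : Cmod (RtoC t) = t) by (apply Cmod_RtoC_pos; lra).
  specialize (H1 (RtoC t)). specialize (H2 (RtoC t)). rewrite Hm in *.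
  generalize (Rmin_l d1 d2) (Rmin_r d1 d2); intros M1 M2.
  assert (H3 : Cmod ((l - m) * RtoC t) <= e * t).
  { replace ((l - m) * RtoC t)%C with
      ((f (z + RtoC t)%C - f z - m * RtoC t) - (f (z + RtoC t)%C - f z - l * RtoC t))%C by ring.
    eapply Rle_trans; [apply Cmod_minus_le|].
    assert (t < d1) by (unfold t in *; lra). assert (t < d2) by (unfold t in *; lra).
    specialize (H1 H0). specialize (H2 H3). lra. }
  rewrite Cmod_mult, Hm in H3. now apply Rmult_le_reg_r with t.
Qed.

(** * Continuously differentiable functions on open sets *)

Definition copen (A : C -> Prop) : Prop :=
  forall z, A z -> exists d, 0 < d /\ forall w, Cmod (w - z) < d -> A w.

Definition disc (c : C) (r : R) (z : C) : Prop := Cmod (z - c) < r.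

Lemma copen_disc c r : copen (disc c r).
Proof.
  intros z Hz. exists (r - Cmod (z - c)). unfold disc in *. split; [lra|]. intros w Hw.
  generalize (Cmod_tri3 w z c). lra.
Qed.

Lemma disc0 r z : disc 0 r z <-> Cmod z < r.
Proof. unfold disc. now replace (z - 0)%C with z by ring. Qed.

Lemma disc_disk z : disc 0 1 z <-> disk z.
Proof. apply disc0. Qed.

Lemma copen_disk : copen disk.
Proof.
  intros z Hz. destruct (copen_disc 0 1 z) as [d [Hd H]]; [now apply disc_disk|].
  exists d. split; [exact Hd|]. intros w Hw. apply disc_disk. auto.
Qed.

(* With the derivative required to be continuous, Cauchy's formula needs no Goursat argument. *)
Definition hol (A : C -> Prop) (f : C -> C) : Prop :=
  exists df : C -> C, forall z, A z -> cderiv f z (df z) /\ ccont df z.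

Definition Cder (f : C -> C) (z : C) : C := epsilon (inhabits (RtoC 0)) (cderiv f z).

Lemma Cder_eq f z l : cderiv f z l -> Cder f z = l.
Proof.
  intro H. apply (cderiv_unique f z); [|exact H].
  unfold Cder. apply epsilon_spec. now exists l.
Qed.

Lemma hol_Cder A f z : hol A f -> A z -> cderiv f z (Cder f z).
Proof.
  intros [df H] Hz. destruct (H z Hz) as [H1 _]. now rewrite (Cder_eq _ _ _ H1).
Qed.

Lemma hol_ccont A f z : hol A f -> A z -> ccont f z.
Proof. intros H Hz. eapply cderiv_cont. eapply hol_Cder; eassumption. Qed.

Lemma hol_ccont_Cder A f z : copen A -> hol A f -> A z -> ccont (Cder f) z.
Proof.
  intros HA [df H] Hz. destruct (HA z Hz) as [d [Hd Hn]].
  apply ccont_ext_loc with df d; [exact Hd| |apply H; exact Hz].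
  intros w Hw. symmetry. apply Cder_eq. now apply H, Hn.
Qed.

Lemma hol_subset (A B : C -> Prop) f : (forall z, B z -> A z) -> hol A f -> hol B f.
Proof. intros S [df H]. exists df. auto. Qed.

(** Derivatives are unique, so the local ones all agree with [Cder f], which serves as a global
    witness. *)
Lemma hol_local A f : (forall z, A z -> exists r, 0 < r /\ hol (disc z r) f) -> hol A f.
Proof.
  intro H. exists (Cder f). intros z Hz. destruct (H z Hz) as [r [Hr K]].
  assert (D : disc z r z).
  { unfold disc. replace (z - z)%C with (RtoC 0) by ring. now rewrite Cmod_0. }
  split; [now apply (hol_Cder (disc z r))|].
  apply (hol_ccont_Cder (disc z r)); auto. apply copen_disc.
Qed.

Lemma hol_ext A f g : copen A -> (forall z, A z -> f z = g z) -> hol A f -> hol A g.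
Proof.
  intros HA E [df H]. exists df. intros z Hz. destruct (H z Hz) as [H1 H2].
  split; [|exact H2]. destruct (HA z Hz) as [d [Hd Hn]].
  apply (cderiv_ext_loc f _ _ _ d); auto.
Qed.

Lemma hol_const A k : hol A (fun _ => k).
Proof. exists (fun _ => (RtoC 0)). intros; split; [apply cderiv_const|apply ccont_const]. Qed.

Lemma hol_id A : hol A (fun z => z).
Proof. exists (fun _ => (RtoC 1)). intros; split; [apply cderiv_id|apply ccont_const]. Qed.

Lemma hol_plus A f g : hol A f -> hol A g -> hol A (fun z => f z + g z)%C.
Proof.
  intros [df Hf] [dg Hg]. exists (fun z => df z + dg z)%C. intros z Hz.
  destruct (Hf z Hz), (Hg z Hz). split; [now apply cderiv_plus|now apply ccont_plus].
Qed.

Lemma hol_mult A f g : hol A f -> hol A g -> hol A (fun z => f z * g z)%C.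
Proof.
  intros [df Hf] [dg Hg]. exists (fun z => df z * g z + f z * dg z)%C. intros z Hz.
  destruct (Hf z Hz), (Hg z Hz). split; [now apply cderiv_mult|].
  apply ccont_plus; apply ccont_mult; auto; eapply cderiv_cont; eassumption.
Qed.

Lemma hol_comp A B f g : hol A g -> hol B f -> (forall z, A z -> B (g z)) ->
  hol A (fun z => f (g z)).
Proof.
  intros [dg Hg] [df Hf] M. exists (fun z => df (g z) * dg z)%C. intros z Hz.
  destruct (Hg z Hz) as [G1 G2]. destruct (Hf (g z) (M z Hz)) as [F1 F2].
  split; [now apply (cderiv_comp f g)|]. apply ccont_mult; [|exact G2].
  apply ccont_comp; [eapply cderiv_cont; eassumption|exact F2].
Qed.

Lemma hol_Cinv : hol (fun z => z <> (RtoC 0)) Cinv.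
Proof.
  exists (fun z => - / (z * z))%C. intros z Hz. split; [now apply cderiv_inv|].
  apply (ccont_ext_loc (fun w => (- (1)) * / (w * w))%C) with 1; [lra|intros; ring|].
  apply ccont_mult; [apply ccont_const|]. apply (ccont_comp Cinv (fun w => w * w)%C).
  - apply ccont_mult; apply ccont_id.
  - apply ccont_inv. now apply Cmult_neq_0.
Qed.

Lemma hol_inv A f : hol A f -> (forall z, A z -> f z <> (RtoC 0)) -> hol A (fun z => / f z)%C.
Proof. intros H N. apply (hol_comp A (fun z => z <> (RtoC 0)) Cinv f); auto. apply hol_Cinv. Qed.

Lemma hol_div A f g : hol A f -> hol A g -> (forall z, A z -> g z <> (RtoC 0)) ->
  hol A (fun z => f z / g z)%C.
Proof. intros. unfold Cdiv. apply hol_mult; [assumption|]. now apply hol_inv. Qed.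

Lemma hol_scal A k f : hol A f -> hol A (fun z => k * f z)%C.
Proof. intro H. apply hol_mult; [apply hol_const|exact H]. Qed.

Lemma hol_opp A f : hol A f -> hol A (fun z => - f z)%C.
Proof.
  intros [df Hf]. exists (fun z => - df z)%C. intros z Hz. destruct (Hf z Hz) as [H1 H2].
  split; [now apply cderiv_opp|].
  apply (ccont_ext_loc (fun w => (- (1)) * df w)%C) with 1; [lra|intros; ring|].
  apply ccont_mult; [apply ccont_const|exact H2].
Qed.

Lemma hol_minus A f g : hol A f -> hol A g -> hol A (fun z => f z - g z)%C.
Proof. intros. apply hol_plus; [assumption|]. now apply hol_opp. Qed.

Lemma hol_pow A f k : hol A f -> hol A (fun z => f z ^ k)%C.
Proof. intro H. induction k; simpl; [apply hol_const|now apply hol_mult]. Qed.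

(** * Integrals of complex-valued functions of a real variable *)

Definition cint (f : R -> C) (a b : R) (l : C) : Prop :=
  is_RInt (V := C_R_NormedModule) f a b l.

Lemma cint_intro f a b l : is_RInt (fun t => Re (f t)) a b (Re l) ->
  is_RInt (fun t => Im (f t)) a b (Im l) -> cint f a b l.
Proof.
  intros H1 H2. destruct l as [x y]. unfold cint.
  exact (is_RInt_fct_extend_pair (U := R_NormedModule) (V := R_NormedModule) f a b x y H1 H2).
Qed.

Lemma cint_Re f a b l : cint f a b l -> is_RInt (fun t => Re (f t)) a b (Re l).
Proof. exact (is_RInt_fct_extend_fst (U := R_NormedModule) (V := R_NormedModule) f a b l). Qed.

Lemma cint_Im f a b l : cint f a b l -> is_RInt (fun t => Im (f t)) a b (Im l).
Proof. exact (is_RInt_fct_extend_snd (U := R_NormedModule) (V := R_NormedModule) f a b l). Qed.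

Lemma cint_RInt f a b l : cint f a b l -> RInt (V := C_R_CompleteNormedModule) f a b = l.
Proof. intro H. apply is_RInt_unique. exact H. Qed.

Lemma cint_unique f a b l m : cint f a b l -> cint f a b m -> l = m.
Proof. intros H K. rewrite <- (cint_RInt _ _ _ _ H). now apply cint_RInt. Qed.

Lemma cint_ext f g a b l : a <= b -> (forall t, a < t < b -> f t = g t) ->
  cint f a b l -> cint g a b l.
Proof.
  intros Hab E. apply is_RInt_ext. intros t Ht.
  rewrite Rmin_left, Rmax_right in Ht by exact Hab. auto.
Qed.

Lemma cint_plus f g a b l m : cint f a b l -> cint g a b m ->
  cint (fun t => f t + g t)%C a b (l + m)%C.
Proof. exact (is_RInt_plus (V := C_R_NormedModule) f g a b l m). Qed.

Lemma cint_Cmult k f a b l : cint f a b l -> cint (fun t => k * f t)%C a b (k * l)%C.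
Proof.
  intro H. generalize (cint_Re _ _ _ _ H) (cint_Im _ _ _ _ H); intros H1 H2.
  apply cint_intro.
  - exact (is_RInt_minus _ _ _ _ _ _ (is_RInt_scal _ _ _ (Re k) _ H1)
      (is_RInt_scal _ _ _ (Im k) _ H2)).
  - exact (is_RInt_plus _ _ _ _ _ _ (is_RInt_scal _ _ _ (Re k) _ H2)
      (is_RInt_scal _ _ _ (Im k) _ H1)).
Qed.

Lemma cint_minus f g a b l m : cint f a b l -> cint g a b m ->
  cint (fun t => f t - g t)%C a b (l - m)%C.
Proof. exact (is_RInt_minus (V := C_R_NormedModule) f g a b l m). Qed.

Lemma cint_const a b (k : C) : cint (fun _ => k) a b (RtoC (b - a) * k)%C.
Proof.
  apply cint_intro; rewrite ?Re_scal, ?Im_scal; exact (is_RInt_const (V := R_NormedModule) _ _ _).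
Qed.

Lemma cint_bound f a b l M : a < b -> (forall t, a < t < b -> Cmod (f t) <= M) ->
  cint f a b l -> Cmod l <= (b - a) * M.
Proof.
  intros Hab HM H.
  (* [norm_RInt_le_const] wants the bound at the endpoints as well. Cutting [f] off to zero there
     does not change the integral, and later integrands are not controlled at [0] when [j = -1]. *)
  set (g := fun t => if Rlt_dec a t then if Rlt_dec t b then f t else (RtoC 0) else (RtoC 0)).
  assert (M0 : 0 <= M).
  { eapply Rle_trans; [apply Cmod_ge_0|apply (HM ((a + b) / 2)); lra]. }
  assert (Hg : cint g a b l).
  { apply cint_ext with f; [lra| |exact H]. intros t Ht. unfold g.
    destruct (Rlt_dec a t); [|lra]. destruct (Rlt_dec t b); [reflexivity|lra]. }
  rewrite Cmod_norm. apply (norm_RInt_le_const g a b l M); [lra| |exact Hg].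
  intros t Ht. rewrite <- (Cmod_norm (g t)). unfold g.
  destruct (Rlt_dec a t); [|now rewrite Cmod_0].
  destruct (Rlt_dec t b); [apply HM; lra|now rewrite Cmod_0].
Qed.

(* A function of a real variable is regarded as a function of [w : C] that only depends
   on [Re w], so that the rules for [ccont] apply. *)
Definition rcont (g : R -> C) (t : R) : Prop := ccont (fun w => g (Re w)) (RtoC t).

Lemma ccont_Re z : ccont (fun w => RtoC (Re w)) z.
Proof.
  intros e He. exists e. split; [exact He|]. intros w Hw.
  rewrite <- RtoC_minus, Cmod_R, <- Re_minus. eapply Rle_lt_trans; [apply re_le_Cmod|exact Hw].
Qed.

Lemma rcont_eps g t : rcont g t <->
  forall e, 0 < e -> exists d, 0 < d /\ forall s, Rabs (s - t) < d -> Cmod (g s - g t) < e.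
Proof.
  split; intros H e He; destruct (H e He) as [d [Hd K]]; exists d; (split; [exact Hd|]).
  - intros s Hs. specialize (K (RtoC s)). rewrite <- RtoC_minus, Cmod_R in K. now apply K.
  - intros w Hw. rewrite Re_RtoC. apply K. rewrite <- (Re_RtoC t), <- Re_minus.
    eapply Rle_lt_trans; [apply re_le_Cmod|exact Hw].
Qed.

Lemma rcont_RtoC t : rcont RtoC t.
Proof. apply ccont_Re. Qed.

Lemma rcont_comp f g t : rcont g t -> ccont f (g t) -> rcont (fun s => f (g s)) t.
Proof. intros Hg Hf. apply (ccont_comp f (fun w => g (Re w))); [exact Hg|exact Hf]. Qed.

Lemma rcont_Re g t : rcont g t -> continuous (fun s => Re (g s)) t.
Proof.
  intro H. apply filterlim_locally. intros eps.
  destruct (proj1 (rcont_eps g t) H eps (cond_pos eps)) as [d [Hd K]].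
  exists (mkposreal d Hd). intros s Hs.
  change (Rabs (Re (g s) - Re (g t)) < eps). rewrite <- Re_minus.
  eapply Rle_lt_trans; [apply re_le_Cmod|]. apply K. exact Hs.
Qed.

Lemma rcont_Im g t : rcont g t -> continuous (fun s => Im (g s)) t.
Proof.
  intro H. apply filterlim_locally. intros eps.
  destruct (proj1 (rcont_eps g t) H eps (cond_pos eps)) as [d [Hd K]].
  exists (mkposreal d Hd). intros s Hs.
  change (Rabs (Im (g s) - Im (g t)) < eps). rewrite <- Im_minus.
  eapply Rle_lt_trans; [apply Im_le_Cmod|]. apply K. exact Hs.
Qed.

Lemma rcont_cint g a b : a <= b -> (forall t, a <= t <= b -> rcont g t) ->
  exists l, cint g a b l.
Proof.
  intros Hab H.
  destruct (ex_RInt_continuous (V := R_CompleteNormedModule) (fun t => Re (g t)) a b) as [x Hx].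
  { intros t Ht. rewrite Rmin_left, Rmax_right in Ht by exact Hab. now apply rcont_Re, H. }
  destruct (ex_RInt_continuous (V := R_CompleteNormedModule) (fun t => Im (g t)) a b) as [y Hy].
  { intros t Ht. rewrite Rmin_left, Rmax_right in Ht by exact Hab. now apply rcont_Im, H. }
  exists (x, y). now apply cint_intro.
Qed.

Lemma rcont_bounded g a b : a <= b -> (forall t, a <= t <= b -> rcont g t) ->
  exists B, 0 <= B /\ forall t, a <= t <= b -> Cmod (g t) <= B.
Proof.
  intros Hab H. destruct (continuity_ab_maj (fun t => Cmod (g t)) a b Hab) as [M [HM _]].
  - intros t Ht e He. destruct (proj1 (rcont_eps g t) (H t Ht) e He) as [d [Hd K]].
    exists d. split; [exact Hd|]. intros s [_ Hs]. simpl in *. unfold Rdist in *.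
    specialize (K s Hs). generalize (Cmod_tri_sub (g s) (g t)) (Cmod_tri_sub (g t) (g s)).
    rewrite (Cmod_sym (g t) (g s)). intros. apply Rabs_def1; lra.
  - exists (Cmod (g M)). split; [apply Cmod_ge_0|exact HM].
Qed.

(** * Differentiation along a real parameter *)

Definition rderiv (g : R -> C) (t : R) (l : C) : Prop :=
  is_derive (fun s => Re (g s)) t (Re l) /\ is_derive (fun s => Im (g s)) t (Im l).

Lemma rderiv_quotient g t l : rderiv g t l ->
  exists psi, psi t = l /\ rcont psi t /\ forall s, g s = (g t + psi s * RtoC (s - t))%C.
Proof.
  intros [H1 H2]. apply is_derive_Reals in H1. apply is_derive_Reals in H2.
  exists (fun s => if Req_EM_T s t then l else (g s - g t) / RtoC (s - t))%C.
  split; [destruct (Req_EM_T t t); congruence|]. split.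
  - apply rcont_eps. intros e He.
    destruct (H1 (e / 2)) as [d1 K1]; [lra|]. destruct (H2 (e / 2)) as [d2 K2]; [lra|].
    exists (Rmin d1 d2). split; [apply Rmin_pos; apply cond_pos|]. intros s Hs.
    destruct (Req_EM_T t t); [|congruence]. destruct (Req_EM_T s t) as [->|n].
    + replace (l - l)%C with (RtoC 0) by ring. now rewrite Cmod_0.
    + assert (Hn : s - t <> 0) by lra.
      specialize (K1 (s - t) Hn). specialize (K2 (s - t) Hn).
      replace (t + (s - t)) with s in K1, K2 by ring.
      generalize (Rmin_l d1 d2) (Rmin_r d1 d2); intros.
      eapply Rle_lt_trans; [apply Cmod_le_Re_Im|].
      replace ((g s - g t) / RtoC (s - t) - l)%C with
        (RtoC (/ (s - t)) * (g s - g t) - l)%C.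
      2:{ rewrite RtoC_inv by exact Hn. unfold Cdiv. ring. }
      rewrite Re_minus, Im_minus, Re_scal, Im_scal, Re_minus, Im_minus.
      unfold Rdiv in K1, K2.
      rewrite (Rmult_comm (/ (s - t))), (Rmult_comm (/ (s - t))).
      assert (Rabs (s - t) < d1) by lra. assert (Rabs (s - t) < d2) by lra.
      specialize (K1 H3). specialize (K2 H4). lra.
  - intros s. destruct (Req_EM_T s t) as [->|n].
    + replace (t - t) with 0 by ring. ring.
    + field. intro E. apply RtoC_inj in E. lra.
Qed.

Lemma rderiv_of_quotient g t l psi : psi t = l -> rcont psi t ->
  (exists d, 0 < d /\ forall s, Rabs (s - t) < d -> g s = (g t + psi s * RtoC (s - t))%C) ->
  rderiv g t l.
Proof.
  intros H1 H2 [d0 [Hd0 H3]].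
  assert (Q : forall e, 0 < e -> exists d, 0 < d /\ forall h, h <> 0 -> Rabs h < d ->
    Cmod ((g (t + h)%R - g t) / RtoC h - l) < e).
  { intros e He. destruct (proj1 (rcont_eps _ _) H2 e He) as [d [Hd K]].
    exists (Rmin d0 d). split; [now apply Rmin_pos|]. intros h Hn Hh.
    generalize (Rmin_l d0 d) (Rmin_r d0 d); intros.
    assert (E : t + h - t = h) by ring.
    rewrite (H3 (t + h)) by (rewrite E; lra). rewrite E.
    replace ((g t + psi (t + h)%R * RtoC h - g t) / RtoC h - l)%C with (psi (t + h)%R - psi t)%C.
    - apply K. rewrite E. lra.
    - rewrite H1. field. intro N. apply RtoC_inj in N. lra. }
  assert (S : forall h, h <> 0 -> ((g (t + h)%R - g t) / RtoC h)%C =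
     (RtoC (/ h) * (g (t + h)%R - g t))%C).
  { intros h Hh. rewrite RtoC_inv by exact Hh. unfold Cdiv. ring. }
  split; apply is_derive_Reals; intros e He; destruct (Q e He) as [d [Hd K]];
    exists (mkposreal d Hd); intros h Hn Hh; simpl in Hh; specialize (K h Hn Hh);
    rewrite S in K by exact Hn.
  - eapply Rle_lt_trans; [|exact K]. eapply Rle_trans; [|apply re_le_Cmod].
    rewrite Re_minus, Re_scal, Re_minus. right. f_equal. unfold Rdiv. ring.
  - eapply Rle_lt_trans; [|exact K]. eapply Rle_trans; [|apply Im_le_Cmod].
    rewrite Im_minus, Im_scal, Im_minus. right. f_equal. unfold Rdiv. ring.
Qed.

Lemma rderiv_rcont g t l : rderiv g t l -> rcont g t.
Proof.
  intro H. destruct (rderiv_quotient _ _ _ H) as [psi [H1 [H2 H3]]].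
  apply (ccont_ext_loc (fun w => g t + psi (Re w) * (RtoC (Re w) - RtoC t))%C) with 1; [lra| |].
  - intros w _. rewrite <- RtoC_minus. now rewrite <- H3.
  - apply ccont_plus; [apply ccont_const|]. apply ccont_mult; [exact H2|].
    unfold Cminus. apply ccont_plus; [apply ccont_Re|apply ccont_const].
Qed.

Lemma rderiv_comp f g t l m : rderiv g t m -> cderiv f (g t) l ->
  rderiv (fun s => f (g s)) t (l * m).
Proof.
  intros Hg [phi [P1 [P2 [d [Hd P3]]]]].
  generalize (rderiv_rcont _ _ _ Hg); intro Cg.
  destruct (rderiv_quotient _ _ _ Hg) as [psi [H1 [H2 H3]]].
  destruct (proj1 (rcont_eps _ _) Cg d Hd) as [d' [Hd' K]].
  apply rderiv_of_quotient with (fun s => phi (g s) * psi s)%C.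
  - now rewrite H1, P1.
  - apply ccont_mult; [|exact H2]. now apply rcont_comp.
  - exists d'. split; [exact Hd'|]. intros s Hs.
    rewrite (P3 (g s) (K s Hs)). rewrite (H3 s) at 2. ring.
Qed.

Lemma rderiv_lin (p q : C) t : rderiv (fun s => p + RtoC s * q)%C t q.
Proof.
  apply rderiv_of_quotient with (fun _ => q); [reflexivity|apply ccont_const|].
  exists 1. split; [lra|]. intros s _. rewrite RtoC_minus. ring.
Qed.

Lemma cint_derive g dg a b : a <= b -> (forall t, a <= t <= b -> rderiv g t (dg t)) ->
  (forall t, a <= t <= b -> rcont dg t) -> cint dg a b (g b - g a)%C.
Proof.
  intros Hab H1 H2. apply cint_intro.
  - apply (is_RInt_derive (V := R_CompleteNormedModule) (fun t => Re (g t)) (fun t => Re (dg t)) a b);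
      intros t Ht; rewrite Rmin_left, Rmax_right in Ht by exact Hab.
    + now apply H1.
    + now apply rcont_Re, H2.
  - apply (is_RInt_derive (V := R_CompleteNormedModule) (fun t => Im (g t)) (fun t => Im (dg t)) a b);
      intros t Ht; rewrite Rmin_left, Rmax_right in Ht by exact Hab.
    + now apply H1.
    + now apply rcont_Im, H2.
Qed.

(* The pair of real parameters [(u, t)] is encoded as the complex number [u + i t] in the
   continuity hypothesis. *)
Lemma cint_param_const (G dG : R -> R -> C) (a b eta : R) (J : R -> C) :
  a <= b -> 0 < eta ->
  (forall u t, - eta < u < 1 + eta -> rderiv (fun v => G v t) u (dG u t)) ->
  (forall u t, - eta < u < 1 + eta -> ccont (fun w => dG (Re w) (Im w)) (u, t)) ->
  (forall u, 0 <= u <= 1 -> cint (dG u) a b 0) ->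
  (forall u, - eta < u < 1 + eta -> cint (G u) a b (J u)) ->
  J 0 = J 1.
Proof.
  intros Hab Heta HD HC H0 HI.
  (* The coordinate [pr] stands for [Re] or [Im]. Differentiation under the integral sign shows that
     the integral has derivative [0], and the mean value theorem concludes. *)
  assert (Key : forall (pr : C -> R) (K : R -> R),
    (forall x y, pr (x - y)%C = pr x - pr y) -> (forall x, Rabs (pr x) <= Cmod x) ->
    (forall u t, - eta < u < 1 + eta -> is_derive (fun v => pr (G v t)) u (pr (dG u t))) ->
    (forall u, 0 <= u <= 1 -> is_RInt (fun t => pr (dG u t)) a b 0) ->
    (forall u, - eta < u < 1 + eta -> is_RInt (fun t => pr (G u t)) a b (K u)) ->
    K 0 = K 1).
  { intros pr K Hlin Hle Hder Hz HK.
    assert (DK : forall u, 0 <= u <= 1 ->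
       is_derive (fun v => RInt (fun t => pr (G v t)) a b) u 0).
    { intros u Hu.
      assert (E : RInt (fun t => Derive (fun v => pr (G v t)) u) a b = 0).
      { rewrite (RInt_ext _ (fun t => pr (dG u t))).
        - apply is_RInt_unique. now apply Hz.
        - intros t Ht. apply is_derive_unique. apply Hder; lra. }
      rewrite <- E. apply (is_derive_RInt_param (fun v t => pr (G v t)) a b u).
      - exists (mkposreal eta Heta). intros v Hv t Ht.
        change (Rabs (v - u) < eta) in Hv. apply Rabs_def2 in Hv.
        eexists. apply Hder. lra.
      - intros t Ht. apply continuity_2d_pt_ext_loc with (fun v s => pr (dG v s)).
        { exists (mkposreal eta Heta). intros v s Hv _. simpl in Hv. apply Rabs_def2 in Hv.
          symmetry. apply is_derive_unique. apply Hder. lra. }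
        intros [e He]. destruct (HC u t) with (e := e) as [d [Hd Hc]]; [lra|exact He|].
        assert (Hd2 : 0 < d / 2) by lra.
        exists (mkposreal (d / 2) Hd2).
        simpl. intros v s Hv Hs. rewrite <- Hlin. eapply Rle_lt_trans; [apply Hle|].
        apply (Hc (v, s)). eapply Rle_lt_trans; [apply Cmod_le_Re_Im|].
        rewrite Re_minus, Im_minus. simpl. lra.
      - exists (mkposreal eta Heta). intros v Hv. change (Rabs (v - u) < eta) in Hv.
        apply Rabs_def2 in Hv. eexists. apply HK. lra. }
    rewrite <- (is_RInt_unique _ _ _ _ (HK 0 ltac:(lra))).
    rewrite <- (is_RInt_unique _ _ _ _ (HK 1 ltac:(lra))).
    destruct (MVT_gen (fun v => RInt (fun t => pr (G v t)) a b) 0 1 (fun _ => 0)) as [x [_ Hx]].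
    - intros u Hu. rewrite Rmin_left, Rmax_right in Hu by lra. apply DK. lra.
    - intros u Hu. rewrite Rmin_left, Rmax_right in Hu by lra.
      apply derivable_continuous_pt. exists 0. apply is_derive_Reals. apply DK. lra.
    - lra. }
  apply C_ext.
  - apply (Key Re (fun u => Re (J u))).
    + intros; reflexivity.
    + apply re_le_Cmod.
    + intros u t Hu. now apply HD.
    + intros u Hu. exact (cint_Re _ _ _ _ (H0 u Hu)).
    + intros u Hu. exact (cint_Re _ _ _ _ (HI u Hu)).
  - apply (Key Im (fun u => Im (J u))).
    + intros; reflexivity.
    + apply Im_le_Cmod.
    + intros u t Hu. now apply HD.
    + intros u Hu. exact (cint_Im _ _ _ _ (H0 u Hu)).
    + intros u Hu. exact (cint_Im _ _ _ _ (HI u Hu)).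
Qed.

(** * Cauchy's formula *)

Definition circ (r t : R) : C := (r * cos t, r * sin t).

Lemma Cmod_circ r t : 0 <= r -> Cmod (circ r t) = r.
Proof.
  intro Hr. unfold Cmod, circ. simpl.
  replace (r * cos t * (r * cos t * 1) + r * sin t * (r * sin t * 1)) with (r * r).
  - now apply sqrt_square.
  - generalize (sin2_cos2 t). unfold Rsqr. intro E.
    transitivity (r * r * (sin t * sin t + cos t * cos t)); [rewrite E|]; ring.
Qed.

Lemma circ_neq0 r t : 0 < r -> circ r t <> RtoC 0.
Proof. intro Hr. apply Cmod_gt_0. rewrite Cmod_circ; lra. Qed.

Lemma circ_period r : circ r (2 * PI) = circ r 0.
Proof. unfold circ. now rewrite sin_2PI, cos_2PI, sin_0, cos_0. Qed.

Lemma rderiv_circ r t : rderiv (circ r) t (Ci * circ r t)%C.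
Proof.
  split; simpl; auto_derive; auto; ring.
Qed.

Lemma ccont_circ_Im r z : ccont (fun w => circ r (Im w)) z.
Proof.
  intros e He. destruct (proj1 (rcont_eps (circ r) (Im z)) (rderiv_rcont _ _ _ (rderiv_circ r (Im z))) e He)
    as [d [Hd K]].
  exists d. split; [exact Hd|]. intros w Hw. apply K. rewrite <- Im_minus.
  eapply Rle_lt_trans; [apply Im_le_Cmod|exact Hw].
Qed.

Lemma rcont_circ_comp H r t : ccont H (circ r t) -> rcont (fun s => H (circ r s)) t.
Proof. apply rcont_comp. eapply rderiv_rcont. apply rderiv_circ. Qed.

(** Differentiating in [u] at the ends of [[0, 1]] needs room on both sides. Since [|x - z| < 2 r],
    prolonging the segment by the fraction [(R0 - r) / (2 r)] adds less than [R0 - r] to the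
    modulus. *)
Lemma Cmod_segment_lt (z x : C) (r R0 u : R) : 0 < r -> Cmod z < r -> r < R0 -> Cmod x = r ->
  - ((R0 - r) / (2 * r)) < u < 1 + (R0 - r) / (2 * r) -> Cmod (z + RtoC u * (x - z)) < R0.
Proof.
  intros Hr Hz HR Hx Hu. set (eta := (R0 - r) / (2 * r)) in *.
  assert (He : eta * (2 * r) = R0 - r) by (unfold eta; field; lra).
  assert (Hep : 0 < eta) by (apply Rdiv_lt_0_compat; lra).
  replace (z + RtoC u * (x - z))%C with (RtoC u * x + RtoC (1 - u) * z)%C
    by (rewrite RtoC_minus; ring).
  eapply Rle_lt_trans; [apply Cmod_triangle|]. rewrite !Cmod_mult, !Cmod_R, Hx.
  generalize (Cmod_ge_0 z). intro Hz0.
  destruct (Rle_lt_dec 0 u).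
  - rewrite (Rabs_pos_eq u) by lra. destruct (Rle_lt_dec u 1).
    + rewrite Rabs_pos_eq by lra. nra.
    + rewrite Rabs_left by lra. nra.
  - rewrite Rabs_left, Rabs_pos_eq by lra. nra.
Qed.

(** The circle is contracted to [z]: with [x = circ r t], the integral of
    [f (z + u (x - z)) x / (x - z)] does not depend on [u], because its derivative in [u] integrates
    [f' (z + u (x - z)) x] over a closed curve. The value at [u = 1] is the Cauchy integral, the one
    at [u = 0] is [f z * l]; the number [l] is evaluated separately. *)
Lemma circ_integral_eq R0 f z r : hol (disc 0 R0) f -> 0 < r -> Cmod z < r -> r < R0 ->
  exists l m, cint (fun t => circ r t / (circ r t - z))%C 0 (2 * PI) l /\
    cint (fun t => f (circ r t) * (circ r t / (circ r t - z)))%C 0 (2 * PI) m /\ m = (f z * l)%C.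
Proof.
  intros Hf Hr Hz HR. generalize PI_RGT_0; intro Hpi.
  set (eta := (R0 - r) / (2 * r)).
  assert (Heta : 0 < eta) by (apply Rdiv_lt_0_compat; lra).
  assert (Hin : forall u t, - eta < u < 1 + eta -> disc 0 R0 (z + RtoC u * (circ r t - z))%C).
  { intros u t Hu. apply disc0. apply Cmod_segment_lt with r; auto. apply Cmod_circ; lra. }
  assert (Hne : forall t, (circ r t - z)%C <> RtoC 0).
  { intros t E. assert (circ r t = z) by (replace (circ r t) with (circ r t - z + z)%C by ring; rewrite E; ring).
    generalize (Cmod_circ r t). rewrite H. lra. }
  set (k := fun t => (circ r t / (circ r t - z))%C).
  set (G := fun u t => (f (z + RtoC u * (circ r t - z))%C * k t)%C).
  set (dG := fun u t => (Cder f (z + RtoC u * (circ r t - z))%C * circ r t)%C).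
  assert (Hk : forall t, rcont k t).
  { intro t. apply (rcont_circ_comp (fun w => w / (w - z))%C).
    unfold Cdiv. apply ccont_mult; [apply ccont_id|]. apply (ccont_comp Cinv (fun w => w - z)%C).
    - unfold Cminus. apply ccont_plus; [apply ccont_id|apply ccont_const].
    - apply ccont_inv. apply Hne. }
  assert (HG : forall u, - eta < u < 1 + eta -> exists l, cint (G u) 0 (2 * PI) l).
  { intros u Hu. apply rcont_cint; [lra|]. intros t _. unfold G.
    apply ccont_mult; [|apply Hk].
    apply (rcont_circ_comp (fun w => f (z + RtoC u * (w - z))%C)).
    apply (ccont_comp f (fun w => z + RtoC u * (w - z))%C).
    - unfold Cminus. repeat first [apply ccont_plus|apply ccont_mult|apply ccont_const|apply ccont_id].
    - apply (hol_ccont _ _ _ Hf). now apply Hin. }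
  set (J := fun u => RInt (V := C_R_CompleteNormedModule) (G u) 0 (2 * PI)).
  assert (HJ : forall u, - eta < u < 1 + eta -> cint (G u) 0 (2 * PI) (J u)).
  { intros u Hu. destruct (HG u Hu) as [l Hl]. unfold J. now rewrite (cint_RInt _ _ _ _ Hl). }
  destruct (rcont_cint k 0 (2 * PI)) as [l Hl]; [lra|intros; apply Hk|].
  exists l, (J 1). split; [exact Hl|].
  assert (E1 : forall t, G 1 t = (f (circ r t) * k t)%C).
  { intro t. unfold G. f_equal. f_equal. ring. }
  split.
  { apply cint_ext with (G 1); [lra| |apply HJ; lra]. intros t _. apply E1. }
  rewrite <- (cint_param_const G dG 0 (2 * PI) eta J); try assumption; try lra.
  - apply cint_unique with (G 0) 0 (2 * PI); [apply HJ; lra|].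
    apply cint_ext with (fun t => f z * k t)%C; [lra| |now apply cint_Cmult].
    intros t _. unfold G. f_equal. f_equal. ring.
  - intros u t Hu.
    replace (dG u t) with ((Cder f (z + RtoC u * (circ r t - z)) * k t) * (circ r t - z))%C.
    2:{ unfold dG, k. field. apply Hne. }
    apply (rderiv_comp (fun w => f w * k t)%C (fun v => z + RtoC v * (circ r t - z))%C).
    + apply rderiv_lin.
    + eapply cderiv_eq; [|apply cderiv_mult; [|apply cderiv_const]].
      2:{ apply (hol_Cder _ _ _ Hf). now apply Hin. }
      cbv beta. ring.
  - intros u t Hu. unfold dG. apply ccont_mult; [|apply ccont_circ_Im].
    apply (ccont_comp (Cder f) (fun w => z + RtoC (Re w) * (circ r (Im w) - z))%C).
    + unfold Cminus.
      repeat first [apply ccont_plus|apply ccont_mult|apply ccont_const|apply ccont_Re|apply ccont_circ_Im].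
    + apply (hol_ccont_Cder (disc 0 R0) f); [apply copen_disc|exact Hf|now apply Hin].
  - intros u Hu.
    assert (Cd : forall t, rcont (dG u) t).
    { intro t. unfold dG. apply (rcont_circ_comp (fun w => Cder f (z + RtoC u * (w - z)) * w)%C).
      apply ccont_mult; [|apply ccont_id].
      apply (ccont_comp (Cder f) (fun w => z + RtoC u * (w - z))%C).
      - unfold Cminus. repeat first [apply ccont_plus|apply ccont_mult|apply ccont_const|apply ccont_id].
      - apply (hol_ccont_Cder (disc 0 R0) f); [apply copen_disc|exact Hf|apply Hin; lra]. }
    (* As [circ r] has derivative [i * circ r], a primitive is [- (i / u) f (z + u (x - z))] for
       [u <> 0]. For [u = 0] the integrand is a constant times [x] and needs a primitive of its
       own. *)
    assert (Prim : exists g, g (circ r (2 * PI)) = g (circ r 0) /\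
       forall t, rderiv (fun s => g (circ r s)) t (dG u t)).
    { destruct (Req_EM_T u 0) as [->|Hu0].
      - exists (fun w => Cder f z * - Ci * w)%C. split; [now rewrite circ_period|]. intro t.
        replace (dG 0 t) with ((Cder f z * - Ci) * (Ci * circ r t))%C.
        2:{ unfold dG. replace (z + RtoC 0 * (circ r t - z))%C with z by ring.
            transitivity (Cder f z * circ r t * - (Ci * Ci))%C; [ring|].
            replace (Ci * Ci)%C with (RtoC (-1)) by (apply C_ext; simpl; ring).
            rewrite <- RtoC_opp. replace (- -1) with 1 by ring. ring. }
        apply (rderiv_comp (fun w => Cder f z * - Ci * w)%C (circ r)); [apply rderiv_circ|].
        eapply cderiv_eq; [|apply cderiv_scal; apply cderiv_id]. ring.
      - assert (Hu1 : RtoC u <> RtoC 0) by (intro E; apply RtoC_inj in E; lra).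
        exists (fun w => - Ci / RtoC u * f (z + RtoC u * (w - z))%C)%C.
        split; [now rewrite circ_period|]. intro t.
        replace (dG u t) with
          ((- Ci / RtoC u * (Cder f (z + RtoC u * (circ r t - z))%C * (RtoC u * 1))) * (Ci * circ r t))%C.
        2:{ unfold dG. set (D := Cder f _).
            transitivity (D * circ r t * - (Ci * Ci))%C; [field; exact Hu1|].
            replace (Ci * Ci)%C with (RtoC (-1)) by (apply C_ext; simpl; ring).
            rewrite <- RtoC_opp. replace (- -1) with 1 by ring. ring. }
        apply (rderiv_comp (fun w => - Ci / RtoC u * f (z + RtoC u * (w - z))%C)%C (circ r));
          [apply rderiv_circ|].
        apply cderiv_scal. apply (cderiv_comp f (fun w => z + RtoC u * (w - z))%C).
        + eapply cderiv_eq; [|apply cderiv_plus; [apply cderiv_const|apply cderiv_scal;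
            apply cderiv_minus; [apply cderiv_id|apply cderiv_const]]]. ring.
        + apply (hol_Cder _ _ _ Hf). apply Hin. lra. }
    destruct Prim as [g [Eg Hg]].
    replace (RtoC 0) with (g (circ r (2 * PI)) - g (circ r 0))%C by (rewrite Eg; ring).
    apply (cint_derive (fun s => g (circ r s))); [lra|intros; apply Hg|intros; apply Cd].
Qed.

Lemma circ_kernel_rcont f z r t : ccont f (circ r t) -> 0 < r -> Cmod z < r ->
  rcont (fun s => f (circ r s) * (circ r s / (circ r s - z)))%C t.
Proof.
  intros Hf Hr Hz. apply (rcont_circ_comp (fun w => f w * (w / (w - z)))%C).
  apply ccont_mult; [exact Hf|]. unfold Cdiv. apply ccont_mult; [apply ccont_id|].
  apply (ccont_comp Cinv (fun w => w - z)%C).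
  - unfold Cminus. apply ccont_plus; [apply ccont_id|apply ccont_const].
  - apply ccont_inv. intro E.
    assert (circ r t = z) by (replace (circ r t) with (circ r t - z + z)%C by ring; rewrite E; ring).
    generalize (Cmod_circ r t). rewrite H. lra.
Qed.

Lemma circ_minus_lower z r t : 0 < r -> Cmod z < r -> r - Cmod z <= Cmod (circ r t - z).
Proof.
  intros Hr Hz. generalize (Cmod_tri_sub (circ r t) z). rewrite Cmod_circ by lra. lra.
Qed.

Lemma circ_minus_neq z r t : 0 < r -> Cmod z < r -> (circ r t - z)%C <> RtoC 0.
Proof.
  intros Hr Hz. apply Cmod_gt_0. generalize (circ_minus_lower z r t Hr Hz). lra.
Qed.

(** A finite geometric expansion of [x / (x - z)] in [z / x] with exact remainder, so that no
    interchange of sum and integral occurs. It is used with [f = 1] to evaluate the kernel, and then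
    to expand the Cauchy integral. *)
Lemma circ_integral_expand f B z r m :
  (forall t, ccont f (circ r t)) -> 0 < r -> Cmod z < r ->
  (forall t, Cmod (f (circ r t)) <= B) ->
  cint (fun t => f (circ r t) * (circ r t / (circ r t - z)))%C 0 (2 * PI) m ->
  forall N, exists e,
    m = (sum_n (fun k => RInt (V := C_R_CompleteNormedModule)
           (fun t => f (circ r t) * / circ r t ^ k)%C 0 (2 * PI) * z ^ k)%C N + e)%C /\
    Cmod e <= 2 * PI * (B * (r / (r - Cmod z)) * (Cmod z / r) ^ S N).
Proof.
  intros Hf Hr Hz HB Hm N. generalize PI_RGT_0; intro Hpi.
  set (q := fun t => (z / circ r t)%C).
  assert (Hc0 : forall t, circ r t <> RtoC 0) by (intro; now apply circ_neq0).
  assert (Step : forall k, exists e,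
    cint (fun t => f (circ r t) * (circ r t / (circ r t - z)) * q t ^ S k)%C 0 (2 * PI) e /\
    m = (sum_n (fun k => RInt (V := C_R_CompleteNormedModule)
           (fun t => f (circ r t) * / circ r t ^ k)%C 0 (2 * PI) * z ^ k)%C k + e)%C).
  (* One term is split off by [x / (x - z) = 1 + (x / (x - z)) (z / x)]. *)
  { assert (Aux : forall k e, cint (fun t => f (circ r t) * (circ r t / (circ r t - z)) * q t ^ k)%C 0 (2 * PI) e ->
      exists e', cint (fun t => f (circ r t) * (circ r t / (circ r t - z)) * q t ^ S k)%C 0 (2 * PI) e' /\
        e = (RInt (V := C_R_CompleteNormedModule)
           (fun t => f (circ r t) * / circ r t ^ k)%C 0 (2 * PI) * z ^ k + e')%C).
    { intros k e He.
      destruct (rcont_cint (fun t => f (circ r t) * / circ r t ^ k)%C 0 (2 * PI)) as [a Ha]; [lra| |].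
      { intros t _. apply (rcont_circ_comp (fun w => f w * / w ^ k)%C). apply ccont_mult; [apply Hf|].
        apply (ccont_comp Cinv (fun w => w ^ k)%C).
        - clear. induction k; simpl; [apply ccont_const|apply ccont_mult; [apply ccont_id|assumption]].
        - apply ccont_inv. apply Cpow_nz. apply Hc0. }
      exists (e - a * z ^ k)%C. rewrite (cint_RInt _ _ _ _ Ha). split; [|ring].
      apply cint_ext with (fun t => f (circ r t) * (circ r t / (circ r t - z)) * q t ^ k -
         z ^ k * (f (circ r t) * / circ r t ^ k))%C; [lra| |].
      - intros t _. assert (E : (q t ^ k)%C = (z ^ k * / circ r t ^ k)%C).
        { unfold q, Cdiv. rewrite Cpow_mult_l, Cpow_inv by apply Hc0. reflexivity. }
        simpl Cpow. rewrite E. unfold q. field. repeat split.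
        + apply Cpow_nz. apply Hc0.
        + apply Hc0.
        + now apply circ_minus_neq.
      - rewrite (Cmult_comm a). apply cint_minus; [exact He|]. now apply cint_Cmult. }
    induction k as [|k [e [He IH]]].
    - destruct (Aux 0%nat m) as [e [He E]].
      { apply cint_ext with (fun t => f (circ r t) * (circ r t / (circ r t - z)))%C; [lra| |exact Hm].
        intros t _. simpl. ring. }
      exists e. split; [exact He|]. rewrite sum_O. exact E.
    - destruct (Aux (S k) e He) as [e' [He' E]]. exists e'. split; [exact He'|].
      rewrite sum_Sn. rewrite IH, E. change plus with Cplus. ring. }
  destruct (Step N) as [e [He E]]. exists e. split; [exact E|].
  replace (2 * PI) with (2 * PI - 0) by ring.
  eapply cint_bound; [lra| |exact He]. intros t _. unfold q.
  assert (Hn : (circ r t - z)%C <> RtoC 0) by now apply circ_minus_neq.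
  rewrite !Cmod_mult, Cmod_pow, !Cmod_div by auto. rewrite Cmod_circ by lra.
  generalize (circ_minus_lower z r t Hr Hz); intro Hl.
  apply Rmult_le_compat_r.
  { apply pow_le. apply Rdiv_le_0_compat; [apply Cmod_ge_0|exact Hr]. }
  apply Rmult_le_compat; [apply Cmod_ge_0| |apply HB|].
  - apply Rdiv_le_0_compat; lra.
  - apply Rmult_le_compat_l; [lra|]. apply Rinv_le_contravar; lra.
Qed.

Lemma geom_lt_eps A q e : 0 <= A -> 0 <= q < 1 -> 0 < e ->
  exists N, forall n, (N <= n)%nat -> A * q ^ S n < e.
Proof.
  intros HA Hq He.
  assert (He' : 0 < e / (A + 1)) by (apply Rdiv_lt_0_compat; lra).
  destruct (pow_lt_1_zero q) with (y := e / (A + 1)) as [N HN].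
  { rewrite Rabs_pos_eq; lra. } { exact He'. }
  exists N. intros n Hn. specialize (HN (S n) ltac:(lia)).
  assert (Hp : 0 <= q ^ S n) by (apply pow_le; lra).
  rewrite Rabs_pos_eq in HN by exact Hp.
  apply Rle_lt_trans with ((A + 1) * q ^ S n); [nra|].
  replace e with ((A + 1) * (e / (A + 1))) by (field; lra).
  apply Rmult_lt_compat_l; lra.
Qed.

(** In the expansion for [f = 1] each power [x^(-k)] with [k > 0] has a primitive on the circle and
    integrates to [0]; the remainder tends to [0], and only the constant term is left. *)
Lemma kernel_integral z r : 0 < r -> Cmod z < r ->
  cint (fun t => circ r t / (circ r t - z))%C 0 (2 * PI) (RtoC (2 * PI)).
Proof.
  intros Hr Hz. generalize PI_RGT_0; intro Hpi.
  destruct (rcont_cint (fun t => RtoC 1 * (circ r t / (circ r t - z)))%C 0 (2 * PI)) as [m Hm]; [lra| |].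
  { intros t _. apply (circ_kernel_rcont (fun _ => RtoC 1)); auto. apply ccont_const. }
  assert (E : m = RtoC (2 * PI)).
  { apply Cmod_small_eq. intros e He.
    destruct (geom_lt_eps (2 * PI * (1 * (r / (r - Cmod z)))) (Cmod z / r) e) as [N HN]; [| |exact He|].
    - apply Rmult_le_pos; [lra|]. rewrite Rmult_1_l. apply Rdiv_le_0_compat; lra.
    - split; [apply Rdiv_le_0_compat; [apply Cmod_ge_0|lra]|].
      apply Rmult_lt_reg_r with r; [lra|]. unfold Rdiv. rewrite Rmult_assoc, Rinv_l by lra. lra.
    - destruct (circ_integral_expand (fun _ => RtoC 1) 1 z r m) with (N := N) as [x [Ex Bx]]; auto.
      { intros; apply ccont_const. } { intros; rewrite Cmod_1; lra. }
      replace (m - RtoC (2 * PI))%C with x.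
      { eapply Rle_trans; [exact Bx|]. rewrite <- Rmult_assoc. left. apply HN. lia. }
      rewrite Ex. match goal with |- x = (?s + x - _)%C => replace s with (RtoC (2 * PI)); [ring|] end.
      clear - Hr Hpi. induction N as [|N IH].
      + rewrite sum_O. simpl Cpow.
        rewrite (cint_RInt _ 0 (2 * PI) (RtoC (2 * PI - 0) * RtoC 1)%C).
        * rewrite Rminus_0_r. ring.
        * apply cint_ext with (fun _ => RtoC 1); [lra| |apply cint_const]. intros; field.
      + rewrite sum_Sn, <- IH. change plus with Cplus.
        rewrite (cint_RInt _ 0 (2 * PI) (RtoC 0)); [ring|].
        set (g := fun w => (Ci / RtoC (INR (S N)) * / (w ^ S N))%C).
        assert (HN : RtoC (INR (S N)) <> RtoC 0).
        { intro E. apply RtoC_inj in E. generalize (pos_INR N). rewrite S_INR in E. lra. }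
        replace (RtoC 0) with (g (circ r (2 * PI)) - g (circ r 0))%C by (rewrite circ_period; ring).
        apply (cint_derive (fun s => g (circ r s))); [lra| |].
        * intros t _. assert (Hn : circ r t <> RtoC 0) by now apply circ_neq0.
          replace (RtoC 1 * / circ r t ^ S N)%C with
            (Ci / RtoC (INR (S N)) * (- / (circ r t ^ S N * circ r t ^ S N) * (RtoC (INR (S N)) * circ r t ^ N * 1))
              * (Ci * circ r t))%C.
          2:{ transitivity (- (Ci * Ci) * / (circ r t ^ S N))%C.
              - simpl Cpow. field. repeat split; auto. now apply Cpow_nz.
              - replace (Ci * Ci)%C with (RtoC (-1)) by (apply C_ext; simpl; ring).
                rewrite <- RtoC_opp. f_equal. f_equal. ring. }
          apply (rderiv_comp g (circ r)); [apply rderiv_circ|]. unfold g. apply cderiv_scal.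
          apply (cderiv_comp Cinv (fun w => w ^ S N)%C).
          -- apply (cderiv_pow (fun w => w)). apply cderiv_id.
          -- apply cderiv_inv. now apply Cpow_nz.
        * intros t _. apply (rcont_circ_comp (fun w => RtoC 1 * / w ^ S N)%C).
          apply ccont_mult; [apply ccont_const|]. apply (ccont_comp Cinv (fun w => w ^ S N)%C).
          -- clear. induction (S N); simpl; [apply ccont_const|apply ccont_mult; [apply ccont_id|assumption]].
          -- apply ccont_inv. apply Cpow_nz. now apply circ_neq0. }
  rewrite <- E. apply cint_ext with (2 := fun t _ => Cmult_1_l _); [lra|exact Hm].
Qed.

Lemma cauchy_formula R0 f z r : hol (disc 0 R0) f -> 0 < r -> Cmod z < r -> r < R0 ->
  cint (fun t => f (circ r t) * (circ r t / (circ r t - z)))%C 0 (2 * PI) (RtoC (2 * PI) * f z)%C.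
Proof.
  intros Hf Hr Hz HR. destruct (circ_integral_eq R0 f z r Hf Hr Hz HR) as [l [m [Hl [Hm E]]]].
  rewrite (cint_unique _ _ _ _ _ Hl (kernel_integral z r Hr Hz)) in E.
  rewrite E in Hm. now rewrite Cmult_comm.
Qed.

(** * Complex power series *)

Fixpoint psum (a : nat -> C) (z : C) (N : nat) : C :=
  match N with
  | O => a 0%nat
  | S n => (psum a z n + a (S n) * z ^ S n)%C
  end.

Definition cps (a : nat -> C) (z l : C) : Prop :=
  is_pseries (K := C_AbsRing) (V := C_NormedModule) a z l.

Lemma pow_n_Cpow (z : C) k : pow_n (K := C_AbsRing) z k = (z ^ k)%C.
Proof. induction k; simpl; [reflexivity|]. rewrite IHk. reflexivity. Qed.

Lemma sum_n_psum a z N :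
  sum_n (G := C_NormedModule) (fun k => scal (K := C_AbsRing) (V := C_NormedModule) (pow_n (K := C_AbsRing) z k) (a k)) N
  = psum a z N.
Proof.
  induction N as [|N IH].
  - rewrite sum_O. change (pow_n (K := C_AbsRing) z 0 * a 0%nat = a 0%nat)%C. simpl.
    apply Cmult_1_l.
  - rewrite sum_Sn, IH, pow_n_Cpow.
    change (psum a z N + z ^ S N * a (S N) = psum a z N + a (S N) * z ^ S N)%C. ring.
Qed.

Lemma cps_eps a z l : cps a z l <->
  forall e, 0 < e -> exists N, forall n, (N <= n)%nat -> Cmod (psum a z n - l) < e.
Proof.
  unfold cps, is_pseries, is_series. split.
  - intros H e He.
    assert (Hf : 0 < norm_factor (V := C_NormedModule)) by apply norm_factor_gt_0.
    assert (He' : 0 < e / norm_factor (V := C_NormedModule)) by now apply Rdiv_lt_0_compat.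
    destruct (proj1 (filterlim_locally _ _) H (mkposreal _ He')) as [N HN].
    exists N. intros n Hn. specialize (HN n Hn). apply norm_compat2 in HN. simpl in HN.
    rewrite sum_n_psum in HN. change (Cmod (psum a z n - l) < norm_factor (V := C_NormedModule) * (e / norm_factor (V := C_NormedModule))) in HN.
    replace (norm_factor (V := C_NormedModule) * (e / norm_factor (V := C_NormedModule))) with e in HN; [exact HN|].
    field. lra.
  - intros H. apply filterlim_locally. intros [e He]. destruct (H e He) as [N HN].
    exists N. intros n Hn. apply norm_compat1. rewrite sum_n_psum. exact (HN n Hn).
Qed.

Lemma cps_unique a z l m : cps a z l -> cps a z m -> l = m.
Proof.
  intros H K. apply Cmod_small_eq. intros e He.
  destruct (proj1 (cps_eps _ _ _) H (e / 2)) as [N1 H1]; [lra|].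
  destruct (proj1 (cps_eps _ _ _) K (e / 2)) as [N2 H2]; [lra|].
  specialize (H1 (N1 + N2)%nat ltac:(lia)). specialize (H2 (N1 + N2)%nat ltac:(lia)).
  generalize (Cmod_tri3 l (psum a z (N1 + N2)) m). rewrite (Cmod_sym l (psum a z (N1 + N2))). lra.
Qed.

Lemma cps_0 a : cps a 0 (a 0%nat).
Proof. exact (is_pseries_0 (K := C_AbsRing) (V := C_NormedModule) a). Qed.

Lemma cps_at0 a l : cps a 0 l -> l = a 0%nat.
Proof. intro H. exact (cps_unique _ _ _ _ H (cps_0 a)). Qed.

Lemma cps_ext a b z l : (forall k, a k = b k) -> cps a z l -> cps b z l.
Proof. apply (is_pseries_ext (K := C_AbsRing) (V := C_NormedModule)). Qed.

Lemma cps_minus a b z l m : cps a z l -> cps b z m -> cps (fun k => a k - b k)%C z (l - m)%C.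
Proof. exact (is_pseries_minus (K := C_AbsRing) (V := C_NormedModule) a b z l m). Qed.

Lemma cps_scal k a z l : cps a z l -> cps (fun n => k * a n)%C z (k * l)%C.
Proof.
  exact (is_pseries_scal (K := C_AbsRing) (V := C_NormedModule) k a z l (Cmult_comm z k)).
Qed.

Lemma cps_shift a z l : z <> RtoC 0 -> cps a z l -> cps (fun k => a (S k)) z ((l - a 0%nat) / z)%C.
Proof.
  intros Hz H. rewrite Cdiv_def || unfold Cdiv. rewrite Cmult_comm.
  exact (is_pseries_decr_1 (K := C_AbsRing) (V := C_NormedModule) a z (/ z)%C l (Cinv_l z Hz) H).
Qed.

Lemma cps_terms_bounded a z l : cps a z l -> exists M, 0 <= M /\ forall k, Cmod (a k * z ^ k) <= M.
Proof.
  intros H. destruct (proj1 (cps_eps _ _ _) H 1 Rlt_0_1) as [N HN].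
  assert (B : exists M, 0 <= M /\ forall k, (k <= S N)%nat -> Cmod (a k * z ^ k) <= M).
  { induction (S N) as [|n [M [M0 HM]]].
    - exists (Cmod (a 0%nat * z ^ 0)). split; [apply Cmod_ge_0|]. intros k Hk.
      replace k with 0%nat by lia. lra.
    - exists (M + Cmod (a (S n) * z ^ S n)). generalize (Cmod_ge_0 (a (S n) * z ^ S n)); intro.
      split; [lra|]. intros k Hk. destruct (Nat.eq_dec k (S n)) as [->|]; [lra|].
      specialize (HM k ltac:(lia)). lra. }
  destruct B as [M [M0 HM]]. exists (M + 2). split; [lra|]. intros k.
  destruct (Compare_dec.le_lt_dec k (S N)); [specialize (HM k l0); lra|].
  destruct k as [|k]; [lia|].
  replace (a (S k) * z ^ S k)%C with ((psum a z (S k) - l) - (psum a z k - l))%C by (simpl; ring).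
  eapply Rle_trans; [apply Cmod_minus_le|].
  generalize (HN (S k) ltac:(lia)) (HN k ltac:(lia)). lra.
Qed.

Definition pdom (a : nat -> C) (R0 : R) : Prop := forall z, Cmod z < R0 -> exists l, cps a z l.

(** The series of moduli is real, which gives access to the theory of the radius of convergence.
    Boundedness of the terms at one point between [r] and [R0] is enough. *)
Lemma pdom_CV a R0 r : pdom a R0 -> 0 <= r -> r < R0 -> Rbar_lt r (CV_radius (fun k => Cmod (a k))).
Proof.
  intros H Hr Hlt. set (s := (r + R0) / 2).
  destruct (H (RtoC s)) as [l Hl]. { rewrite Cmod_RtoC_pos; unfold s; lra. }
  destruct (cps_terms_bounded _ _ _ Hl) as [M [M0 HM]].
  destruct (CV_radius_bounded (fun k => Cmod (a k))) as [Hub _].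
  apply Rbar_lt_le_trans with s; [unfold s; simpl; lra|]. apply Hub. exists M. intros n.
  specialize (HM n). rewrite Cmod_mult, Cmod_pow, Cmod_RtoC_pos in HM by (unfold s; lra).
  rewrite Rabs_pos_eq; [exact HM|]. apply Rmult_le_pos; [apply Cmod_ge_0|].
  apply pow_le. unfold s; lra.
Qed.

Lemma cps_of_abs a (b : nat -> R) z : (forall k, Cmod (a k * z ^ k) <= b k) -> ex_series b ->
  exists l, cps a z l.
Proof.
  intros H Hb.
  destruct (ex_series_le (K := C_AbsRing) (V := C_CompleteNormedModule)
    (fun k => scal (K := C_AbsRing) (V := C_NormedModule) (pow_n (K := C_AbsRing) z k) (a k)) b) as [l Hl].
  - intro n. rewrite pow_n_Cpow. change (Cmod (z ^ n * a n) <= b n). rewrite Cmult_comm. apply H.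
  - exact Hb.
  - exists l. exact Hl.
Qed.

Definition pder (a : nat -> C) (k : nat) : C := (RtoC (INR (S k)) * a (S k))%C.

Lemma Cmod_pder a k : Cmod (pder a k) = PS_derive (fun n => Cmod (a n)) k.
Proof. unfold pder, PS_derive. rewrite Cmod_mult, Cmod_RtoC_pos; [reflexivity|apply pos_INR]. Qed.

Lemma pdom_pder a R0 : pdom a R0 -> pdom (pder a) R0.
Proof.
  intros H z Hz. apply cps_of_abs with (fun k => PS_derive (fun n => Cmod (a n)) k * Cmod z ^ k).
  - intro k. rewrite Cmod_mult, Cmod_pow, Cmod_pder. lra.
  - assert (E : ex_pseries (PS_derive (fun n => Cmod (a n))) (Cmod z)).
    { apply ex_pseries_derive. rewrite Rabs_pos_eq by apply Cmod_ge_0.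
      apply (pdom_CV a R0); auto. apply Cmod_ge_0. }
    apply ex_series_ext with (2 := E). intro n. change scal with Rmult.
    rewrite pow_n_pow. simpl. ring.
Qed.

(** The constant is the full second derivative of [rho^(k+2)], without the factor [1/2]: the
    induction closes with it, and summation over [k] yields [PS_derive] applied twice to the series
    of moduli. *)
Lemma Cpow_taylor2 (z h : C) rho k : Cmod z <= rho -> Cmod (z + h) <= rho ->
  Cmod ((z + h) ^ S (S k) - z ^ S (S k) - RtoC (INR (S (S k))) * z ^ S k * h) <=
    INR (S (S k)) * INR (S k) * rho ^ k * Cmod h ^ 2.
Proof.
  intros Hz Hzh. assert (Hrho : 0 <= rho) by (generalize (Cmod_ge_0 z); lra).
  generalize (Cmod_ge_0 h); intro Hh0.
  induction k as [|k IH].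
  - replace ((z + h) ^ 2 - z ^ 2 - RtoC (INR 2) * z ^ 1 * h)%C with (h ^ 2)%C.
    2:{ simpl. rewrite RtoC_plus. ring. }
    rewrite Cmod_pow. simpl. nra.
  - replace ((z + h) ^ S (S (S k)) - z ^ S (S (S k)) - RtoC (INR (S (S (S k)))) * z ^ S (S k) * h)%C
      with ((z + h) * ((z + h) ^ S (S k) - z ^ S (S k) - RtoC (INR (S (S k))) * z ^ S k * h)
            + RtoC (INR (S (S k))) * z ^ S k * h ^ 2)%C.
    2:{ rewrite (S_INR (S (S k))), RtoC_plus. simpl Cpow. ring. }
    eapply Rle_trans; [apply Cmod_triangle|].
    rewrite !Cmod_mult, !Cmod_pow, Cmod_RtoC_pos by apply pos_INR.
    set (X := Cmod (_ - _ - _)) in *.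
    assert (A1 : Cmod (z + h) * X <= rho * (INR (S (S k)) * INR (S k) * rho ^ k * Cmod h ^ 2)).
    { apply Rmult_le_compat; auto; apply Cmod_ge_0. }
    assert (A2 : INR (S (S k)) * Cmod z ^ S k * Cmod h ^ 2 <= INR (S (S k)) * rho ^ S k * Cmod h ^ 2).
    { apply Rmult_le_compat_r; [apply pow2_ge_0|]. apply Rmult_le_compat_l; [apply pos_INR|].
      apply pow_incr. split; [apply Cmod_ge_0|exact Hz]. }
    eapply Rle_trans; [apply Rplus_le_compat; [exact A1|exact A2]|].
    rewrite !S_INR. simpl pow. generalize (pos_INR k); intro Hk.
    assert (0 <= rho ^ k) by now apply pow_le.
    assert (0 <= rho * rho ^ k * (Cmod h * (Cmod h * 1))) by (repeat apply Rmult_le_pos; lra).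
    set (Y := rho * rho ^ k * (Cmod h * (Cmod h * 1))) in *.
    replace (rho * ((INR k + 1 + 1) * (INR k + 1) * rho ^ k * (Cmod h * (Cmod h * 1)))) with
      ((INR k + 1 + 1) * (INR k + 1) * Y) by (unfold Y; ring).
    replace ((INR k + 1 + 1) * (rho * rho ^ k) * (Cmod h * (Cmod h * 1))) with
      ((INR k + 1 + 1) * Y) by (unfold Y; ring).
    replace ((INR k + 1 + 1 + 1) * (INR k + 1 + 1) * (rho * rho ^ k) * (Cmod h * (Cmod h * 1))) with
      ((INR k + 1 + 1 + 1) * (INR k + 1 + 1) * Y) by (unfold Y; ring).
    nra.
Qed.

Lemma psum_taylor2 a z h rho N : Cmod z <= rho -> Cmod (z + h) <= rho ->
  Cmod (psum a (z + h) (S (S N)) - psum a z (S (S N)) - psum (pder a) z (S N) * h) <=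
  Cmod h ^ 2 * sum_n (fun k => PS_derive (PS_derive (fun n => Cmod (a n))) k * rho ^ k) N.
Proof.
  intros Hz Hzh.
  assert (T : forall k, Cmod (a (S (S k)) * (z + h) ^ S (S k) - a (S (S k)) * z ^ S (S k)
      - pder a (S k) * z ^ S k * h) <=
      Cmod h ^ 2 * (PS_derive (PS_derive (fun n => Cmod (a n))) k * rho ^ k)).
  { intro k. replace (a (S (S k)) * (z + h) ^ S (S k) - a (S (S k)) * z ^ S (S k)
      - pder a (S k) * z ^ S k * h)%C with
      (a (S (S k)) * ((z + h) ^ S (S k) - z ^ S (S k) - RtoC (INR (S (S k))) * z ^ S k * h))%C
      by (unfold pder; ring).
    rewrite Cmod_mult. eapply Rle_trans.
    - apply Rmult_le_compat_l; [apply Cmod_ge_0|]. now apply Cpow_taylor2 with (rho := rho).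
    - unfold PS_derive. right. ring. }
  induction N as [|N IH].
  - rewrite sum_O. eapply Rle_trans; [|apply (T 0%nat)]. right. f_equal.
    simpl psum. unfold pder at 1. simpl. ring.
  - rewrite sum_Sn. change plus with Rplus. rewrite Rmult_plus_distr_l.
    change (psum a (z + h) (S (S (S N)))) with (psum a (z + h) (S (S N)) + a (S (S (S N))) * (z + h) ^ S (S (S N)))%C.
    change (psum a z (S (S (S N)))) with (psum a z (S (S N)) + a (S (S (S N))) * z ^ S (S (S N)))%C.
    change (psum (pder a) z (S (S N))) with (psum (pder a) z (S N) + pder a (S (S N)) * z ^ S (S N))%C.
    replace (psum a (z + h) (S (S N)) + a (S (S (S N))) * (z + h) ^ S (S (S N)) -
      (psum a z (S (S N)) + a (S (S (S N))) * z ^ S (S (S N))) -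
      (psum (pder a) z (S N) + pder a (S (S N)) * z ^ S (S N)) * h)%C with
      ((psum a (z + h) (S (S N)) - psum a z (S (S N)) - psum (pder a) z (S N) * h) +
       (a (S (S (S N))) * (z + h) ^ S (S (S N)) - a (S (S (S N))) * z ^ S (S (S N))
        - pder a (S (S N)) * z ^ S (S N) * h))%C by ring.
    eapply Rle_trans; [apply Cmod_triangle|]. apply Rplus_le_compat; [exact IH|apply T].
Qed.

(** The termwise Taylor remainders add up to at most [K |h|^2], where [K] is the second derivative
    of the series of moduli at a radius [rho] between [|z|] and [R0]. *)
Lemma cps_cderiv a f g R0 : (forall z, Cmod z < R0 -> cps a z (f z)) ->
  (forall z, Cmod z < R0 -> cps (pder a) z (g z)) ->
  forall z, Cmod z < R0 -> cderiv f z (g z).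
Proof.
  intros Hf Hg z Hz. generalize (Cmod_ge_0 z); intro Hz0.
  set (rho := (Cmod z + R0) / 2).
  assert (Hd : pdom a R0) by (intros w Hw; exists (f w); auto).
  assert (HS : ex_series (fun k => PS_derive (PS_derive (fun n => Cmod (a n))) k * rho ^ k)).
  { assert (E : ex_pseries (PS_derive (PS_derive (fun n => Cmod (a n)))) rho).
    { apply ex_pseries_derive. rewrite CV_radius_derive.
      rewrite Rabs_pos_eq by (unfold rho; lra). apply (pdom_CV a R0); unfold rho; auto; lra. }
    apply ex_series_ext with (2 := E). intro n. change scal with Rmult. rewrite pow_n_pow.
    apply Rmult_comm. }
  destruct HS as [K HK].
  assert (HK' : forall N, sum_n (fun k => PS_derive (PS_derive (fun n => Cmod (a n))) k * rho ^ k) N <= K).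
  { apply is_lim_seq_incr_compare; [exact HK|]. intro n. rewrite sum_Sn. change plus with Rplus.
    assert (0 <= PS_derive (PS_derive (fun n => Cmod (a n))) (S n) * rho ^ S n); [|lra].
    apply Rmult_le_pos; [|apply pow_le; unfold rho; lra]. unfold PS_derive.
    apply Rmult_le_pos; [apply pos_INR|]. apply Rmult_le_pos; [apply pos_INR|apply Cmod_ge_0]. }
  assert (K0 : 0 <= K).
  { eapply Rle_trans; [|apply (HK' 0%nat)]. rewrite sum_O. unfold PS_derive.
    repeat apply Rmult_le_pos; try apply pos_INR; try apply Cmod_ge_0. simpl; lra. }
  assert (B : forall h, Cmod h < (R0 - Cmod z) / 2 -> Cmod (f (z + h)%C - f z - g z * h) <= Cmod h ^ 2 * K).
  { intros h Hh. apply Rnot_lt_le. intro Hlt.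
    set (X := (f (z + h)%C - f z - g z * h)%C) in *.
    (* Three limits are replaced by partial sums, at a cost of at most [e], [e] and [e |h|]; this
       stays below the assumed excess [(3 + |h|) e]. *)
    set (e := (Cmod X - Cmod h ^ 2 * K) / (3 + Cmod h)).
    generalize (Cmod_ge_0 h); intro Hh0.
    assert (He : 0 < e) by (apply Rdiv_lt_0_compat; lra).
    assert (Hzh : Cmod (z + h) <= rho).
    { eapply Rle_trans; [apply Cmod_triangle|]. unfold rho. lra. }
    assert (Hzh' : Cmod (z + h) < R0) by (unfold rho in Hzh; lra).
    destruct (proj1 (cps_eps _ _ _) (Hf _ Hzh') e He) as [N1 H1].
    destruct (proj1 (cps_eps _ _ _) (Hf _ Hz) e He) as [N2 H2].
    destruct (proj1 (cps_eps _ _ _) (Hg _ Hz) e He) as [N3 H3].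
    set (N := (N1 + N2 + N3)%nat).
    specialize (H1 (S (S N)) ltac:(lia)). specialize (H2 (S (S N)) ltac:(lia)).
    specialize (H3 (S N) ltac:(lia)).
    assert (Hr : Cmod z <= rho) by (unfold rho; lra).
    generalize (psum_taylor2 a z h rho N Hr Hzh). intro T.
    set (A := psum a (z + h) (S (S N))) in *. set (A' := psum a z (S (S N))) in *.
    set (A3 := psum (pder a) z (S N)) in *.
    assert (EX : Cmod X <= Cmod (A - A' - A3 * h) + (Cmod (A - f (z + h)%C) + (Cmod (A' - f z) + Cmod (A3 - g z) * Cmod h))).
    { replace X with ((A - A' - A3 * h) - ((A - f (z + h)%C) - ((A' - f z) + (A3 - g z) * h)))%C
        by (unfold X; ring).
      eapply Rle_trans; [apply Cmod_minus_le|]. apply Rplus_le_compat_l.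
      eapply Rle_trans; [apply Cmod_minus_le|]. apply Rplus_le_compat_l.
      eapply Rle_trans; [apply Cmod_triangle|]. apply Rplus_le_compat_l.
      rewrite Cmod_mult. lra. }
    assert (Cmod h ^ 2 * sum_n (fun k => PS_derive (PS_derive (fun n => Cmod (a n))) k * rho ^ k) N <= Cmod h ^ 2 * K).
    { apply Rmult_le_compat_l; [apply pow2_ge_0|apply HK']. }
    assert (Cmod (A3 - g z) * Cmod h <= e * Cmod h) by (apply Rmult_le_compat_r; lra).
    assert (e * (3 + Cmod h) = Cmod X - Cmod h ^ 2 * K) by (unfold e; field; lra).
    nra. }
  apply cderiv_of_bound. intros e He. exists (Rmin ((R0 - Cmod z) / 2) (e / (K + 1))).
  split. { apply Rmin_pos; [lra|]. apply Rdiv_lt_0_compat; lra. }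
  intros h Hh. generalize (Rmin_l ((R0 - Cmod z) / 2) (e / (K + 1))) (Rmin_r ((R0 - Cmod z) / 2) (e / (K + 1))).
  intros. eapply Rle_trans; [apply B; lra|]. generalize (Cmod_ge_0 h); intro.
  replace (Cmod h ^ 2 * K) with (Cmod h * K * Cmod h) by ring.
  apply Rmult_le_compat_r; [lra|].
  assert (Cmod h * (K + 1) <= e).
  { replace e with (e / (K + 1) * (K + 1)) by (field; lra). apply Rmult_le_compat_r; lra. }
  nra.
Qed.

Lemma cps_derivative a R0 f : (forall z, Cmod z < R0 -> cps a z (f z)) ->
  exists g, (forall z, Cmod z < R0 -> cps (pder a) z (g z)) /\
    forall z, Cmod z < R0 -> cderiv f z (g z).
Proof.
  intro Hf. set (g := fun z => epsilon (inhabits (RtoC 0)) (cps (pder a) z)).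
  assert (Hg : forall z, Cmod z < R0 -> cps (pder a) z (g z)).
  { intros z Hz. unfold g. apply epsilon_spec. apply (pdom_pder a R0); auto.
    intros w Hw. exists (f w). auto. }
  exists g. split; [exact Hg|]. now apply (cps_cderiv a).
Qed.

Lemma hol_cps a R0 f : (forall z, Cmod z < R0 -> cps a z (f z)) -> hol (disc 0 R0) f.
Proof.
  intro Hf. destruct (cps_derivative _ _ _ Hf) as [g [Hg Dg]].
  destruct (cps_derivative _ _ _ Hg) as [h [_ Dh]].
  exists g. intros z Hz. rewrite disc0 in Hz. split; [auto|]. eapply cderiv_cont. eauto.
Qed.

Lemma cps_coef_unique a b f r : 0 < r -> (forall z, Cmod z < r -> cps a z (f z)) ->
  (forall z, Cmod z < r -> cps b z (f z)) -> forall k, a k = b k.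
Proof.
  intros Hr Ha Hb k.
  assert (Gen : forall k e, (forall z, Cmod z < r -> cps e z 0) -> e k = RtoC 0).
  { clear - Hr. intro k. induction k as [|k IH]; intros e He.
    - symmetry. apply cps_at0. apply He. rewrite Cmod_0. exact Hr.
    - apply (IH (fun n => e (S n))).
      assert (E0 : e 0%nat = RtoC 0) by (symmetry; apply cps_at0, He; now rewrite Cmod_0).
      assert (Hnz : forall z, Cmod z < r -> z <> RtoC 0 -> cps (fun n => e (S n)) z 0).
      { intros z Hz Hn. replace (RtoC 0) with ((RtoC 0 - e 0%nat) / z)%C.
        - apply cps_shift; auto.
        - rewrite E0. field. exact Hn. }
      (* Off the origin the shifted series sums to [0], at the origin to [e 1]. Continuity of the
         sum forces [e 1 = 0], so that the induction hypothesis also covers the origin. *)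
      set (f := fun z => if excluded_middle_informative (z = RtoC 0) then e 1%nat else RtoC 0).
      assert (Hf : forall z, Cmod z < r -> cps (fun n => e (S n)) z (f z)).
      { intros z Hz. unfold f. destruct (excluded_middle_informative (z = RtoC 0)) as [->|].
        - apply (cps_0 (fun n => e (S n))).
        - now apply Hnz. }
      assert (E1 : e 1%nat = RtoC 0).
      { assert (Cf : ccont f 0).
        { apply (hol_ccont (disc 0 r)); [eapply hol_cps; exact Hf|]. apply disc0. now rewrite Cmod_0. }
        apply Cmod_small_eq. intros x Hx. destruct (Cf x Hx) as [d [Hd K]].
        assert (Hp : Cmod (RtoC (d / 2)) = d / 2) by (apply Cmod_RtoC_pos; lra).
        specialize (K (RtoC (d / 2))). unfold f in K.
        destruct (excluded_middle_informative (RtoC 0 = RtoC 0)); [|congruence].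
        destruct (excluded_middle_informative (RtoC (d / 2) = RtoC 0)) as [E|_].
        { apply RtoC_inj in E. lra. }
        rewrite (Cmod_sym (RtoC 0) (e 1%nat)) in K. left. apply K. replace (RtoC (d / 2) - RtoC 0)%C with (RtoC (d / 2)) by ring.
        lra. }
      intros z Hz. destruct (excluded_middle_informative (z = RtoC 0)) as [->|n]; [|auto].
      rewrite <- E1 at 2. apply (cps_0 (fun n => e (S n))). }
  assert (E : (a k - b k)%C = RtoC 0).
  { apply (Gen k (fun k => a k - b k)%C). intros z Hz.
    replace (RtoC 0) with (f z - f z)%C by ring. apply cps_minus; auto. }
  replace (a k) with ((a k - b k) + b k)%C by ring. rewrite E. ring.
Qed.

(** * Taylor expansion of holomorphic functions, and analyticity *)

Lemma hol_taylor_lt R0 r f : hol (disc 0 R0) f -> 0 < r < R0 ->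
  exists a, forall z, Cmod z < r -> cps a z (f z).
Proof.
  intros Hf Hr. generalize PI_RGT_0; intro Hpi.
  assert (Cf : forall t, ccont f (circ r t)).
  { intro t. apply (hol_ccont _ _ _ Hf). apply disc0. rewrite Cmod_circ; lra. }
  set (I := fun k : nat => RInt (V := C_R_CompleteNormedModule) (fun t => f (circ r t) * / circ r t ^ k)%C 0 (2 * PI) : C).
  exists (fun k => / RtoC (2 * PI) * I k)%C. intros z Hz.
  (* The expansion asks for a bound at every real [t]. Continuity provides one on a compact
     interval, and periodicity of [circ] moves every [t] into it. *)
  destruct (rcont_bounded (fun t => f (circ r t)) (- (2 * PI)) (2 * PI)) as [B [B0 HB]]; [lra| |].
  { intros t _. now apply rcont_circ_comp. }
  assert (HBall : forall t, Cmod (f (circ r t)) <= B).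
  { intro t. assert (exists s, - (2 * PI) <= s <= 2 * PI /\ circ r s = circ r t) as [s [Hs E]].
    { destruct (archimed (t / (2 * PI))) as [A1 A2]. set (m := up (t / (2 * PI))) in *.
      exists (t - IZR m * (2 * PI)).
      assert (Et : t = t / (2 * PI) * (2 * PI)) by (field; lra).
      split; [split; nra|].
      assert (P : forall k : nat, circ r (t + INR k * (2 * PI)) = circ r t).
      { intro k. unfold circ. f_equal; f_equal.
        - rewrite <- (cos_period t k). f_equal. ring.
        - rewrite <- (sin_period t k). f_equal. ring. }
      assert (P' : forall (k : nat) s, circ r (s - INR k * (2 * PI)) = circ r s).
      { intros k s. unfold circ. f_equal; f_equal.
        - rewrite <- (cos_period (s - INR k * (2 * PI)) k). f_equal. ring.
        - rewrite <- (sin_period (s - INR k * (2 * PI)) k). f_equal. ring. }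
      destruct (Z_le_gt_dec 0 m).
      - rewrite <- (Z2Nat.id m) by lia. rewrite <- INR_IZR_INZ. apply P'.
      - replace m with (- Z.of_nat (Z.to_nat (- m)))%Z by lia.
        rewrite opp_IZR, <- INR_IZR_INZ.
        replace (t - - INR (Z.to_nat (- m)) * (2 * PI)) with (t + INR (Z.to_nat (- m)) * (2 * PI)) by ring.
        apply P. }
    rewrite <- E. now apply HB. }
  generalize (cauchy_formula R0 f z r Hf (proj1 Hr) Hz (proj2 Hr)); intro HC.
  apply cps_eps. intros e He. generalize (Cmod_ge_0 z); intro Hz0.
  destruct (geom_lt_eps (B * (r / (r - Cmod z))) (Cmod z / r) e) as [N HN]; [| |exact He|].
  - apply Rmult_le_pos; [lra|]. apply Rdiv_le_0_compat; lra.
  - split; [apply Rdiv_le_0_compat; lra|].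
    apply Rmult_lt_reg_r with r; [lra|]. unfold Rdiv. rewrite Rmult_assoc, Rinv_l by lra. lra.
  - exists N. intros n Hn.
    destruct (circ_integral_expand f B z r _ Cf (proj1 Hr) Hz HBall HC n) as [x [Ex Bx]].
    assert (H2 : RtoC (2 * PI) <> RtoC 0) by (intro E; apply RtoC_inj in E; lra).
    assert (Es : sum_n (fun k => I k * z ^ k)%C n = (RtoC (2 * PI) * psum (fun k => / RtoC (2 * PI) * I k) z n)%C).
    { clear - H2. induction n as [|n IH].
      - rewrite sum_O. simpl. match goal with |- ?x = ?y => change (@eq C x y) end. field. exact H2.
      - rewrite sum_Sn, IH. change plus with Cplus. simpl psum. match goal with |- ?x = ?y => change (@eq C x y) end. simpl Cpow. field. exact H2. }
    assert (Ed : (psum (fun k => / RtoC (2 * PI) * I k) z n - f z)%C = (- (/ RtoC (2 * PI) * x))%C).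
    { unfold I in Es |- *. rewrite Es in Ex. apply (Cmult_cancel_l (RtoC (2 * PI))); [exact H2|].
      set (p := psum _ z n) in *. 
      transitivity (RtoC (2 * PI) * p - RtoC (2 * PI) * f z)%C; [ring|]. rewrite Ex. field. exact H2. }
    rewrite Ed, Cmod_opp, Cmod_mult, Cmod_inv by exact H2. rewrite Cmod_RtoC_pos by lra.
    eapply Rle_lt_trans; [|apply (HN n Hn)].
    apply Rmult_le_reg_l with (2 * PI); [lra|].
    rewrite <- Rmult_assoc, Rinv_r, Rmult_1_l by lra. exact Bx.
Qed.

(** All radii below [R0] give the same coefficients by uniqueness, so the expansion found for
    [R0 / 2] is valid in the whole disc. *)
Lemma hol_taylor R0 f : 0 < R0 -> hol (disc 0 R0) f ->
  exists a, forall z, Cmod z < R0 -> cps a z (f z).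
Proof.
  intros HR Hf.
  destruct (hol_taylor_lt R0 (R0 / 2) f Hf) as [a Ha]; [lra|].
  exists a. intros z Hz. set (r := Rmax (R0 / 2) ((Cmod z + R0) / 2)).
  assert (Hr : R0 / 2 <= r /\ Cmod z < r /\ r < R0).
  { unfold r. generalize (Rmax_l (R0 / 2) ((Cmod z + R0) / 2)) (Rmax_r (R0 / 2) ((Cmod z + R0) / 2)).
    generalize (Cmod_ge_0 z). intros. repeat split; try lra. apply Rmax_lub_lt; lra. }
  destruct (hol_taylor_lt R0 r f Hf) as [b Hb]; [lra|].
  apply cps_ext with b; [|apply Hb; lra]. intro k. symmetry.
  apply (cps_coef_unique a b f (R0 / 2)); [lra|exact Ha|]. intros w Hw. apply Hb. lra.
Qed.

Lemma hol_shift c r f : hol (disc c r) f <-> hol (disc 0 r) (fun h => f (c + h)%C).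
Proof.
  split; intro H.
  - apply (hol_comp (disc 0 r) (disc c r) f (fun h => c + h)%C); [|exact H|].
    + apply hol_plus; [apply hol_const|apply hol_id].
    + intros z Hz. rewrite disc0 in Hz. unfold disc. replace (c + z - c)%C with z by ring. exact Hz.
  - apply (hol_ext _ (fun w => f (c + (w - c))%C)); [apply copen_disc| |].
    + intros z _. f_equal. ring.
    + apply (hol_comp (disc c r) (disc 0 r) (fun h => f (c + h)%C) (fun w => w - c)%C); [|exact H|].
      * apply hol_minus; [apply hol_id|apply hol_const].
      * intros z Hz. apply disc0. exact Hz.
Qed.

Lemma analytic_at_hol f z0 : analytic_at f z0 <-> exists r, 0 < r /\ hol (disc z0 r) f.
Proof.
  split.
  - intros [a [r [Hr H]]]. exists r. split; [exact Hr|]. apply (proj2 (hol_shift _ _ _)).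
    apply hol_cps with a. intros h Hh.
    specialize (H (z0 + h)%C). replace (z0 + h - z0)%C with h in H by ring. exact (H Hh).
  - intros [r [Hr H]]. apply (proj1 (hol_shift _ _ _)) in H. destruct (hol_taylor r _ Hr H) as [a Ha].
    exists a, r. split; [exact Hr|]. intros z Hz. specialize (Ha (z - z0)%C Hz).
    replace (z0 + (z - z0))%C with z in Ha by ring. exact Ha.
Qed.

Lemma analytic_on_hol A f : copen A -> (analytic_on A f <-> hol A f).
Proof.
  intro HA. split; intro H.
  - apply hol_local. intros z Hz. now apply analytic_at_hol, H.
  - intros z Hz. apply analytic_at_hol. destruct (HA z Hz) as [d [Hd K]].
    exists d. split; [exact Hd|]. now apply (hol_subset A).
Qed.

Lemma hol_derivative A f : copen A -> hol A f -> hol A (Cder f).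
Proof.
  intros HA H. apply hol_local. intros z Hz. destruct (HA z Hz) as [d [Hd K]].
  exists d. split; [exact Hd|].
  assert (H1 : hol (disc z d) f) by now apply (hol_subset A).
  generalize (proj1 (hol_shift _ _ _) H1); intro H2.
  destruct (hol_taylor d _ Hd H2) as [a Ha].
  destruct (cps_derivative _ _ _ Ha) as [g [Hg Dg]].
  apply (proj2 (hol_shift _ _ _)). apply (hol_ext _ g); [apply copen_disc| |now apply hol_cps with (pder a)].
  intros h Hh. rewrite disc0 in Hh. symmetry. apply Cder_eq.
  specialize (Dg h Hh).
  apply (cderiv_ext_loc (fun w => f (z + (w - z))%C) _ _ _ 1); [lra|intros; f_equal; ring|].
  eapply cderiv_eq; [|apply (cderiv_comp (fun h => f (z + h)%C) (fun w => w - z)%C)].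
  2:{ apply cderiv_minus; [apply cderiv_id|apply cderiv_const]. }
  2:{ cbv beta. replace (z + h - z)%C with h by ring. exact Dg. }
  ring.
Qed.

Lemma hol_factor R0 f : 0 < R0 -> hol (disc 0 R0) f -> f 0 = RtoC 0 ->
  exists g, hol (disc 0 R0) g /\ forall z, Cmod z < R0 -> f z = (z * g z)%C.
Proof.
  intros HR Hf H0. destruct (hol_taylor _ _ HR Hf) as [a Ha].
  assert (Ea : a 0%nat = RtoC 0).
  { rewrite <- H0. symmetry. apply cps_at0. apply Ha. now rewrite Cmod_0. }
  set (g := fun z => if excluded_middle_informative (z = RtoC 0) then a 1%nat else (f z / z)%C).
  exists g. split.
  - apply hol_cps with (fun k => a (S k)). intros z Hz. unfold g.
    destruct (excluded_middle_informative (z = RtoC 0)) as [->|n].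
    + apply (cps_0 (fun k => a (S k))).
    + replace (f z / z)%C with ((f z - a 0%nat) / z)%C by (rewrite Ea; field; exact n).
      apply cps_shift; auto.
  - intros z Hz. unfold g. destruct (excluded_middle_informative (z = RtoC 0)) as [->|n].
    + rewrite H0. ring.
    + field. exact n.
Qed.

(** * The maximum principle and Schwarz's lemma *)

Lemma cauchy_bound R0 f z r M : hol (disc 0 R0) f -> 0 < r < R0 -> Cmod z < r ->
  (forall w, Cmod w = r -> Cmod (f w) <= M) -> Cmod (f z) <= r / (r - Cmod z) * M.
Proof.
  intros Hf Hr Hz HM. generalize PI_RGT_0; intro Hpi. generalize (Cmod_ge_0 z); intro Hz0.
  generalize (cauchy_formula R0 f z r Hf (proj1 Hr) Hz (proj2 Hr)); intro H.
  apply cint_bound with (M := r / (r - Cmod z) * M) in H; [|lra|].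
  - rewrite Cmod_mult, Cmod_RtoC_pos in H by lra. rewrite Rminus_0_r in H.
    apply Rmult_le_reg_l with (2 * PI); lra.
  - intros t _. assert (Hn : (circ r t - z)%C <> RtoC 0) by (apply circ_minus_neq; lra).
    rewrite Cmod_mult, Cmod_div by exact Hn. rewrite Cmod_circ by lra. rewrite Rmult_comm.
    generalize (circ_minus_lower z r t (proj1 Hr) Hz); intro Hl.
    apply Rmult_le_compat.
    + apply Rdiv_le_0_compat; lra.
    + apply Cmod_ge_0.
    + apply Rmult_le_compat_l; [lra|]. apply Rinv_le_contravar; lra.
    + apply HM. apply Cmod_circ; lra.
Qed.

(* Apply [cauchy_bound] to the powers of [f] and take roots. *)
Lemma max_principle R0 f z r M : hol (disc 0 R0) f -> 0 < r < R0 -> Cmod z < r ->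
  (forall w, Cmod w = r -> Cmod (f w) <= M) -> Cmod (f z) <= M.
Proof.
  intros Hf Hr Hz HM. apply Rnot_lt_le. intro Hlt.
  assert (M0 : 0 <= M).
  { eapply Rle_trans; [apply Cmod_ge_0|apply (HM (RtoC r))]. apply Cmod_RtoC_pos; lra. }
  set (F := Cmod (f z)) in *. set (A := r / (r - Cmod z)).
  assert (A0 : 0 <= A) by (apply Rdiv_le_0_compat; lra).
  assert (B : forall k, F ^ k <= A * M ^ k).
  { intro k. unfold F. rewrite <- Cmod_pow.
    apply (cauchy_bound R0 (fun z => f z ^ k)%C z r (M ^ k)); auto.
    - now apply hol_pow.
    - intros w Hw. rewrite Cmod_pow. apply pow_incr. split; [apply Cmod_ge_0|auto]. }
  destruct (geom_lt_eps A (M / F) 1) as [N HN]; auto; [|lra|].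
  { split; [apply Rdiv_le_0_compat; lra|]. apply Rmult_lt_reg_r with F; [lra|].
    unfold Rdiv. rewrite Rmult_assoc, Rinv_l by lra. lra. }
  specialize (HN N (Nat.le_refl _)). specialize (B (S N)).
  assert (FP : 0 < F ^ S N) by (apply pow_lt; lra).
  unfold Rdiv in HN. rewrite Rpow_mult_distr, pow_inv in HN.
  apply Rmult_lt_compat_r with (r := F ^ S N) in HN; [|exact FP].
  replace (A * (M ^ S N * / F ^ S N) * F ^ S N) with (A * M ^ S N) in HN by (field; lra).
  lra.
Qed.

Lemma le_div_limit X B R0 r0 : 0 < R0 -> r0 < R0 ->
  (forall r, 0 < r -> r0 < r -> r < R0 -> X <= B / r) -> X <= B / R0.
Proof.
  intros HR Hr H. apply Rnot_lt_le. intro Hlt.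
  assert (E : B < X * R0).
  { apply Rmult_lt_compat_r with (r := R0) in Hlt; [|exact HR].
    unfold Rdiv in Hlt. rewrite Rmult_assoc, Rinv_l in Hlt by lra. lra. }
  (* Replacing [R0] by a radius within [d] of it changes [X * R0] by at most half of the excess
     [X * R0 - B]. *)
  set (d := (X * R0 - B) / (2 * (Rabs X + 1))).
  generalize (Rabs_pos X); intro HX.
  assert (Hd : 0 < d) by (apply Rdiv_lt_0_compat; lra).
  set (m := Rmax (R0 / 2) (Rmax ((r0 + R0) / 2) (R0 - d))).
  assert (M1 : R0 / 2 <= m) by apply Rmax_l.
  assert (M2 : Rmax ((r0 + R0) / 2) (R0 - d) <= m) by apply Rmax_r.
  generalize (Rmax_l ((r0 + R0) / 2) (R0 - d)) (Rmax_r ((r0 + R0) / 2) (R0 - d)); intros M3 M4.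
  assert (M5 : m < R0) by (unfold m; repeat apply Rmax_lub_lt; lra).
  specialize (H m ltac:(lra) ltac:(lra) M5).
  apply Rmult_le_compat_r with (r := m) in H; [|lra].
  unfold Rdiv in H. rewrite Rmult_assoc, Rinv_l in H by lra.
  assert (E2 : d * (2 * (Rabs X + 1)) = X * R0 - B) by (unfold d; field; lra).
  assert (X * (R0 - m) <= Rabs X * (R0 - m)).
  { apply Rmult_le_compat_r; [lra|apply Rle_abs]. }
  nra.
Qed.

(** On [|z| = r] the quotient is at most [B / r]; the maximum principle carries this inwards, and
    [r] tends to [R0]. The case [R0 = B = 1] is Schwarz's lemma. *)
Lemma factor_bound R0 f g B : 0 < R0 -> hol (disc 0 R0) g ->
  (forall z, Cmod z < R0 -> f z = (z * g z)%C) ->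
  (forall z, Cmod z < R0 -> Cmod (f z) <= B) ->
  forall z, Cmod z < R0 -> Cmod (g z) <= B / R0.
Proof.
  intros HR Hg E HB z Hz. apply le_div_limit with (Cmod z); auto. intros r Hr0 Hr1 Hr2.
  apply (max_principle R0 g z r); auto. intros w Hw.
  apply Rmult_le_reg_l with r; [exact Hr0|].
  replace (r * (B / r)) with B by (field; lra). rewrite <- Hw at 1. rewrite <- Cmod_mult, <- E by lra.
  apply HB. lra.
Qed.

Lemma schwarz f : hol disk f -> f 0 = RtoC 0 -> (forall z, disk z -> Cmod (f z) <= 1) ->
  exists g, hol disk g /\ (forall z, disk z -> f z = (z * g z)%C) /\
    forall z, disk z -> Cmod (g z) <= 1.
Proof.
  intros Hf H0 HB.
  assert (Hf' : hol (disc 0 1) f) by (apply (hol_subset disk); auto; intro; apply disc_disk).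
  destruct (hol_factor 1 f Rlt_0_1 Hf' H0) as [g [Hg E]]. exists g.
  split; [apply (hol_subset (disc 0 1)); auto; intro; apply disc_disk|]. split; [exact E|].
  intros z Hz. replace 1 with (1 / 1) by field. now apply (factor_bound 1 f g 1 Rlt_0_1).
Qed.

(** Schwarz's lemma, rescaled, for [f (c + h) - f c], which is bounded by [2 B]. *)
Lemma hol_lipschitz c r f B h : 0 < r -> hol (disc c r) f ->
  (forall z, Cmod (z - c) < r -> Cmod (f z) <= B) -> Cmod h < r ->
  Cmod (f (c + h)%C - f c) <= 2 * B / r * Cmod h.
Proof.
  intros Hr Hf HB Hh. apply (proj1 (hol_shift _ _ _)) in Hf.
  set (F := fun h => (f (c + h)%C - f c)%C).
  assert (HF : hol (disc 0 r) F) by (apply hol_minus; [exact Hf|apply hol_const]).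
  destruct (hol_factor r F Hr HF) as [g [Hg E]].
  { unfold F. replace (c + RtoC 0)%C with c by ring. ring. }
  change (Cmod (F h) <= 2 * B / r * Cmod h). rewrite E by exact Hh. rewrite Cmod_mult, Rmult_comm.
  apply Rmult_le_compat_r; [apply Cmod_ge_0|].
  apply (factor_bound r F g (2 * B)); auto. intros z Hz. unfold F.
  eapply Rle_trans; [apply Cmod_minus_le|].
  assert (H1 := HB (c + z)%C). replace (c + z - c)%C with z in H1 by ring. specialize (H1 Hz).
  assert (H2 := HB c). replace (c - c)%C with (RtoC 0) in H2 by ring. rewrite Cmod_0 in H2.
  specialize (H2 Hr). lra.
Qed.

Lemma cderiv_factor_0 R0 f g : 0 < R0 -> hol (disc 0 R0) g ->
  (forall z, Cmod z < R0 -> f z = (f 0 + z * g z)%C) -> cderiv f 0 (g 0).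
Proof.
  intros HR Hg E. exists g. split; [reflexivity|]. split.
  - apply (hol_ccont _ _ _ Hg). apply disc0. now rewrite Cmod_0.
  - exists R0. split; [exact HR|]. intros w Hw. replace (w - RtoC 0)%C with w in * by ring.
    rewrite E by exact Hw. ring.
Qed.

(** Two divisions by [h]: the increment is at most [2 B], its quotient [g] at most [2 B / r], the
    increment of [g] at most [4 B / r], and a second division costs another [r]. *)
Lemma hol_taylor2 c r f B l h : 0 < r -> hol (disc c r) f -> cderiv f c l ->
  (forall z, Cmod (z - c) < r -> Cmod (f z) <= B) -> Cmod h < r ->
  Cmod (f (c + h)%C - f c - l * h) <= 4 * B / (r * r) * Cmod h ^ 2 /\ Cmod l <= 2 * B / r.
Proof.
  intros Hr Hf Hl HB Hh. apply (proj1 (hol_shift _ _ _)) in Hf.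
  set (F := fun h => (f (c + h)%C - f c)%C).
  assert (HF : hol (disc 0 r) F) by (apply hol_minus; [exact Hf|apply hol_const]).
  assert (F0 : F 0 = RtoC 0) by (unfold F; replace (c + RtoC 0)%C with c by ring; ring).
  destruct (hol_factor r F Hr HF F0) as [g [Hg E]].
  assert (Bg : forall z, Cmod z < r -> Cmod (g z) <= 2 * B / r).
  { apply (factor_bound r F g (2 * B)); auto. intros z Hz. unfold F.
    eapply Rle_trans; [apply Cmod_minus_le|].
    assert (H1 := HB (c + z)%C). replace (c + z - c)%C with z in H1 by ring. specialize (H1 Hz).
    assert (H2 := HB c). replace (c - c)%C with (RtoC 0) in H2 by ring. rewrite Cmod_0 in H2.
    specialize (H2 Hr). lra. }
  assert (El : g 0 = l).
  { apply (cderiv_unique F 0).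
    - apply (cderiv_factor_0 r F g); auto. intros z Hz. rewrite F0, E by exact Hz. ring.
    - eapply cderiv_eq; [|apply cderiv_minus; [|apply cderiv_const]].
      2:{ apply (cderiv_comp f (fun h => c + h)%C); [apply cderiv_plus; [apply cderiv_const|apply cderiv_id]|].
          replace (c + RtoC 0)%C with c by ring. exact Hl. }
      ring. }
  split.
  - replace (f (c + h)%C - f c - l * h)%C with (h * (g (RtoC 0 + h)%C - g 0))%C.
    2:{ rewrite El. replace (RtoC 0 + h)%C with h by ring.
        transitivity (h * g h - l * h)%C; [ring|]. rewrite <- E by exact Hh. unfold F. ring. }
    rewrite Cmod_mult.
    assert (HL := hol_lipschitz 0 r g (2 * B / r) h Hr Hg).
    replace (4 * B / (r * r) * Cmod h ^ 2) with (Cmod h * (2 * (2 * B / r) / r * Cmod h)) by (field; lra).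
    apply Rmult_le_compat_l; [apply Cmod_ge_0|]. apply HL; auto.
    intros z Hz. apply Bg. now replace (z - RtoC 0)%C with z in Hz by ring.
  - rewrite <- El. apply Bg. now rewrite Cmod_0.
Qed.

(** * Automorphisms of the disk *)

Lemma sigma_identity (a z : C) :
  Cmod (1 + Cconj a * z) ^ 2 - Cmod (z + a) ^ 2 = (1 - Cmod a ^ 2) * (1 - Cmod z ^ 2).
Proof. rewrite !Cmod_sqr. destruct a as [a1 a2], z as [z1 z2]. simpl. ring. Qed.

Lemma one_plus_neq0 (x : C) : Cmod x < 1 -> (1 + x)%C <> RtoC 0.
Proof.
  intros H E. assert (x = (- (1))%C) by (replace x with (1 + x - 1)%C by ring; rewrite E; ring).
  rewrite H0, Cmod_m1 in H. lra.
Qed.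

Lemma sigma_den (a z : C) : Cmod a < 1 -> Cmod z <= 1 -> (1 + Cconj a * z)%C <> RtoC 0.
Proof.
  intros Ha Hz. apply one_plus_neq0. rewrite Cmod_mult, Cmod_conj.
  generalize (Cmod_ge_0 a) (Cmod_ge_0 z). nra.
Qed.

Lemma sigma_deficit (a z : C) : Cmod a < 1 -> Cmod z <= 1 ->
  1 - Cmod (sigma a z) ^ 2 = (1 - Cmod a ^ 2) * (1 - Cmod z ^ 2) / Cmod (1 + Cconj a * z) ^ 2.
Proof.
  intros Ha Hz. generalize (sigma_den a z Ha Hz); intro Hd. unfold sigma.
  rewrite Cmod_div by exact Hd. rewrite <- sigma_identity.
  assert (0 < Cmod (1 + Cconj a * z)) by now apply Cmod_gt_0. field. lra.
Qed.

Lemma sigma_le1 (a z : C) : Cmod a < 1 -> Cmod z <= 1 -> Cmod (sigma a z) <= 1.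
Proof.
  intros Ha Hz. generalize (sigma_deficit a z Ha Hz); intro E.
  assert (Hd : 0 < Cmod (1 + Cconj a * z)) by now apply Cmod_gt_0, sigma_den.
  generalize (Cmod_ge_0 a) (Cmod_ge_0 z) (Cmod_ge_0 (sigma a z)); intros.
  assert (0 <= 1 - Cmod (sigma a z) ^ 2); [|nra].
  rewrite E. apply Rdiv_le_0_compat; [|apply pow_lt; exact Hd]. apply Rmult_le_pos; nra.
Qed.

Lemma sigma_lt1 (a z : C) : Cmod a < 1 -> Cmod z < 1 -> Cmod (sigma a z) < 1.
Proof.
  intros Ha Hz. assert (Hz' : Cmod z <= 1) by lra.
  generalize (sigma_deficit a z Ha Hz'); intro E.
  assert (Hd : 0 < Cmod (1 + Cconj a * z)) by now apply Cmod_gt_0, sigma_den.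
  generalize (Cmod_ge_0 a) (Cmod_ge_0 z) (Cmod_ge_0 (sigma a z)); intros.
  assert (0 < 1 - Cmod (sigma a z) ^ 2); [|nra].
  rewrite E. apply Rdiv_lt_0_compat; [|apply pow_lt; exact Hd]. apply Rmult_lt_0_compat; nra.
Qed.

Lemma one_minus_mod2_neq0 (a : C) : Cmod a < 1 -> (1 - a * Cconj a)%C <> RtoC 0.
Proof.
  intros Ha E. rewrite Cmod2_conj_mult, <- RtoC_minus in E. apply RtoC_inj in E.
  generalize (Cmod_ge_0 a). nra.
Qed.

Lemma Cconj_opp (a : C) : Cconj (- a) = (- Cconj a)%C.
Proof. apply C_ext; reflexivity. Qed.

Lemma sigma_cancel (a z : C) : Cmod a < 1 -> Cmod z <= 1 -> sigma (- a) (sigma a z) = z.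
Proof.
  intros Ha Hz. generalize (sigma_den a z Ha Hz) (one_minus_mod2_neq0 a Ha); intros Hd Hn.
  unfold sigma. rewrite Cconj_opp. field. split; [exact Hd|].
  replace (1 + Cconj a * z + - Cconj a * (z + a))%C with (1 - a * Cconj a)%C by ring. exact Hn.
Qed.

Lemma Cmod_opp_lt (a : C) : Cmod a < 1 -> Cmod (- a) < 1.
Proof. now rewrite Cmod_opp. Qed.

Lemma sigma_cancel' (a z : C) : Cmod a < 1 -> Cmod z <= 1 -> sigma a (sigma (- a) z) = z.
Proof.
  intros Ha Hz. replace (sigma a) with (sigma (- - a)) by (f_equal; ring).
  apply sigma_cancel; [now apply Cmod_opp_lt|exact Hz].
Qed.

Lemma sigma_0 (a : C) : sigma a 0 = a.
Proof. unfold sigma. field. Qed.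

Definition dsigma (a z : C) : C :=
  ((1 - a * Cconj a) / ((1 + Cconj a * z) * (1 + Cconj a * z)))%C.

Lemma cderiv_affine (p q z : C) : cderiv (fun w => p + q * w)%C z q.
Proof.
  eapply cderiv_eq; [|apply cderiv_plus; [apply cderiv_const|apply cderiv_scal, cderiv_id]]. ring.
Qed.

Lemma cderiv_sigma (a z : C) : (1 + Cconj a * z)%C <> RtoC 0 -> cderiv (sigma a) z (dsigma a z).
Proof.
  intro Hd. unfold sigma.
  eapply cderiv_eq; [|apply cderiv_div; [|apply cderiv_affine|exact Hd]].
  2:{ apply cderiv_plus; [apply cderiv_id|apply cderiv_const]. }
  unfold dsigma. cbv beta. field. exact Hd.
Qed.

Lemma hol_sigma (a : C) : hol (fun z => (1 + Cconj a * z)%C <> RtoC 0) (sigma a).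
Proof.
  apply hol_div; [apply hol_plus; [apply hol_id|apply hol_const]| |auto].
  apply hol_plus; [apply hol_const|apply hol_scal, hol_id].
Qed.

Lemma hol_sigma_comp A a f : hol A f -> Cmod a < 1 -> (forall z, A z -> Cmod (f z) <= 1) ->
  hol A (fun z => sigma a (f z)).
Proof.
  intros Hf Ha HB. apply (hol_comp A (fun z => (1 + Cconj a * z)%C <> RtoC 0) (sigma a) f); auto.
  - apply hol_sigma.
  - intros z Hz. apply sigma_den; auto.
Qed.

Lemma dsigma_neq0 (a z : C) : Cmod a < 1 -> Cmod z <= 1 -> dsigma a z <> RtoC 0.
Proof.
  intros Ha Hz. unfold dsigma, Cdiv. apply Cmult_neq_0; [now apply one_minus_mod2_neq0|].
  intro E. assert (H : (1 + Cconj a * z)%C <> RtoC 0) by now apply sigma_den.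
  assert (((1 + Cconj a * z) * (1 + Cconj a * z)) <> RtoC 0)%C by now apply Cmult_neq_0.
  apply Cmod_gt_0 in H0. assert (F := Cmod_inv _ (proj2 (Cmod_gt_0 _) H0)).
  rewrite E, Cmod_0 in F. assert (0 < / Cmod ((1 + Cconj a * z) * (1 + Cconj a * z))); [|lra].
  now apply Rinv_0_lt_compat.
Qed.

(** Schwarz's lemma for [sigma (- f 0)] composed with [f]. The denominator is cleared, which leaves
    a form that survives the limit taken in [unimodular_const]. *)
Lemma schwarz_pick f z : hol disk f -> (forall w, disk w -> Cmod (f w) <= 1) ->
  Cmod (f 0) < 1 -> disk z ->
  Cmod (f z - f 0) <= Cmod z * Cmod (1 - Cconj (f 0) * f z) /\ Cmod (f z) < 1.
Proof.
  intros Hf HB Ha Hz. set (a := f 0) in *.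
  destruct (schwarz (fun z => sigma (- a) (f z))) as [g [_ [E Bg]]].
  - apply hol_sigma_comp; auto. now apply Cmod_opp_lt.
  - fold a. unfold sigma. rewrite Cconj_opp. replace (a + - a)%C with (RtoC 0) by ring.
    unfold Cdiv. ring.
  - intros w Hw. apply sigma_le1; auto. now apply Cmod_opp_lt.
  - specialize (E z Hz). specialize (Bg z Hz). cbv beta in E.
    assert (Hs : Cmod (sigma (- a) (f z)) <= Cmod z).
    { rewrite E, Cmod_mult. generalize (Cmod_ge_0 z). nra. }
    assert (Hd : (1 + Cconj (- a) * f z)%C <> RtoC 0).
    { apply sigma_den; auto. now apply Cmod_opp_lt. }
    split.
    + unfold sigma in Hs. rewrite Cmod_div in Hs by exact Hd.
      assert (P : 0 < Cmod (1 + Cconj (- a) * f z)) by now apply Cmod_gt_0.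
      apply Rmult_le_compat_r with (r := Cmod (1 + Cconj (- a) * f z)) in Hs; [|lra].
      unfold Rdiv in Hs. rewrite Rmult_assoc, Rinv_l, Rmult_1_r in Hs by lra.
      rewrite Cconj_opp in Hs.
      replace (1 - Cconj a * f z)%C with (1 + - Cconj a * f z)%C by ring. exact Hs.
    + rewrite <- (sigma_cancel' a (f z)); auto. apply sigma_lt1; auto. unfold disk in Hz. lra.
Qed.

(** Schwarz-Pick applies to [t f] for [t < 1]. In the limit [t -> 1] it says that
    [|f z - f 0| <= |z| |f z - f 0|], whence [f z = f 0]. *)
Lemma unimodular_const f z : hol disk f -> (forall w, disk w -> Cmod (f w) <= 1) ->
  Cmod (f 0) = 1 -> disk z -> f z = f 0.
Proof.
  intros Hf HB Ha Hz.
  assert (Key : forall t, 0 < t < 1 -> t * Cmod (f z - f 0) <= Cmod z * (Cmod (f z - f 0) + (1 - t * t))).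
  { intros t Ht.
    assert (Mt : Cmod (RtoC t) = t) by (apply Cmod_RtoC_pos; lra).
    destruct (schwarz_pick (fun z => RtoC t * f z)%C z) as [H _].
    - now apply hol_scal.
    - intros w Hw. rewrite Cmod_mult, Mt. specialize (HB w Hw). generalize (Cmod_ge_0 (f w)). nra.
    - rewrite Cmod_mult, Mt, Ha. lra.
    - exact Hz.
    - replace (RtoC t * f z - RtoC t * f 0)%C with (RtoC t * (f z - f 0))%C in H by ring.
      rewrite Cmod_mult, Mt in H. eapply Rle_trans; [exact H|].
      apply Rmult_le_compat_l; [apply Cmod_ge_0|].
      assert (Ec : Cconj (RtoC t * f 0) = (RtoC t * Cconj (f 0))%C).
      { apply C_ext; simpl; ring. }
      rewrite Ec.
      replace (1 - RtoC t * Cconj (f 0) * (RtoC t * f z))%C with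
        (Cconj (f 0) * (f 0 - f z) + RtoC (1 - t * t) * (Cconj (f 0) * f z))%C.
      2:{ assert (Eo : (f 0 * Cconj (f 0))%C = RtoC 1) by (rewrite Cmod2_conj_mult, Ha; f_equal; ring).
          rewrite RtoC_minus, RtoC_mult. 
          transitivity ((f 0 * Cconj (f 0)) - RtoC t * RtoC t * (Cconj (f 0) * f z))%C; [ring|].
          rewrite Eo. ring. }
      eapply Rle_trans; [apply Cmod_triangle|].
      rewrite !Cmod_mult, Cmod_conj, Ha, Rmult_1_l, (Cmod_sym (f 0)).
      rewrite Cmod_RtoC_pos by nra. rewrite Rmult_1_l.
      specialize (HB z Hz). assert (0 <= 1 - t * t) by nra. nra. }
  set (X := Cmod (f z - f 0)) in *. unfold disk in Hz.
  generalize (Cmod_ge_0 z) (Cmod_ge_0 (f z - f 0)); fold X; intros Hz0 HX0.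
  destruct (Req_dec X 0) as [E|E].
  - apply Cmod_eq_0 in E. replace (f z) with ((f z - f 0) + f 0)%C by ring. rewrite E. ring.
  (* With [t = 1 - s], [Key] implies [(1 - |z|) X <= s (2 + X)]; this [s] makes the right-hand side
     half of the left. *)
  - exfalso. set (s := (1 - Cmod z) * X / (2 * (2 + X))).
    assert (Hs : s * (2 * (2 + X)) = (1 - Cmod z) * X) by (unfold s; field; lra).
    assert (0 < s) by (apply Rdiv_lt_0_compat; [apply Rmult_lt_0_compat|]; lra).
    assert (s < 1) by nra.
    specialize (Key (1 - s) ltac:(lra)). nra.
Qed.

(** * Extreme values *)

Definition closed_bounded (K : C -> Prop) : Prop :=
  (exists r, forall z, K z -> Cmod z <= r) /\
  forall z, ~ K z -> exists d, 0 < d /\ forall w, Cmod (w - z) < d -> ~ K w.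

(** If the infimum [m] were not attained, every point of the plane would have a neighbourhood on
    whose part in [K] the function exceeds [m] by a fixed margin, vacuously so away from [K].
    Compactness of a square makes the margin uniform, against the definition of [m]. *)
Lemma extreme_value (K : C -> Prop) (phi : C -> R) :
  closed_bounded K -> (exists z, K z) -> (forall z, K z -> 0 <= phi z) ->
  (forall z, K z -> forall e, 0 < e -> exists d, 0 < d /\
     forall w, K w -> Cmod (w - z) < d -> Rabs (phi w - phi z) < e) ->
  exists z, K z /\ forall w, K w -> phi z <= phi w.
Proof.
  intros [[r Hr] Hcl] [z0 Hz0] Hpos Hc. apply NNPP. intro Hno.
  destruct (completeness (fun x => forall z, K z -> x <= phi z)) as [m [Hub Hlub]].
  { exists (phi z0). intros x Hx. now apply Hx. }
  { exists 0. exact Hpos. }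
  assert (Hm : forall z, K z -> m <= phi z).
  { intros z Hz. apply Hlub. intros x Hx. now apply Hx. }
  assert (Hlt : forall z, K z -> m < phi z).
  { intros z Hz. destruct (Hm z Hz) as [|E]; [assumption|]. exfalso. apply Hno.
    exists z. split; [exact Hz|]. intros w Hw. rewrite <- E. auto. }
  (* The same [d] is the size of the neighbourhood and the margin above [m], so the uniform size
     returned by the compactness lemma is a uniform margin as well. *)
  assert (Hd : forall u v, exists d : posreal, forall w, K w ->
     Rabs (Re w - u) < d -> Rabs (Im w - v) < d -> m + d < phi w).
  { intros u v. destruct (classic (K (u, v))) as [H|H].
    - set (g := (phi (u, v) - m) / 2).
      assert (Hg : 0 < g) by (unfold g; specialize (Hlt _ H); lra).
      destruct (Hc _ H g Hg) as [d [Hd Hcd]].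
      assert (Hp : 0 < Rmin (d / 2) g) by (apply Rmin_pos; lra).
      exists (mkposreal _ Hp). simpl. intros w Hw H1 H2.
      generalize (Rmin_l (d / 2) g) (Rmin_r (d / 2) g); intros.
      assert (Cmod (w - (u, v)) < d).
      { eapply Rle_lt_trans; [apply Cmod_le_Re_Im|]. rewrite Re_minus, Im_minus. simpl. lra. }
      specialize (Hcd w Hw H4). apply Rabs_def2 in Hcd. unfold g in *. lra.
    - destruct (Hcl _ H) as [d [Hd Hcd]]. assert (Hp : 0 < d / 2) by lra.
      exists (mkposreal _ Hp). simpl. intros w Hw H1 H2. exfalso. apply (Hcd w); [|exact Hw].
      eapply Rle_lt_trans; [apply Cmod_le_Re_Im|]. rewrite Re_minus, Im_minus. simpl. lra. }
  set (delta := fun u v => proj1_sig (constructive_indefinite_description _ (Hd u v))).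
  destruct (compactness_value_2d (- r) r (- r) r delta) as [d Hcomp].
  assert (Hall : forall w, K w -> m + d <= phi w).
  { intros w Hw. specialize (Hr w Hw).
    assert (A1 : - r <= Re w <= r).
    { generalize (re_le_Cmod w); intro. assert (Rabs (Re w) <= r) by lra. now apply Rabs_le_between. }
    assert (A2 : - r <= Im w <= r).
    { generalize (Im_le_Cmod w); intro. assert (Rabs (Im w) <= r) by lra. now apply Rabs_le_between. }
    generalize (NNPP _ (Hcomp (Re w) (Im w) A1 A2)). intros [u [v [_ [_ [H1 [H2 H3]]]]]].
    unfold delta in *. destruct (constructive_indefinite_description _ (Hd u v)) as [d' Hd'].
    simpl in *. specialize (Hd' w Hw H1 H2). lra. }
  specialize (Hub (m + d) Hall). generalize (cond_pos d). lra.
Qed.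

Lemma closed_bounded_disc c r : closed_bounded (fun z => Cmod (z - c) <= r).
Proof.
  split.
  - exists (r + Cmod c). intros z Hz. generalize (Cmod_tri_sub z c). lra.
  - intros z Hz. apply Rnot_le_lt in Hz. exists (Cmod (z - c) - r). split; [lra|].
    intros w Hw H. generalize (Cmod_tri3 z w c). rewrite (Cmod_sym z w). lra.
Qed.

Lemma closed_bounded_circle c r : closed_bounded (fun z => Cmod (z - c) = r).
Proof.
  split.
  - exists (r + Cmod c). intros z Hz. generalize (Cmod_tri_sub z c). lra.
  - intros z Hz. exists (Rabs (Cmod (z - c) - r)). split.
    { apply Rabs_pos_lt. lra. }
    intros w Hw H. generalize (Cmod_tri3 z w c) (Cmod_tri3 w z c).
    rewrite (Cmod_sym z w). intros. revert Hw. unfold Rabs. destruct (Rcase_abs _); lra.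
Qed.

Lemma Cmod_cont f z : ccont f z -> forall e, 0 < e -> exists d, 0 < d /\
  forall w, Cmod (w - z) < d -> Rabs (Cmod (f w) - Cmod (f z)) < e.
Proof.
  intros Hf e He. destruct (Hf e He) as [d [Hd H]]. exists d. split; [exact Hd|].
  intros w Hw. specialize (H w Hw).
  generalize (Cmod_tri_sub (f w) (f z)) (Cmod_tri_sub (f z) (f w)).
  rewrite (Cmod_sym (f z) (f w)). intros. apply Rabs_def1; lra.
Qed.

Lemma min_modulus (K : C -> Prop) f : closed_bounded K -> (exists z, K z) ->
  (forall z, K z -> ccont f z) -> exists z, K z /\ forall w, K w -> Cmod (f z) <= Cmod (f w).
Proof.
  intros HK Hne Hf. apply extreme_value; auto.
  - intros; apply Cmod_ge_0.
  - intros z Hz e He. destruct (Cmod_cont f z (Hf z Hz) e He) as [d [Hd H]].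
    exists d. split; auto.
Qed.

Lemma bounded_on (K : C -> Prop) f : closed_bounded K -> (forall z, K z -> ccont f z) ->
  exists B, 0 < B /\ forall z, K z -> Cmod (f z) <= B.
Proof.
  intros HK Hf. destruct (classic (exists z, K z)) as [Hne|Hne].
  2:{ exists 1. split; [lra|]. intros z Hz. exfalso. apply Hne. now exists z. }
  (* A minimum of [1 / (1 + |f|)] is a maximum of [|f|]. *)
  destruct (extreme_value K (fun z => / (1 + Cmod (f z)))) as [z [Hz Hmin]]; auto.
  - intros z _. left. apply Rinv_0_lt_compat. generalize (Cmod_ge_0 (f z)). lra.
  - intros z Hz e He. destruct (Cmod_cont f z (Hf z Hz) e He) as [d [Hd H]].
    exists d. split; [exact Hd|]. intros w _ Hw. specialize (H w Hw).
    generalize (Cmod_ge_0 (f z)) (Cmod_ge_0 (f w)); intros Z W.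
    replace (/ (1 + Cmod (f w)) - / (1 + Cmod (f z))) with
      ((Cmod (f z) - Cmod (f w)) * / ((1 + Cmod (f w)) * (1 + Cmod (f z)))) by (field; lra).
    rewrite Rabs_mult, Rabs_minus_sym.
    assert (P : 1 <= (1 + Cmod (f w)) * (1 + Cmod (f z))) by nra.
    assert (Q : / ((1 + Cmod (f w)) * (1 + Cmod (f z))) <= 1).
    { rewrite <- Rinv_1. apply Rinv_le_contravar; lra. }
    assert (Q0 : 0 < / ((1 + Cmod (f w)) * (1 + Cmod (f z)))) by (apply Rinv_0_lt_compat; lra).
    rewrite (Rabs_pos_eq (/ _)) by lra. generalize (Rabs_pos (Cmod (f w) - Cmod (f z))). nra.
  - exists (1 + Cmod (f z)). generalize (Cmod_ge_0 (f z)); intro. split; [lra|]. intros w Hw.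
    specialize (Hmin w Hw). generalize (Cmod_ge_0 (f w)); intro.
    apply Rnot_lt_le. intro Hlt. assert (/ (1 + Cmod (f w)) < / (1 + Cmod (f z))); [|lra].
    apply Rinv_lt_contravar; nra.
Qed.

(** * First-order behaviour *)

Definition near0 (A : R -> Prop) : Prop := exists T, 0 < T /\ forall t, 0 < t < T -> A t.

Lemma near0_and A B : near0 A -> near0 B -> exists t, A t /\ B t.
Proof.
  intros [T [HT HA]] [T' [HT' HB]]. exists (Rmin T T' / 2).
  generalize (Rmin_l T T') (Rmin_r T T') (Rmin_pos _ _ HT HT'). intros.
  split; [apply HA|apply HB]; lra.
Qed.

Lemma near0_disc (a v c : C) r : Cmod (a - c) < r -> near0 (fun t => Cmod (a + RtoC t * v - c) < r).
Proof.
  intro H. generalize (Cmod_ge_0 v); intro V0. exists ((r - Cmod (a - c)) / (Cmod v + 1)).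
  split; [apply Rdiv_lt_0_compat; lra|]. intros t [Ht0 Ht]. apply Rlt_div_r in Ht; [|lra].
  replace (a + RtoC t * v - c)%C with ((a - c) + RtoC t * v)%C by ring.
  eapply Rle_lt_trans; [apply Cmod_triangle|]. rewrite Cmod_mult, Cmod_RtoC_pos by lra. nra.
Qed.

(** With [X = w - f a] and [D] the increment of [f], [|D - X|^2 = |X|^2 - 2 Re (conj X D) + |D|^2].
    The middle term is of order [t] and wins over the last, of order [t^2]. *)
Lemma cderiv_dir_approach f a l w v : cderiv f a l -> 0 < Re (Cconj (w - f a) * (l * v)) ->
  near0 (fun t => Cmod (f (a + RtoC t * v)%C - w) < Cmod (f a - w)).
Proof.
  intros Hf Hpos. set (X := (w - f a)%C) in *. set (c := Re (Cconj X * (l * v))) in *.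
  generalize (Cmod_ge_0 X) (Cmod_ge_0 v) (Cmod_ge_0 l); intros X0 V0 L0.
  (* With this precision the error of the linear approximation costs at most half of the gain
     [t c]. *)
  set (e := c / (2 * (Cmod X * Cmod v + 1))).
  assert (XV : 0 <= Cmod X * Cmod v) by now apply Rmult_le_pos.
  assert (He : 0 < e) by (apply Rdiv_lt_0_compat; lra).
  destruct (cderiv_bound _ _ _ Hf e He) as [d [Hd Hb]].
  set (S := (Cmod v * (Cmod l + e)) ^ 2).
  assert (S0 : 0 <= S) by apply pow2_ge_0.
  exists (Rmin (d / (Cmod v + 1)) (c / (S + 1))). split.
  { apply Rmin_pos; apply Rdiv_lt_0_compat; lra. }
  intros t [Ht0 Ht].
  destruct (Rmin_lt _ _ _ Ht) as [T1 T2].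
  assert (T1' : t * (Cmod v + 1) < d) by (apply Rlt_div_r in T1; lra).
  assert (T2' : t * (S + 1) < c) by (apply Rlt_div_r in T2; lra).
  assert (Mh : Cmod (RtoC t * v) = t * Cmod v) by (rewrite Cmod_mult, Cmod_RtoC_pos; lra).
  specialize (Hb (RtoC t * v)%C). rewrite Mh in Hb. specialize (Hb ltac:(nra)).
  set (D := (f (a + RtoC t * v)%C - f a)%C) in *.
  set (eta := (D - l * (RtoC t * v))%C) in *.
  assert (ED : D = (eta + RtoC t * (l * v))%C) by (unfold eta; ring).
  assert (HD : Cmod D <= t * (Cmod v * (Cmod l + e))).
  { rewrite ED. eapply Rle_trans; [apply Cmod_triangle|]. rewrite !Cmod_mult, Cmod_RtoC_pos by lra. nra. }
  assert (HR : t * (c / 2) <= Re (Cconj X * D)).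
  { rewrite ED. replace (Cconj X * (eta + RtoC t * (l * v)))%C with
      (Cconj X * eta + RtoC t * (Cconj X * (l * v)))%C by ring.
    rewrite Re_plus, Re_scal. fold c.
    assert (A : - (Cmod X * (e * (t * Cmod v))) <= Re (Cconj X * eta)).
    { generalize (re_le_Cmod (Cconj X * eta)). rewrite Cmod_mult, Cmod_conj. intro A.
      assert (Cmod X * Cmod eta <= Cmod X * (e * (t * Cmod v))) by (apply Rmult_le_compat_l; auto).
      assert (Rabs (Re (Cconj X * eta)) <= Cmod X * (e * (t * Cmod v))) by lra.
      apply Rabs_le_between in H0. lra. }
    assert (E : e * (2 * (Cmod X * Cmod v + 1)) = c) by (unfold e; field; lra).
    nra. }
  assert (D0 := Cmod_ge_0 D).
  assert (HD2 : Cmod D ^ 2 <= t * t * S).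
  { unfold S. replace (t * t * (Cmod v * (Cmod l + e)) ^ 2) with ((t * (Cmod v * (Cmod l + e))) ^ 2) by ring.
    apply pow_incr. split; lra. }
  replace (f (a + RtoC t * v)%C - w)%C with (D - X)%C by (unfold D, X; ring).
  rewrite (Cmod_sym (f a) w). fold X.
  assert (E2 : Cmod (D - X) ^ 2 = Cmod X ^ 2 - 2 * Re (Cconj X * D) + Cmod D ^ 2).
  { rewrite !Cmod_sqr. autorewrite with reim. ring. }
  assert (Cmod (D - X) ^ 2 < Cmod X ^ 2) by nra.
  generalize (Cmod_ge_0 (D - X)). nra.
Qed.

Lemma cderiv_dir_increase f a l v : cderiv f a l -> 0 < Re (l * v) ->
  near0 (fun t => Re (f a) < Re (f (a + RtoC t * v)%C)).
Proof.
  intros Hf Hpos. set (c := Re (l * v)) in *. generalize (Cmod_ge_0 v); intro V0.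
  assert (He : 0 < c / (2 * (Cmod v + 1))) by (apply Rdiv_lt_0_compat; lra).
  destruct (cderiv_bound _ _ _ Hf _ He) as [d [Hd Hb]].
  exists (d / (Cmod v + 1)). split; [apply Rdiv_lt_0_compat; lra|]. intros t [Ht0 Ht].
  assert (T1' : t * (Cmod v + 1) < d) by (apply Rlt_div_r in Ht; lra).
  specialize (Hb (RtoC t * v)%C). rewrite Cmod_mult, Cmod_RtoC_pos in Hb by lra.
  specialize (Hb ltac:(nra)).
  generalize (re_le_Cmod (f (a + RtoC t * v)%C - f a - l * (RtoC t * v))). intro A.
  assert (B := Rle_trans _ _ _ A Hb). apply Rabs_le_between in B.
  rewrite !Re_minus in B. replace (l * (RtoC t * v))%C with (RtoC t * (l * v))%C in B by ring.
  rewrite Re_scal in B. fold c in B.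
  assert (c / (2 * (Cmod v + 1)) * (t * Cmod v) < t * c).
  { apply Rmult_lt_reg_r with (2 * (Cmod v + 1)); [lra|].
    replace (c / (2 * (Cmod v + 1)) * (t * Cmod v) * (2 * (Cmod v + 1))) with (t * c * Cmod v) by (field; lra).
    assert (0 < t * c) by now apply Rmult_lt_0_compat. nra. }
  lra.
Qed.

(** The vectors [- a k] with [Re k > 0] are exactly the directions from [a] strictly into the disc
    [|z| < |a|]; the claim reduces to [|1 - t k| < 1] for small [t]. *)
Lemma inward_modulus (a k : C) : a <> RtoC 0 -> 0 < Re k ->
  near0 (fun t => Cmod (a + RtoC t * (- (a * k))) < Cmod a).
Proof.
  intros Ha Hk. assert (K0 : 0 < Cmod k).
  { generalize (Re_le_Cmod k). lra. }
  exists (2 * Re k / (Cmod k ^ 2)). split; [apply Rdiv_lt_0_compat; [lra|now apply pow_lt]|].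
  intros t [Ht0 Ht].
  assert (H : t * Cmod k ^ 2 < 2 * Re k).
  { apply Rlt_div_r in Ht; [lra|]. now apply pow_lt. }
  replace (a + RtoC t * - (a * k))%C with (a * (1 - RtoC t * k))%C by ring.
  rewrite Cmod_mult. assert (0 < Cmod a) by now apply Cmod_gt_0.
  assert (Cmod (1 - RtoC t * k) < 1); [|nra].
  apply Cmod_lt_of_sqr; [lra|]. rewrite Cmod_sqr in H. autorewrite with reim. nra.
Qed.

(** The dual cone of a half plane is a ray. Testing with [1] gives the sign of [Re q], testing with
    [1 + i s] for large [|s|] removes [Im q]. *)
Lemma half_plane_dual (q : C) : (forall k, 0 < Re k -> 0 <= Re (q * k)) -> Im q = 0 /\ 0 <= Re q.
Proof.
  intro H.
  assert (H1 : 0 <= Re q).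
  { specialize (H (RtoC 1)). rewrite Re_RtoC in H. rewrite Re_mult, Re_RtoC, Im_RtoC in H. lra. }
  split; [|exact H1].
  assert (H2 : forall s, 0 <= Re q - Im q * s).
  { intro s. specialize (H (1, s)). rewrite Re_mult in H. simpl in H. lra. }
  destruct (Req_dec (Im q) 0) as [|n]; [assumption|]. exfalso.
  specialize (H2 ((Re q + 1) / Im q)).
  replace (Im q * ((Re q + 1) / Im q)) with (Re q + 1) in H2 by (field; exact n). lra.
Qed.

(* At a point of least modulus in [{Re p >= 0}], every inward direction decreases [Re p], which
   forces [z p'(z)] to be real and nonnegative. *)
Lemma jack (p : C -> C) : hol disk p -> Re (p 0) < 0 ->
  (forall z k, disk z -> z <> RtoC 0 -> Re (p z) = 0 -> (z * Cder p z)%C = RtoC k -> 0 <= k -> False) ->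
  forall z, disk z -> Re (p z) < 0.
Proof.
  intros Hp H0 Hjack z1 Hz1. apply Rnot_le_lt. intro Hge.
  set (K := fun z => Cmod z <= Cmod z1 /\ 0 <= Re (p z)).
  assert (KD : forall z, K z -> disk z) by (intros z [H _]; unfold disk in *; lra).
  assert (Clt : forall z, disk z -> Re (p z) < 0 ->
     exists d, 0 < d /\ forall w, Cmod (w - z) < d -> Re (p w) < 0).
  { intros z Hz Hn. destruct (hol_ccont _ _ _ Hp Hz (- Re (p z))) as [d [Hd H]]; [lra|].
    exists d. split; [exact Hd|]. intros w Hw. specialize (H w Hw).
    generalize (Re_le_Cmod (p w - p z)). rewrite Re_minus. lra. }
  destruct (min_modulus K (fun z => z)) as [z [Hz Hmin]].
  - split.
    + exists (Cmod z1). intros z [H _]. exact H.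
    + intros z Hz. destruct (Rle_lt_dec (Cmod z) (Cmod z1)) as [Hle|Hlt].
      * assert (Hn : Re (p z) < 0) by (apply Rnot_le_lt; intro; apply Hz; now split).
        destruct (Clt z) as [d [Hd H]]; [unfold disk in *; lra|exact Hn|].
        exists d. split; [exact Hd|]. intros w Hw [_ Hk]. specialize (H w Hw). lra.
      * exists (Cmod z - Cmod z1). split; [lra|]. intros w Hw [Hk _].
        generalize (Cmod_tri_sub z w). rewrite Cmod_sym. lra.
  - exists z1. split; lra.
  - intros; apply ccont_id.
  - assert (Dz := KD z Hz).
    assert (Hz0 : z <> RtoC 0) by (intro E; rewrite E in Hz; destruct Hz; lra).
    assert (Hin : forall w, Cmod w < Cmod z -> Re (p w) < 0).
    { intros w Hw. apply Rnot_le_lt. intro Hr. assert (K w) by (split; [destruct Hz; lra|exact Hr]).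
      specialize (Hmin w H). lra. }
    assert (Hder := hol_Cder _ _ _ Hp Dz). set (l := Cder p z) in *.
    (* If the real part were positive, a slightly smaller positive multiple of [z] would still lie
       in [K], against minimality. *)
    assert (Re0 : Re (p z) = 0).
    { destruct Hz as [_ Hz]. apply Rle_antisym; [|exact Hz]. apply Rnot_lt_le. intro Hgt.
      destruct (hol_ccont _ _ _ Hp Dz (Re (p z)) Hgt) as [d [Hd H]].
      assert (Hc : near0 (fun t => Cmod (z + RtoC t * - (z * 1) - z) < d)).
      { apply near0_disc. replace (z - z)%C with (RtoC 0) by ring. now rewrite Cmod_0. }
      destruct (near0_and _ _ (inward_modulus z (RtoC 1) Hz0 Rlt_0_1) Hc) as [t [HI Hw]].
      set (w := (z + RtoC t * - (z * 1))%C) in *.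
      specialize (H w Hw). specialize (Hin w HI).
      generalize (re_le_Cmod (p w - p z)). rewrite Re_minus. intro A.
      assert (Rabs (Re (p w) - Re (p z)) < Re (p z)) by lra. apply Rabs_def2 in H1. lra. }
    destruct (half_plane_dual (z * l)) as [Hi Hr].
    { intros k Hk. apply Rnot_lt_le. intro Hneg.
      assert (Hi : near0 (fun t => Re (p z) < Re (p (z + RtoC t * - (z * k))%C))).
      { apply (cderiv_dir_increase p z l); [exact Hder|].
        replace (l * - (z * k))%C with (- (z * l * k))%C by ring. rewrite Re_opp. lra. }
      destruct (near0_and _ _ Hi (inward_modulus z k Hz0 Hk)) as [t [H1 H2]].
      specialize (Hin _ H2). lra. }
    apply (Hjack z (Re (z * l))); auto. apply C_ext; [reflexivity|]. rewrite Im_RtoC. exact Hi.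
Qed.

(** * Univalent functions *)

(** The induction runs on the index of some nonzero Taylor coefficient, not necessarily the first;
    each division by [z] lowers it by one. *)
Lemma zero_order r g : 0 < r -> hol (disc 0 r) g -> (exists z, Cmod z < r /\ g z <> RtoC 0) ->
  exists p G, hol (disc 0 r) G /\ G 0 <> RtoC 0 /\ forall z, Cmod z < r -> g z = (z ^ p * G z)%C.
Proof.
  intros Hr Hg [z [Hz Hn]]. destruct (hol_taylor r g Hr Hg) as [a Ha].
  assert (Hex : exists p, a p <> RtoC 0).
  { apply NNPP. intro H. apply Hn. apply cps_unique with a z; [now apply Ha|].
    apply cps_ext with (fun k => RtoC 0 * a k)%C.
    - intro k. transitivity (RtoC 0); [ring|]. apply NNPP. intro E. apply H. exists k. congruence.
    - generalize (cps_scal (RtoC 0) a z (g z) (Ha z Hz)).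
      replace (RtoC 0 * g z)%C with (RtoC 0) by ring. auto. }
  destruct Hex as [p Hp]. clear z Hz Hn. revert a g Hg Ha Hp. induction p as [|p IH]; intros a g Hg Ha Hp.
  - exists 0%nat, g. split; [exact Hg|]. split; [|intros; simpl; ring].
    rewrite (cps_at0 a (g 0)); [exact Hp|]. apply Ha. now rewrite Cmod_0.
  - destruct (classic (g 0 = RtoC 0)) as [E|E].
    2:{ exists 0%nat, g. split; [exact Hg|]. split; [exact E|intros; simpl; ring]. }
    destruct (hol_factor r g Hr Hg E) as [g1 [Hg1 E1]].
    assert (Ha1 : forall z, Cmod z < r -> cps (fun k => a (S k)) z (g1 z)).
    { destruct (hol_taylor r g1 Hr Hg1) as [b Hb]. intros z Hz.
      apply cps_ext with b; [|now apply Hb]. intro k.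
      apply (cps_coef_unique (fun k => match k with O => RtoC 0 | S k => b k end) a g r Hr) with (k := S k); auto.
      intros w Hw. rewrite E1 by exact Hw.
      apply (cps_ext (PS_incr_1 (V := C_NormedModule) b)).
      - intros [|k']; reflexivity.
      - exact (is_pseries_incr_1 (K := C_AbsRing) (V := C_NormedModule) b w (g1 w) (Hb w Hw)). }
    destruct (IH (fun k => a (S k)) g1 Hg1 Ha1 Hp) as [q [G [HG [G0 EG]]]].
    exists (S q), G. split; [exact HG|]. split; [exact G0|]. intros z Hz.
    rewrite E1, EG by exact Hz. simpl. ring.
Qed.

Lemma disc_center c r : 0 < r -> disc c r c.
Proof. intro Hr. unfold disc. replace (c - c)%C with (RtoC 0) by ring. now rewrite Cmod_0. Qed.

(* If [F'(0) = 0], the minimum principle gives a zero of the symmetric difference quotient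
   [z |-> (F (z + h) - F (z - h)) / 2h] near the origin, against injectivity. *)
Lemma inj_deriv_neq0_aux rho F : 0 < rho -> hol (disc 0 rho) F -> injective_on (disc 0 rho) F ->
  ~ cderiv F 0 0.
Proof.
  intros Hrho HF Hinj H0.
  assert (HD := hol_derivative _ _ (copen_disc 0 rho) HF).
  assert (E0 : Cder F 0 = RtoC 0) by now apply Cder_eq.
  destruct (zero_order rho (Cder F) Hrho HD) as [p [G [HG [G0 EG]]]].
  (* If [F'] vanished identically, so would all coefficients of [F] beyond the constant one, and [F]
     would not be injective. *)
  { apply NNPP. intro H. destruct (hol_taylor rho F Hrho HF) as [b Hb].
    destruct (cps_derivative _ _ _ Hb) as [g [Hg Dg]].
    assert (Zg : forall z, Cmod z < rho -> g z = RtoC 0).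
    { intros z Hz. rewrite <- (Cder_eq _ _ _ (Dg z Hz)). apply NNPP. intro. apply H. now exists z. }
    assert (Zb : forall k, b (S k) = RtoC 0).
    { intro k. assert (E : pder b k = RtoC 0).
      { replace (RtoC 0) with (RtoC 0 * pder b k)%C by ring.
        apply (cps_coef_unique (pder b) (fun k => RtoC 0 * pder b k)%C (fun _ => RtoC 0) rho Hrho) with (k := k) .
        - intros z Hz. rewrite <- (Zg z Hz). auto.
        - intros z Hz. generalize (cps_scal (RtoC 0) _ z (g z) (Hg z Hz)).
          replace (RtoC 0 * g z)%C with (RtoC 0) by ring. auto. }
      unfold pder in E. apply (Cmult_cancel_l (RtoC (INR (S k)))).
      - intro N. apply RtoC_inj in N. rewrite S_INR in N. generalize (pos_INR k). lra.
      - rewrite E. ring. }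
    assert (Hc : forall z, Cmod z < rho -> F z = b 0%nat).
    { intros z Hz. apply cps_unique with b z; [auto|]. apply cps_eps. intros e He. exists 0%nat.
      intros n _. replace (psum b z n - b 0%nat)%C with (RtoC 0); [now rewrite Cmod_0|].
      induction n as [|n IHn]; simpl; [ring|]. rewrite Zb.
      replace (psum b z n + RtoC 0 * (z * z ^ n) - b 0%nat)%C with (psum b z n - b 0%nat)%C by ring.
      exact IHn. }
    assert (M : Cmod (RtoC (rho / 2)) = rho / 2) by (apply Cmod_RtoC_pos; lra).
    assert (E : RtoC 0 = RtoC (rho / 2)).
    { apply Hinj; [now apply disc_center|apply disc0; lra|].
      rewrite !Hc; auto; [lra|now rewrite Cmod_0]. }
    apply RtoC_inj in E. lra. }
  destruct (hol_ccont _ _ _ HG (disc_center 0 rho Hrho) (Cmod (G 0) / 2)) as [d [Hd Hcd]].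
  { apply Cmod_gt_0 in G0. lra. }
  (* [s] keeps [|G|] above [|G 0| / 2] on the circle [|z| = s], and it leaves room in the disc of
     radius [rho] for [z + h] and [z - h] when [|z| < 2 s] and [h < s]. *)
  set (s := Rmin (d / 2) (rho / 4)).
  assert (Hs : 0 < s /\ s < d /\ 4 * s <= rho).
  { generalize (Rmin_l (d / 2) (rho / 4)) (Rmin_r (d / 2) (rho / 4)). unfold s.
    assert (0 < Rmin (d / 2) (rho / 4)) by (apply Rmin_pos; lra). lra. }
  set (mu := s ^ p * (Cmod (G 0) / 2)).
  assert (Gp : 0 < Cmod (G 0)) by now apply Cmod_gt_0.
  assert (Hmu : 0 < mu) by (apply Rmult_lt_0_compat; [apply pow_lt|]; lra).
  assert (Hlow : forall z, Cmod z = s -> mu <= Cmod (Cder F z)).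
  { intros z Hz. rewrite EG by lra. rewrite Cmod_mult, Cmod_pow, Hz.
    apply Rmult_le_compat_l; [apply pow_le; lra|].
    specialize (Hcd z). replace (z - RtoC 0)%C with z in Hcd by ring. specialize (Hcd ltac:(lra)).
    generalize (Cmod_tri_sub (G 0) (G z)). rewrite Cmod_sym. lra. }
  destruct (bounded_on (fun z => Cmod (z - 0) <= 2 * s) F) as [B [HB BF]].
  { apply closed_bounded_disc. }
  { intros z Hz. apply (hol_ccont _ _ _ HF). apply disc0. replace (z - RtoC 0)%C with z in Hz by ring. lra. }
  (* [4 B / s^2] is the constant of [hol_taylor2] on discs of radius [s]; with this step the
     difference quotient [D] is within [mu / 4] of [F'] on [|z| <= s]. *)
  set (h := Rmin (s / 2) (mu / (4 * (4 * B / (s * s) + 1)))).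
  assert (Q0 : 0 < 4 * B / (s * s)) by (apply Rdiv_lt_0_compat; nra).
  assert (Hh : 0 < h /\ h < s /\ 4 * B / (s * s) * h <= mu / 4).
  { assert (0 < mu / (4 * (4 * B / (s * s) + 1))) by (apply Rdiv_lt_0_compat; lra).
    assert (h <= s / 2) by apply Rmin_l. assert (h <= mu / (4 * (4 * B / (s * s) + 1))) by apply Rmin_r.
    assert (0 < h) by (apply Rmin_pos; lra). repeat split; try lra.
    apply Rle_trans with ((4 * B / (s * s) + 1) * (mu / (4 * (4 * B / (s * s) + 1)))).
    - apply Rmult_le_compat; lra.
    - clearbody h mu. set (K := 4 * B / (s * s)) in *. clearbody K. right. field. lra. }
  assert (Hh1 : Cmod (RtoC h) = h) by (apply Cmod_RtoC_pos; lra).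
  assert (Hhn : RtoC h <> RtoC 0) by (intro E; apply RtoC_inj in E; lra).
  set (D := fun z => ((F (z + RtoC h)%C - F (z - RtoC h)%C) / (2 * RtoC h))%C).
  assert (H2n : (2 * RtoC h)%C <> RtoC 0).
  { apply Cmult_neq_0; [|exact Hhn]. intro E. apply RtoC_inj in E. lra. }
  assert (HDF : forall z, Cmod z <= s -> Cmod (D z - Cder F z) <= mu / 4).
  { intros z Hz.
    assert (Hsub : forall w, disc z s w -> disc 0 rho w).
    { intros w Hw. apply disc0. unfold disc in Hw. generalize (Cmod_tri_sub w z). lra. }
    assert (Hz' : disc 0 rho z) by (apply disc0; lra).
    assert (T : forall k, Cmod k = h -> Cmod (F (z + k)%C - F z - Cder F z * k) <= mu / 4 * h).
    { intros k Hk. destruct (hol_taylor2 z s F B (Cder F z) k) as [T _]; try lra.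
      - now apply (hol_subset (disc 0 rho)).
      - now apply (hol_Cder (disc 0 rho)).
      - intros w Hw. apply BF. replace (w - RtoC 0)%C with w by ring.
        generalize (Cmod_tri_sub w z). lra.
      - eapply Rle_trans; [exact T|]. rewrite Hk. replace (h ^ 2) with (h * h) by ring. nra. }
    assert (T1 := T (RtoC h) Hh1). assert (T2 := T (- RtoC h)%C). rewrite Cmod_opp in T2. specialize (T2 Hh1).
    replace (D z - Cder F z)%C with
      (((F (z + RtoC h)%C - F z - Cder F z * RtoC h) - (F (z + - RtoC h)%C - F z - Cder F z * - RtoC h)) / (2 * RtoC h))%C.
    2:{ unfold D. unfold Cminus at 8. field. exact Hhn. }
    rewrite Cmod_div by exact H2n. rewrite Cmod_mult, Hh1.
    replace (Cmod 2) with 2 by (rewrite Cmod_RtoC_pos; lra).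
    apply Rmult_le_reg_r with (2 * h); [lra|]. unfold Rdiv at 1. rewrite Rmult_assoc, Rinv_l, Rmult_1_r by lra.
    eapply Rle_trans; [apply Cmod_minus_le|]. lra. }
  assert (HDn : forall z, disc 0 (2 * s) z -> D z <> RtoC 0).
  { intros z Hz E. rewrite disc0 in Hz. unfold D in E.
    assert (E2 : F (z + RtoC h)%C = F (z - RtoC h)%C).
    { assert (E3 : (F (z + RtoC h)%C - F (z - RtoC h)%C)%C = RtoC 0).
      { replace (F (z + RtoC h)%C - F (z - RtoC h)%C)%C with
          ((F (z + RtoC h)%C - F (z - RtoC h)%C) / (2 * RtoC h) * (2 * RtoC h))%C by (field; exact Hhn).
        rewrite E. ring. }
      replace (F (z + RtoC h)%C) with ((F (z + RtoC h)%C - F (z - RtoC h)%C) + F (z - RtoC h)%C)%C by ring.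
      rewrite E3. ring. }
    apply Hinj in E2.
    - apply H2n. replace (2 * RtoC h)%C with ((z + RtoC h) - (z - RtoC h))%C by ring. rewrite E2. ring.
    - apply disc0. eapply Rle_lt_trans; [apply Cmod_triangle|]. lra.
    - apply disc0. eapply Rle_lt_trans; [apply Cmod_minus_le|]. lra. }
  assert (HDh : hol (disc 0 (2 * s)) (fun z => / D z)%C).
  { apply hol_inv; [|exact HDn]. unfold D. unfold Cdiv. apply hol_mult; [|apply hol_const].
    apply hol_minus.
    - apply (hol_comp (disc 0 (2 * s)) (disc 0 rho) F (fun z => z + RtoC h)%C); auto.
      + apply hol_plus; [apply hol_id|apply hol_const].
      + intros z Hz. rewrite disc0 in *. eapply Rle_lt_trans; [apply Cmod_triangle|]. lra.
    - apply (hol_comp (disc 0 (2 * s)) (disc 0 rho) F (fun z => z - RtoC h)%C); auto.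
      + apply hol_minus; [apply hol_id|apply hol_const].
      + intros z Hz. rewrite disc0 in *. eapply Rle_lt_trans; [apply Cmod_minus_le|]. lra. }
  (* [D] has no zeros by injectivity, so the maximum principle applies to [1 / D]. But [|D|] is at
     least [3 mu / 4] on the circle and at most [mu / 4] at its centre. *)
  assert (HM : Cmod (/ D 0) <= / (3 / 4 * mu)).
  { apply (max_principle (2 * s) (fun z => / D z)%C 0 s); [exact HDh|lra|rewrite Cmod_0; lra|].
    intros w Hw. assert (HDw : D w <> RtoC 0) by (apply HDn, disc0; lra).
    rewrite Cmod_inv by exact HDw. apply Rinv_le_contravar; [lra|].
    specialize (HDF w ltac:(lra)). specialize (Hlow w Hw).
    generalize (Cmod_tri_sub (Cder F w) (D w)). rewrite (Cmod_sym (Cder F w)). lra. }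
  assert (HD0 : D 0 <> RtoC 0) by (apply HDn, disc_center; lra).
  rewrite Cmod_inv in HM by exact HD0.
  assert (S1 : Cmod (D 0) <= mu / 4).
  { specialize (HDF 0). rewrite Cmod_0, E0 in HDF. replace (D 0 - RtoC 0)%C with (D 0) in HDF by ring.
    apply HDF. lra. }
  assert (P0 : 0 < Cmod (D 0)) by now apply Cmod_gt_0.
  assert (/ (3 / 4 * mu) < / Cmod (D 0)) by (apply Rinv_lt_contravar; nra). lra.
Qed.

Lemma inj_deriv_neq0 A f z : copen A -> hol A f -> injective_on A f -> A z -> Cder f z <> RtoC 0.
Proof.
  intros HA Hf Hinj Hz E. destruct (HA z Hz) as [d [Hd K]].
  assert (Hs : forall h, disc 0 d h -> A (z + h)%C).
  { intros h Hh. rewrite disc0 in Hh. apply K. now replace (z + h - z)%C with h by ring. }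
  apply (inj_deriv_neq0_aux d (fun h => f (z + h)%C) Hd).
  - apply (proj1 (hol_shift _ _ _)). now apply (hol_subset A).
  - intros x y Hx Hy Exy. apply Hinj in Exy; auto.
    replace x with (z + x - z)%C by ring. rewrite Exy. ring.
  - eapply cderiv_eq; [|apply (cderiv_comp f (fun h => z + h)%C)].
    2:{ apply cderiv_plus; [apply cderiv_const|apply cderiv_id]. }
    2:{ replace (z + RtoC 0)%C with z by ring. apply (hol_Cder A); auto. }
    rewrite E. ring.
Qed.

(** The point of the closed disc where [|f - w|] is least is interior, because on the circle [f] is
    farther from [w] than [f a] is. There [w] is attained, since otherwise a move in the direction
    [(w - f z) / f' z] would decrease the distance. *)
Lemma open_mapping A f a s : copen A -> hol A f -> injective_on A f ->
  (forall z, A z -> Cder f z <> RtoC 0) -> 0 < s -> (forall z, Cmod (z - a) <= s -> A z) ->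
  exists m, 0 < m /\ forall w, Cmod (w - f a) < m -> exists z, Cmod (z - a) < s /\ f z = w.
Proof.
  intros HA Hf Hinj Hd Hs Hsub.
  assert (Hc : forall z, Cmod (z - a) <= s -> forall w, ccont (fun z => f z - w)%C z).
  { intros z Hz w. unfold Cminus. apply ccont_plus; [|apply ccont_const].
    apply (hol_ccont A); auto. }
  destruct (min_modulus (fun z => Cmod (z - a) = s) (fun z => f z - f a)%C) as [z1 [Hz1 Hmin]].
  { apply closed_bounded_circle. }
  { exists (a + RtoC s)%C. replace (a + RtoC s - a)%C with (RtoC s) by ring. apply Cmod_RtoC_pos; lra. }
  { intros z Hz. apply Hc. lra. }
  assert (Ha : A a) by (apply Hsub; replace (a - a)%C with (RtoC 0) by ring; rewrite Cmod_0; lra).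
  assert (Hp : 0 < Cmod (f z1 - f a)).
  { apply Cmod_gt_0. intro E.
    assert (f z1 = f a) by (replace (f z1) with ((f z1 - f a) + f a)%C by ring; rewrite E; ring).
    apply Hinj in H; auto; [|apply Hsub; lra]. rewrite H in Hz1.
    replace (a - a)%C with (RtoC 0) in Hz1 by ring. rewrite Cmod_0 in Hz1. lra. }
  exists (Cmod (f z1 - f a) / 2). split; [lra|]. intros w Hw.
  destruct (min_modulus (fun z => Cmod (z - a) <= s) (fun z => f z - w)%C) as [z [Hz Hzm]].
  { apply closed_bounded_disc. }
  { exists a. replace (a - a)%C with (RtoC 0) by ring. rewrite Cmod_0. lra. }
  { intros z Hz. now apply Hc. }
  assert (Haw : Cmod (f z - w) <= Cmod (f a - w)).
  { apply Hzm. replace (a - a)%C with (RtoC 0) by ring. rewrite Cmod_0. lra. }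
  rewrite (Cmod_sym (f a)) in Haw.
  assert (Hlt : Cmod (z - a) < s).
  { destruct Hz as [|E]; [assumption|]. exfalso. specialize (Hmin z E).
    generalize (Cmod_tri3 (f z) w (f a)). lra. }
  exists z. split; [exact Hlt|]. apply NNPP. intro Hne.
  assert (Az : A z) by now apply Hsub.
  assert (Hdz := Hd z Az). set (l := Cder f z) in *.
  assert (Hn : (w - f z)%C <> RtoC 0).
  { intro E. apply Hne. replace w with ((w - f z) + f z)%C by ring. rewrite E. ring. }
  assert (Happ : near0 (fun t => Cmod (f (z + RtoC t * ((w - f z) / l))%C - w) < Cmod (f z - w))).
  { apply (cderiv_dir_approach f z l w); [now apply (hol_Cder A)|].
    replace (Cconj (w - f z) * (l * ((w - f z) / l)))%C with ((w - f z) * Cconj (w - f z))%C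
      by (field; exact Hdz).
    rewrite Cmod2_conj_mult, Re_RtoC. apply pow_lt. now apply Cmod_gt_0. }
  destruct (near0_and _ _ Happ (near0_disc z ((w - f z) / l) a s Hlt)) as [t [H1 H2]].
  specialize (Hzm _ (Rlt_le _ _ H2)). lra.
Qed.

Definition univ (q : C -> C) : Prop := hol disk q /\ injective_on disk q.

Lemma univ_deriv q z : univ q -> disk z -> Cder q z <> RtoC 0.
Proof. intros [H1 H2] Hz. now apply (inj_deriv_neq0 disk); [apply copen_disk| | |]. Qed.

Lemma disk_inv_spec q w : image q disk w -> disk (disk_inv q w) /\ q (disk_inv q w) = w.
Proof. intro H. unfold disk_inv. apply epsilon_spec. exact H. Qed.

Lemma disk_inv_eq q z : univ q -> disk z -> disk_inv q (q z) = z.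
Proof.
  intros [H1 H2] Hz. destruct (disk_inv_spec q (q z)) as [D E]; [now exists z|]. now apply H2.
Qed.

Lemma univ_local q a e : univ q -> disk a -> 0 < e ->
  exists m, 0 < m /\ forall w, Cmod (w - q a) < m -> image q disk w /\ Cmod (disk_inv q w - a) < e.
Proof.
  intros Hq Ha He. set (s := Rmin (e / 2) ((1 - Cmod a) / 2)). unfold disk in Ha.
  assert (Hs : 0 < s /\ s < e /\ s < 1 - Cmod a).
  { generalize (Rmin_l (e / 2) ((1 - Cmod a) / 2)) (Rmin_r (e / 2) ((1 - Cmod a) / 2)). unfold s.
    assert (0 < Rmin (e / 2) ((1 - Cmod a) / 2)) by (apply Rmin_pos; lra). lra. }
  assert (Hsub : forall z, Cmod (z - a) <= s -> disk z).
  { intros z Hz. unfold disk. generalize (Cmod_tri_sub z a). lra. }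
  destruct (open_mapping disk q a s) as [m [Hm H]]; try apply Hq; try lra.
  - apply copen_disk.
  - intros z Hz. now apply univ_deriv.
  - exact Hsub.
  - exists m. split; [exact Hm|]. intros w Hw. destruct (H w Hw) as [z [Hz E]].
    assert (Dz : disk z) by (apply Hsub; lra). split; [now exists z|].
    rewrite <- E, disk_inv_eq by assumption. lra.
Qed.

Lemma disk_inv_cont q w : univ q -> image q disk w -> ccont (disk_inv q) w.
Proof.
  intros Hq [a [Ha E]] e He. destruct (univ_local q a e Hq Ha He) as [m [Hm H]].
  exists m. split; [exact Hm|]. intros v Hv. rewrite <- E in *. rewrite (disk_inv_eq q a) by assumption.
  now apply H.
Qed.

Lemma disk_inv_cderiv q a : univ q -> disk a -> cderiv (disk_inv q) (q a) (/ Cder q a).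
Proof.
  intros Hq Ha. assert (Hn := univ_deriv q a Hq Ha).
  assert (Hi := disk_inv_eq q a Hq Ha).
  destruct (hol_Cder _ _ _ (proj1 Hq) Ha) as [phi [P1 [P2 [d [Hd P3]]]]].
  assert (Cc : ccont (disk_inv q) (q a)) by (apply disk_inv_cont; auto; now exists a).
  exists (fun w => / phi (disk_inv q w))%C. split; [now rewrite Hi, P1|]. split.
  - apply (ccont_comp Cinv (fun w => phi (disk_inv q w))).
    + apply (ccont_comp phi (disk_inv q)); [exact Cc|]. now rewrite Hi.
    + rewrite Hi, P1. now apply ccont_inv.
  - destruct (ccont_neq phi a 0 P2) as [d1 [Hd1 N1]]; [now rewrite P1|].
    destruct (univ_local q a (Rmin d d1) Hq Ha) as [m [Hm H]]; [now apply Rmin_pos|].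
    exists m. split; [exact Hm|]. intros w Hw. destruct (H w Hw) as [Hw1 Hw2].
    destruct (disk_inv_spec q w Hw1) as [_ E]. rewrite Hi.
    generalize (Rmin_l d d1) (Rmin_r d d1); intros.
    specialize (P3 (disk_inv q w) ltac:(lra)). rewrite E in P3.
    assert (Hp : phi (disk_inv q w) <> RtoC 0) by (apply N1; lra).
    replace (w - q a)%C with (phi (disk_inv q w) * (disk_inv q w - a))%C by (rewrite P3 at 3; ring).
    field. exact Hp.
Qed.

Lemma disk_inv_hol q : univ q -> hol (image q disk) (disk_inv q).
Proof.
  intros Hq. exists (fun w => / Cder q (disk_inv q w))%C. intros w Hw.
  assert (Hw' := Hw). destruct Hw' as [a [Ha E]]. rewrite <- E in *. split.
  - rewrite disk_inv_eq by assumption. now apply disk_inv_cderiv.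
  - apply (ccont_comp Cinv (fun w => Cder q (disk_inv q w))).
    + apply (ccont_comp (Cder q) (disk_inv q)); [now apply disk_inv_cont|].
      rewrite disk_inv_eq by assumption. apply (hol_ccont_Cder disk); auto; [apply copen_disk|apply Hq].
    + rewrite disk_inv_eq by assumption. apply ccont_inv. now apply univ_deriv.
Qed.

(** * Convex univalent functions *)

Definition cv (q : C -> C) : Prop := univ q /\ convex_set (image q disk).

Lemma disk_0 : disk 0.
Proof. unfold disk. rewrite Cmod_0. lra. Qed.

Lemma Cmod_convex_lt1 (x : C) t : Cmod x <= 1 -> x <> RtoC 1 -> 0 < t < 1 ->
  Cmod (RtoC (1 - t) * x + RtoC t) < 1.
Proof.
  intros Hx Hn Ht. apply Cmod_lt_of_sqr; [lra|]. autorewrite with reim.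
  assert (Hx2 : Re x ^ 2 + Im x ^ 2 <= 1).
  { rewrite <- Cmod_sqr. generalize (Cmod_ge_0 x). nra. }
  assert (Hre : Re x < 1).
  { destruct (Rle_lt_dec 1 (Re x)); [|assumption]. exfalso. apply Hn. apply C_ext; simpl.
    - nra.
    - assert (Im x ^ 2 <= 0) by nra. nra. }
  assert (A : 0 < t * (1 - t) * (1 - Re x)) by (repeat apply Rmult_lt_0_compat; lra).
  assert (B : 0 <= (1 - t) ^ 2 * (1 - (Re x ^ 2 + Im x ^ 2))).
  { apply Rmult_le_pos; [apply pow2_ge_0|lra]. }
  nra.
Qed.

(** With [lam = w1 / w2], the inverse of [q] applied to [(1 - t) q (lam z) + t q z] is a self-map of
    the disk fixing [0], and Schwarz's lemma is read off at [z = w2]. Its derivative at [0] is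
    [(1 - t) lam + t], of modulus below [1] unless [lam = 1], which gives strictness. *)
Lemma study q w1 w2 t : cv q -> disk w2 -> Cmod w1 <= Cmod w2 -> w2 <> RtoC 0 -> 0 <= t <= 1 ->
  exists v, q v = (RtoC (1 - t) * q w1 + RtoC t * q w2)%C /\ Cmod v <= Cmod w2 /\
    (w1 <> w2 -> 0 < t < 1 -> Cmod v < Cmod w2).
Proof.
  intros [Hq Hcv] Hw2 Hle Hn Ht. set (lam := (w1 / w2)%C).
  assert (P2 : 0 < Cmod w2) by now apply Cmod_gt_0.
  assert (Hlam : Cmod lam <= 1).
  { unfold lam. rewrite Cmod_div by exact Hn. apply Rmult_le_reg_r with (Cmod w2); [exact P2|].
    unfold Rdiv. rewrite Rmult_assoc, Rinv_l by lra. lra. }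
  assert (Hld : forall z, disk z -> disk (lam * z)%C).
  { intros z Hz. unfold disk in *. rewrite Cmod_mult. generalize (Cmod_ge_0 z) (Cmod_ge_0 lam). nra. }
  set (k := fun z => (RtoC (1 - t) * q (lam * z)%C + RtoC t * q z)%C).
  assert (Hk : forall z, disk z -> image q disk (k z)).
  { intros z Hz. apply Hcv; auto; [exists (lam * z)%C|exists z]; auto. }
  assert (Kh : hol disk k).
  { apply hol_plus; apply hol_scal; [|apply Hq].
    apply (hol_comp disk disk q (fun z => lam * z)%C); auto; [apply hol_scal, hol_id|apply Hq]. }
  set (phi := fun z => disk_inv q (k z)).
  assert (Ph : hol disk phi) by (apply (hol_comp disk (image q disk) (disk_inv q) k); auto; now apply disk_inv_hol).
  assert (K0 : k 0 = q 0).
  { unfold k. replace (lam * RtoC 0)%C with (RtoC 0) by ring. rewrite RtoC_minus. ring. }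
  assert (P0 : phi 0 = RtoC 0) by (unfold phi; rewrite K0; apply disk_inv_eq; auto; apply disk_0).
  destruct (schwarz phi Ph P0) as [g [Hg [E Bg]]].
  { intros z Hz. unfold phi. left. now apply disk_inv_spec, Hk. }
  exists (phi w2). split; [|split].
  - unfold phi. rewrite (proj2 (disk_inv_spec q (k w2) (Hk _ Hw2))). unfold k.
    replace (lam * w2)%C with w1; [reflexivity|]. unfold lam. field. exact Hn.
  - rewrite E, Cmod_mult by exact Hw2. specialize (Bg w2 Hw2). nra.
  - intros Hne Ht'. rewrite E, Cmod_mult by exact Hw2.
    assert (Hq0 := univ_deriv q 0 Hq disk_0).
    assert (Eg : g 0 = (RtoC (1 - t) * lam + RtoC t)%C).
    { assert (D1 : cderiv phi 0 (g 0)).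
      { apply (cderiv_factor_0 1 phi g Rlt_0_1).
        - apply (hol_subset disk); auto. intro z. apply disc_disk.
        - intros z Hz. rewrite P0, E by exact Hz. ring. }
      assert (D2 : cderiv k 0 ((RtoC (1 - t) * lam + RtoC t) * Cder q 0)%C).
      { eapply cderiv_eq; [|apply cderiv_plus; apply cderiv_scal].
        2:{ apply (cderiv_comp q (fun z => lam * z)%C).
            - eapply cderiv_eq; [|apply cderiv_scal, cderiv_id]. reflexivity.
            - replace (lam * RtoC 0)%C with (RtoC 0) by ring. apply (hol_Cder disk); [apply Hq|apply disk_0]. }
        2:{ apply (hol_Cder disk); [apply Hq|apply disk_0]. }
        ring. }
      assert (D3 : cderiv phi 0 (/ Cder q 0 * ((RtoC (1 - t) * lam + RtoC t) * Cder q 0))%C).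
      { apply (cderiv_comp (disk_inv q) k); [exact D2|]. rewrite K0. apply disk_inv_cderiv; auto. apply disk_0. }
      rewrite (cderiv_unique _ _ _ _ D1 D3). field. exact Hq0. }
    assert (Hg0 : Cmod (g 0) < 1).
    { rewrite Eg. apply Cmod_convex_lt1; auto. intro E1. apply Hne.
      replace w1 with (lam * w2)%C by (unfold lam; field; exact Hn). rewrite E1. ring. }
    destruct (schwarz_pick g w2 Hg Bg Hg0 Hw2) as [_ S]. nra.
Qed.

Lemma study_le q w1 w2 t : cv q -> disk w1 -> disk w2 -> 0 <= t <= 1 ->
  exists v, q v = (RtoC (1 - t) * q w1 + RtoC t * q w2)%C /\ Cmod v <= Rmax (Cmod w1) (Cmod w2).
Proof.
  intros Hq H1 H2 Ht. destruct (Rle_lt_dec (Cmod w1) (Cmod w2)) as [Hle|Hlt].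
  - destruct (classic (w2 = RtoC 0)) as [E|Hn].
    + assert (E1 : w1 = RtoC 0).
      { apply Cmod_eq_0. rewrite E, Cmod_0 in Hle. generalize (Cmod_ge_0 w1). lra. }
      exists (RtoC 0). rewrite E, E1, Cmod_0. split; [rewrite RtoC_minus; ring|].
      apply Rmax_l.
    + destruct (study q w1 w2 t Hq H2 Hle Hn Ht) as [v [Ev [Bv _]]].
      exists v. split; [exact Ev|]. eapply Rle_trans; [exact Bv|apply Rmax_r].
  - assert (Hn : w1 <> RtoC 0) by (apply Cmod_gt_0; generalize (Cmod_ge_0 w2); lra).
    destruct (study q w2 w1 (1 - t) Hq H1) as [v [Ev [Bv _]]]; [lra|exact Hn|lra|].
    exists v. split.
    + rewrite Ev. replace (1 - (1 - t)) with t by ring. ring.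
    + eapply Rle_trans; [exact Bv|apply Rmax_l].
Qed.

(** This is Study's theorem that concentric subdisks have convex images. *)
Lemma cv_scale q zeta : cv q -> zeta <> RtoC 0 -> Cmod zeta <= 1 -> cv (fun z => q (zeta * z)%C).
Proof.
  intros Hq Hn Hle.
  assert (P : 0 < Cmod zeta) by now apply Cmod_gt_0.
  assert (Hd : forall z, disk z -> disk (zeta * z)%C).
  { intros z Hz. unfold disk in *. rewrite Cmod_mult. generalize (Cmod_ge_0 z). nra. }
  split.
  - split.
    + apply (hol_comp disk disk q (fun z => zeta * z)%C); auto; [apply hol_scal, hol_id|apply Hq].
    + intros z w Hz Hw E. apply (proj2 (proj1 Hq)) in E; auto.
      now apply Cmult_cancel_l in E.
  - intros x y t [z [Hz Ez]] [w [Hw Ew]] Ht.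
    destruct (study_le q (zeta * z)%C (zeta * w)%C t Hq (Hd z Hz) (Hd w Hw) Ht) as [v [Ev Bv]].
    exists (v / zeta)%C. split.
    + unfold disk in *. rewrite Cmod_div by exact Hn. apply Rmult_lt_reg_r with (Cmod zeta); [exact P|].
      unfold Rdiv. rewrite Rmult_assoc, Rinv_l by lra.
      eapply Rle_lt_trans; [rewrite Rmult_1_r; exact Bv|]. rewrite !Cmod_mult. apply Rmax_lub_lt; nra.
    + replace (zeta * (v / zeta))%C with v by (field; exact Hn). rewrite Ev, Ez, Ew. reflexivity.
Qed.

Lemma cv_sigma q a : cv q -> Cmod a < 1 -> cv (fun z => q (sigma a z)).
Proof.
  intros Hq Ha.
  assert (Hd : forall z, disk z -> disk (sigma a z)) by (intros z Hz; now apply sigma_lt1).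
  assert (Him : forall w, image (fun z => q (sigma a z)) disk w <-> image q disk w).
  { intro w. split; intros [z [Hz E]].
    - exists (sigma a z). auto.
    - exists (sigma (- a) z). split; [apply sigma_lt1; auto; now apply Cmod_opp_lt|].
      rewrite sigma_cancel'; auto. unfold disk in Hz. lra. }
  split.
  - split.
    + apply (hol_comp disk disk q (sigma a)); auto; [|apply Hq].
      apply (hol_sigma_comp disk a (fun z => z)); auto; [apply hol_id|unfold disk; intros; lra].
    + intros z w Hz Hw E. apply (proj2 (proj1 Hq)) in E; auto. unfold disk in *.
      rewrite <- (sigma_cancel a z), <- (sigma_cancel a w) by (auto; lra). now rewrite E.
  - intros x y t Hx Hy Ht. apply Him. apply (proj2 Hq); auto; now apply Him.
Qed.

(** The segment from [q e] towards [q w] pulls back to a curve that stays in [|v| <= |e|] by Study's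
    theorem. Its velocity at [e], [(q w - q e) / q' e], therefore cannot point out of that disc. *)
Lemma support_le q e w : cv q -> disk e -> e <> RtoC 0 -> Cmod w <= Cmod e ->
  Re ((q w - q e) / (e * Cder q e)) <= 0.
Proof.
  intros Hq He Hn Hw. apply Rnot_lt_le. intro Hpos.
  assert (Hd := univ_deriv q e (proj1 Hq) He). set (X := (q w - q e)%C) in *.
  assert (Hi : near0 (fun t => Re (/ e * disk_inv q (q e)) < Re (/ e * disk_inv q (q e + RtoC t * X)%C))).
  { apply (cderiv_dir_increase (fun z => / e * disk_inv q z)%C (q e) (/ e * / Cder q e)%C X).
    - apply cderiv_scal. apply disk_inv_cderiv; auto. apply Hq.
    - replace (/ e * / Cder q e * X)%C with (X / (e * Cder q e))%C by (field; auto). exact Hpos. }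
  assert (H1 : near0 (fun t => 0 < t < 1)) by (exists 1; split; [lra|auto]).
  destruct (near0_and _ _ Hi H1) as [t [H Ht]].
  rewrite (disk_inv_eq q e (proj1 Hq) He) in H.
  replace (/ e * e)%C with (RtoC 1) in H by (field; exact Hn).
  destruct (study q w e (1 - t) Hq He Hw Hn) as [v [Ev [Bv _]]]; [lra|].
  replace (q e + RtoC t * X)%C with (q v) in H.
  2:{ rewrite Ev. unfold X. replace (1 - (1 - t)) with t by ring. rewrite RtoC_minus. ring. }
  unfold disk in He. rewrite (disk_inv_eq q v (proj1 Hq)) in H by (unfold disk; lra).
  rewrite Re_RtoC in H. generalize (Re_le_Cmod (/ e * v)). rewrite Cmod_mult, Cmod_inv by exact Hn.
  intro A. assert (P : 0 < Cmod e) by now apply Cmod_gt_0.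
  assert (/ Cmod e * Cmod v <= 1).
  { apply Rmult_le_reg_l with (Cmod e); [exact P|]. rewrite <- Rmult_assoc, Rinv_r by lra. lra. }
  lra.
Qed.

(** The midpoint of [q w] and [q e] has a preimage [v] with [|v| < |e|]. If the real part were
    nonnegative at [w], it would be so at [v], and moving [v] slightly would make it positive while
    keeping [|v| <= |e|], against [support_le]. *)
Lemma support_lt q e w : cv q -> disk e -> e <> RtoC 0 -> Cmod w <= Cmod e -> w <> e ->
  Re ((q w - q e) / (e * Cder q e)) < 0.
Proof.
  intros Hq He Hn Hw Hne. apply Rnot_le_lt. intro Hge.
  assert (Hd := univ_deriv q e (proj1 Hq) He).
  destruct (study q w e (1 / 2) Hq He Hw Hn) as [v [Ev [_ Bv]]]; [lra|].
  specialize (Bv Hne ltac:(lra)).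
  assert (Dv : disk v) by (unfold disk in *; lra).
  assert (Hdv := univ_deriv q v (proj1 Hq) Dv).
  set (k := (e * Cder q e)%C) in *.
  assert (Hk : k <> RtoC 0) by now apply Cmult_neq_0.
  assert (Rv : 0 <= Re ((q v - q e) / k)).
  { replace ((q v - q e) / k)%C with (RtoC (1 / 2) * ((q w - q e) / k))%C.
    - rewrite Re_scal. lra.
    - rewrite Ev. replace (1 - 1 / 2) with (1 / 2) by field.
      assert (E : RtoC (1 / 2) = (/ 2)%C).
      { unfold Rdiv. rewrite Rmult_1_l. rewrite RtoC_inv by lra. reflexivity. }
      rewrite E. field. exact Hk. }
  (* In this direction [(q - q e) / k] has derivative [1]. *)
  set (d := (k / Cder q v)%C).
  assert (Hi : near0 (fun t => Re ((q v - q e) / k) < Re ((q (v + RtoC t * d)%C - q e) / k))).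
  { apply (cderiv_dir_increase (fun z => (q z - q e) / k)%C v (Cder q v / k)%C d).
    - unfold Cdiv. eapply cderiv_eq; [|apply cderiv_mult; [apply cderiv_minus; [|apply cderiv_const]|apply cderiv_const]].
      2:{ apply (hol_Cder disk); auto. apply Hq. }
      cbv beta. ring.
    - replace (Cder q v / k * d)%C with (RtoC 1) by (unfold d; field; auto). rewrite Re_RtoC. lra. }
  assert (Hv : Cmod (v - 0) < Cmod e) by now rewrite Cminus_0_r.
  destruct (near0_and _ _ Hi (near0_disc v d 0 (Cmod e) Hv)) as [t [H Hin]].
  rewrite Cminus_0_r in Hin. apply Rlt_le in Hin.
  generalize (support_le q e _ Hq He Hn Hin). fold k. lra.
Qed.

Lemma ccont_punctured_eq f g : ccont f 0 -> ccont g 0 ->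
  (forall z, disk z -> z <> RtoC 0 -> f z = g z) -> f 0 = g 0.
Proof.
  intros Hf Hg E. apply Cmod_small_eq. intros e He.
  destruct (Hf (e / 2)) as [d1 [Hd1 H1]]; [lra|]. destruct (Hg (e / 2)) as [d2 [Hd2 H2]]; [lra|].
  set (t := Rmin (1 / 2) (Rmin d1 d2 / 2)).
  assert (P : 0 < Rmin d1 d2) by now apply Rmin_pos.
  assert (T1 : t <= 1 / 2) by apply Rmin_l. assert (T2 : t <= Rmin d1 d2 / 2) by apply Rmin_r.
  assert (T0 : 0 < t) by (apply Rmin_pos; lra).
  generalize (Rmin_l d1 d2) (Rmin_r d1 d2); intros.
  assert (M : Cmod (RtoC t) = t) by (apply Cmod_RtoC_pos; lra).
  specialize (H1 (RtoC t)). specialize (H2 (RtoC t)).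
  replace (RtoC t - RtoC 0)%C with (RtoC t) in * by ring. rewrite M in *.
  specialize (H1 ltac:(lra)). specialize (H2 ltac:(lra)).
  rewrite (E (RtoC t)) in H1; [|unfold disk; lra|intro N; apply RtoC_inj in N; lra].
  generalize (Cmod_tri3 (f 0) (g (RtoC t)) (g 0)). rewrite (Cmod_sym (f 0) (g (RtoC t))). lra.
Qed.

Lemma hol_disc1 f : hol (disc 0 1) f <-> hol disk f.
Proof. split; apply hol_subset; intro z; apply disc_disk. Qed.

(* Schwarz's lemma applied twice to [phi], where [q (phi z) = (q z + q (- z)) / 2], an even
   function vanishing to second order at the origin. *)
Lemma cv_second_coef q : cv q -> Cmod (Cder (Cder q) 0) <= 2 * Cmod (Cder q 0).
Proof.
  intros [Hq Hcv].
  assert (Hh : hol (disc 0 1) q) by (apply hol_disc1; apply Hq).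
  assert (D0 : disc 0 1 0) by (apply disc_center; lra).
  assert (Hneg : forall z, disk z -> disk (- z)%C) by (intros z Hz; unfold disk in *; now rewrite Cmod_opp).
  (* The divided differences [q = q 0 + z f1] and [f1 = f1 0 + z f2] turn the claim into
     [|f2 0| <= |f1 0|], as [q' 0 = f1 0] and [q'' 0 = 2 f2 0]. *)
  destruct (hol_factor 1 (fun z => q z - q 0)%C Rlt_0_1) as [f1 [Hf1 E1]].
  { apply hol_minus; [exact Hh|apply hol_const]. } { ring. }
  destruct (hol_factor 1 (fun z => f1 z - f1 0)%C Rlt_0_1) as [f2 [Hf2 E2]].
  { apply hol_minus; [exact Hf1|apply hol_const]. } { ring. }
  cbv beta in E1, E2.
  assert (Eq1 : cderiv q 0 (f1 0)).
  { apply (cderiv_factor_0 1 q f1 Rlt_0_1 Hf1). intros z Hz. rewrite <- E1 by exact Hz. ring. }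
  assert (Eq2 : cderiv f1 0 (f2 0)).
  { apply (cderiv_factor_0 1 f1 f2 Rlt_0_1 Hf2). intros z Hz. rewrite <- E2 by exact Hz. ring. }
  assert (Ed : forall z, disc 0 1 z -> (f1 z + z * Cder f1 z)%C = Cder q z).
  { intros z Hz. symmetry. apply Cder_eq.
    apply (cderiv_eq _ _ (0 + (1 * f1 z + z * Cder f1 z))%C); [ring|].
    destruct (copen_disc 0 1 z Hz) as [d [Hd K]].
    apply (cderiv_ext_loc (fun z => q 0 + z * f1 z)%C _ _ _ d); [exact Hd| |].
    { intros w Hw. rewrite <- E1; [ring|]. apply disc0. auto. }
    apply cderiv_plus; [apply cderiv_const|]. apply cderiv_mult; [apply cderiv_id|].
    now apply (hol_Cder (disc 0 1)). }
  assert (Edd : Cder (Cder q) 0 = (2 * f2 0)%C).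
  { apply Cder_eq. apply (cderiv_ext_loc (fun z => f1 z + z * Cder f1 z)%C _ _ _ 1); [lra| |].
    { intros w Hw. apply Ed. exact Hw. }
    apply (cderiv_eq _ _ (f2 0 + (1 * Cder f1 0 + 0 * Cder (Cder f1) 0))%C).
    { rewrite (Cder_eq _ _ _ Eq2). ring. }
    apply cderiv_plus; [exact Eq2|]. apply (cderiv_mult (fun z => z)); [apply cderiv_id|].
    apply (hol_Cder (disc 0 1)); [|exact D0]. apply hol_derivative; [apply copen_disc|exact Hf1]. }
  rewrite Edd, (Cder_eq _ _ _ Eq1), Cmod_mult. replace (Cmod 2) with 2 by (rewrite Cmod_RtoC_pos; lra).
  apply Rmult_le_compat_l; [lra|].
  set (k := fun z => (RtoC (1 - 1 / 2) * q z + RtoC (1 / 2) * q (- z))%C).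
  assert (Hk : forall z, disk z -> image q disk (k z)).
  { intros z Hz. apply Hcv; [exists z; auto|exists (- z)%C; auto|lra]. }
  assert (Kh : hol disk k).
  { apply hol_plus; apply hol_scal; [apply Hq|].
    apply (hol_comp disk disk q (fun z => - z)%C); auto; [apply hol_opp, hol_id|apply Hq]. }
  assert (Half : RtoC (1 - 1 / 2) = RtoC (1 / 2)) by (f_equal; lra).
  assert (Half2 : (RtoC (1 / 2) + RtoC (1 / 2))%C = RtoC 1) by (rewrite <- RtoC_plus; f_equal; lra).
  set (phi := fun z => disk_inv q (k z)).
  assert (Ph : hol disk phi) by (apply (hol_comp disk (image q disk) (disk_inv q) k); auto; now apply disk_inv_hol).
  assert (Pd : forall z, disk z -> disk (phi z)) by (intros z Hz; now apply disk_inv_spec, Hk).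
  assert (P0 : phi 0 = RtoC 0).
  { unfold phi. replace (k 0) with (q 0); [apply disk_inv_eq; auto; apply disk_0|].
    unfold k. replace (- RtoC 0)%C with (RtoC 0) by ring. rewrite Half.
    transitivity ((RtoC (1 / 2) + RtoC (1 / 2)) * q 0)%C; [rewrite Half2|]; ring. }
  destruct (schwarz phi Ph P0) as [g [Hg [E Bg]]].
  { intros z Hz. left. now apply Pd. }
  assert (Cphi : ccont (fun z => f1 (phi z)) 0).
  { apply (ccont_comp f1 phi); [apply (hol_ccont disk); auto; apply disk_0|].
    rewrite P0. now apply (hol_ccont (disc 0 1)). }
  assert (C2 : ccont (fun z => RtoC (1 / 2) * (f2 z + f2 (- z)%C))%C 0).
  { apply ccont_mult; [apply ccont_const|]. apply ccont_plus; [now apply (hol_ccont (disc 0 1))|].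
    apply (ccont_comp f2 (fun z => - z)%C).
    - apply (hol_ccont (disc 0 1)); [apply hol_opp, hol_id|exact D0].
    - replace (- RtoC 0)%C with (RtoC 0) by ring. now apply (hol_ccont (disc 0 1)). }
  (* Both sides are [(k z - q 0) / z]: on the left through [k = q (phi)] with [phi = z g], on the
     right through the expansions of [q z] and [q (- z)], whose odd parts cancel. *)
  assert (Main : forall z, disk z -> z <> RtoC 0 ->
     (g z * f1 (phi z))%C = (z * (RtoC (1 / 2) * (f2 z + f2 (- z))))%C).
  { intros z Hz Hn. apply (Cmult_cancel_l z); [exact Hn|].
    transitivity (phi z * f1 (phi z))%C; [rewrite E at 2 by exact Hz; ring|].
    rewrite <- E1 by now apply Pd. unfold phi. rewrite (proj2 (disk_inv_spec q (k z) (Hk z Hz))).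
    unfold k. rewrite Half.
    assert (Hz' := Hneg z Hz).
    assert (A1 : q z = (q 0 + z * (f1 0 + z * f2 z))%C).
    { rewrite <- E2 by exact Hz. replace (f1 0 + (f1 z - f1 0))%C with (f1 z) by ring.
      rewrite <- E1 by exact Hz. ring. }
    assert (A2 : q (- z)%C = (q 0 + - z * (f1 0 + - z * f2 (- z)%C))%C).
    { rewrite <- E2 by exact Hz'. replace (f1 0 + (f1 (- z)%C - f1 0))%C with (f1 (- z)%C) by ring.
      rewrite <- E1 by exact Hz'. ring. }
    rewrite A1, A2.
    transitivity ((RtoC (1 / 2) + RtoC (1 / 2)) * q 0 - q 0 + z * (z * (RtoC (1 / 2) * (f2 z + f2 (- z)%C))))%C; [ring|].
    rewrite Half2. ring. }
  assert (Hq0 : f1 0 <> RtoC 0).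
  { rewrite <- (Cder_eq _ _ _ Eq1). apply univ_deriv; auto. apply disk_0. }
  assert (Cg : ccont g 0) by (apply (hol_ccont disk); auto; apply disk_0).
  assert (G0 : g 0 = RtoC 0).
  { assert (X : (g 0 * f1 (phi 0))%C = (0 * (RtoC (1 / 2) * (f2 0 + f2 (- 0)%C)))%C).
    { apply (ccont_punctured_eq (fun z => g z * f1 (phi z))%C
        (fun z => z * (RtoC (1 / 2) * (f2 z + f2 (- z)%C)))%C); auto.
      - now apply ccont_mult.
      - apply ccont_mult; [apply ccont_id|exact C2]. }
    rewrite P0 in X. apply (Cmult_cancel_l (f1 0)); [exact Hq0|]. rewrite Cmult_comm, X. ring. }
  (* Now [phi = z^2 chi] with [|chi| <= 1], and comparison at the origin gives
     [chi 0 * f1 0 = f2 0]. *)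
  destruct (schwarz g Hg G0 Bg) as [chi [Hchi [Ec Bc]]].
  assert (F : (chi 0 * f1 (phi 0))%C = (RtoC (1 / 2) * (f2 0 + f2 (- 0)%C))%C).
  { apply (ccont_punctured_eq (fun z => chi z * f1 (phi z))%C (fun z => RtoC (1 / 2) * (f2 z + f2 (- z)%C))%C); auto.
    - apply ccont_mult; [|exact Cphi]. apply (hol_ccont disk); auto. apply disk_0.
    - intros z Hz Hn. apply (Cmult_cancel_l z); [exact Hn|]. rewrite <- Main by auto.
      rewrite Ec by exact Hz. ring. }
  rewrite P0 in F. replace (- RtoC 0)%C with (RtoC 0) in F by ring.
  replace (RtoC (1 / 2) * (f2 0 + f2 0))%C with ((RtoC (1 / 2) + RtoC (1 / 2)) * f2 0)%C in F by ring.
  rewrite Half2, Cmult_1_l in F. rewrite <- F, Cmod_mult.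
  specialize (Bc 0 disk_0). generalize (Cmod_ge_0 (f1 0)). nra.
Qed.

(** The pre-Schwarzian [sigma'' / sigma'] of the automorphism [sigma a], that is, the logarithmic
    derivative of [dsigma a]. *)
Definition psigma (a z : C) : C := (- (2 * Cconj a / (1 + Cconj a * z)))%C.

Lemma cderiv_dsigma (a z : C) : (1 + Cconj a * z)%C <> RtoC 0 ->
  cderiv (dsigma a) z (dsigma a z * psigma a z)%C.
Proof.
  intro Hd. unfold dsigma.
  eapply cderiv_eq; [|apply cderiv_div; [apply cderiv_const|apply cderiv_mult; apply cderiv_affine|]].
  - unfold psigma. cbv beta. field. exact Hd.
  - now apply Cmult_neq_0.
Qed.

(** This is [cv_second_coef] for [q] composed with [sigma u], a convex univalent function whose
    first two derivatives at [0] are [rho q' u] and [rho^2 q'' u - 2 rho (conj u) q' u], with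
    [rho = 1 - |u|^2]. *)
Lemma cv_pre_schwarzian q u : cv q -> disk u ->
  Cmod (RtoC (1 - Cmod u ^ 2) * (Cder (Cder q) u / Cder q u) - 2 * Cconj u) <= 2.
Proof.
  intros Hq Hu. assert (Hq' := Hq). destruct Hq' as [Huq _].
  assert (Hs := cv_second_coef _ (cv_sigma q u Hq Hu)).
  assert (Hden : forall z, disk z -> (1 + Cconj u * z)%C <> RtoC 0).
  { intros z Hz. apply sigma_den; auto. unfold disk in Hz. lra. }
  assert (Hsd : forall z, disk z -> disk (sigma u z)) by (intros; now apply sigma_lt1).
  assert (D1 : forall z, disk z -> cderiv (fun z => q (sigma u z)) z (Cder q (sigma u z) * dsigma u z)%C).
  { intros z Hz. apply (cderiv_comp q (sigma u)); [apply cderiv_sigma; auto|].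
    apply (hol_Cder disk); [apply Huq|auto]. }
  assert (Hn := univ_deriv q u Huq Hu).
  assert (E1 : Cder (fun z => q (sigma u z)) 0 = (Cder q u * RtoC (1 - Cmod u ^ 2))%C).
  { rewrite (Cder_eq _ _ _ (D1 0 disk_0)), sigma_0. unfold dsigma.
    rewrite Cmod2_conj_mult, <- RtoC_minus. field. }
  assert (E2 : Cder (Cder (fun z => q (sigma u z))) 0 =
     (Cder (Cder q) u * (RtoC (1 - Cmod u ^ 2) * RtoC (1 - Cmod u ^ 2)) +
      Cder q u * (RtoC (1 - Cmod u ^ 2) * - (2 * Cconj u)))%C).
  { apply Cder_eq. apply (cderiv_ext_loc (fun z => Cder q (sigma u z) * dsigma u z)%C _ _ _ 1); [lra| |].
    { intros w Hw. symmetry. apply Cder_eq, D1. apply disc_disk. exact Hw. }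
    assert (Ds0 : dsigma u 0 = RtoC (1 - Cmod u ^ 2)).
    { unfold dsigma. rewrite Cmod2_conj_mult, <- RtoC_minus. field. }
    eapply cderiv_eq; [|apply cderiv_mult; [|apply cderiv_dsigma; apply Hden, disk_0]].
    2:{ apply (cderiv_comp (Cder q) (sigma u)); [apply cderiv_sigma, Hden, disk_0|].
        rewrite sigma_0. apply (hol_Cder disk); [|exact Hu].
        apply hol_derivative; [apply copen_disk|apply Huq]. }
    cbv beta. rewrite sigma_0, Ds0. unfold psigma. field. }
  rewrite E1, E2 in Hs.
  assert (Rp : 0 < 1 - Cmod u ^ 2) by (unfold disk in Hu; generalize (Cmod_ge_0 u); nra).
  set (rho := 1 - Cmod u ^ 2) in *.
  assert (Rn : RtoC rho <> RtoC 0) by (intro E; apply RtoC_inj in E; lra).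
  set (k := (Cder q u * RtoC rho)%C) in *.
  assert (Kn : k <> RtoC 0) by now apply Cmult_neq_0.
  assert (Kp : 0 < Cmod k) by now apply Cmod_gt_0.
  apply Rmult_le_reg_r with (Cmod k); [exact Kp|]. rewrite <- Cmod_mult.
  replace ((RtoC rho * (Cder (Cder q) u / Cder q u) - 2 * Cconj u) * k)%C with
    (Cder (Cder q) u * (RtoC rho * RtoC rho) + Cder q u * (RtoC rho * - (2 * Cconj u)))%C; [exact Hs|].
  unfold k. field. exact Hn.
Qed.

(** * The extremal functions *)

(** The derivative of [omega] in [eps] with its factor [z^(n+1)] removed. What remains is a product
    of derivatives of automorphisms and has no zero, not even at [z = 0]. *)
Fixpoint omega_eps (n : nat) (gamma : nat -> C) (eps z : C) : C :=
  match n with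
  | O => dsigma (gamma 0%nat) (eps * z)%C
  | S m => (dsigma (gamma 0%nat) (z * omega m (fun i => gamma (S i)) eps z) *
            omega_eps m (fun i => gamma (S i)) eps z)%C
  end.

Definition small (n : nat) (gamma : nat -> C) : Prop := forall i, (i <= n)%nat -> Cmod (gamma i) < 1.

Lemma small_shift n gamma : small (S n) gamma -> small n (fun i => gamma (S i)).
Proof. intros H i Hi. apply H. lia. Qed.

Lemma small_0 n gamma : small n gamma -> Cmod (gamma 0%nat) < 1.
Proof. intro H. apply H. lia. Qed.

Lemma Cmod_mult_lt1 x y : Cmod x < 1 -> Cmod y <= 1 -> Cmod (x * y) < 1.
Proof. intros. rewrite Cmod_mult. generalize (Cmod_ge_0 x) (Cmod_ge_0 y). nra. Qed.

Lemma omega_lt1 n : forall gamma eps z, small n gamma -> Cmod z < 1 -> Cmod (eps * z) < 1 ->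
  Cmod (omega n gamma eps z) < 1.
Proof.
  induction n as [|n IH]; intros gamma eps z Hg Hz He; simpl.
  - apply sigma_lt1; [now apply small_0 in Hg|exact He].
  - apply sigma_lt1; [now apply small_0 in Hg|]. apply Cmod_mult_lt1; [exact Hz|].
    left. apply IH; auto. now apply small_shift.
Qed.

Lemma omega_cderiv_eps n : forall gamma eps z, small n gamma -> Cmod z < 1 -> Cmod (eps * z) < 1 ->
  cderiv (fun e => omega n gamma e z) eps (z ^ S n * omega_eps n gamma eps z)%C.
Proof.
  induction n as [|n IH]; intros gamma eps z Hg Hz He; simpl.
  - eapply cderiv_eq; [|apply (cderiv_comp (sigma (gamma 0%nat)) (fun e => e * z)%C)].
    2:{ apply cderiv_mult; [apply cderiv_id|apply cderiv_const]. }
    2:{ apply cderiv_sigma. apply sigma_den; [now apply small_0 in Hg|lra]. }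
    cbv beta. ring.
  - assert (Hv : Cmod (omega n (fun i => gamma (S i)) eps z) < 1)
      by (apply omega_lt1; auto; now apply small_shift).
    eapply cderiv_eq; [|apply (cderiv_comp (sigma (gamma 0%nat)) (fun e => z * omega n (fun i => gamma (S i)) e z)%C)].
    2:{ apply cderiv_scal. apply IH; auto. now apply small_shift. }
    2:{ apply cderiv_sigma. apply sigma_den; [now apply small_0 in Hg|].
        left. apply Cmod_mult_lt1; lra. }
    cbv beta. simpl. ring.
Qed.

(** Only the product [eps * z] has to stay in the disk, so [|eps|] may exceed [1]; this is what
    analyticity in [eps] across the unit circle needs. *)
Definition zdom (eps z : C) : Prop := Cmod z < 1 /\ Cmod (eps * z) < 1.

Lemma omega_comp_hol A n : forall gamma ws, hol A ws -> small n gamma ->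
  (forall z, A z -> Cmod z < 1 /\ Cmod (ws z * z) < 1) -> hol A (fun z => omega n gamma (ws z) z).
Proof.
  induction n as [|n IH]; intros gamma ws Hw Hg HA; simpl.
  - apply (hol_sigma_comp A (gamma 0%nat) (fun z => ws z * z)%C).
    + apply hol_mult; [exact Hw|apply hol_id].
    + now apply small_0 in Hg.
    + intros z Hz. left. now apply HA.
  - apply (hol_sigma_comp A (gamma 0%nat) (fun z => z * omega n (fun i => gamma (S i)) (ws z) z)%C).
    + apply hol_mult; [apply hol_id|]. apply IH; auto. now apply small_shift.
    + now apply small_0 in Hg.
    + intros z Hz. destruct (HA z Hz) as [H1 H2]. left. apply Cmod_mult_lt1; [exact H1|]. left.
      apply omega_lt1; auto. now apply small_shift.
Qed.

Lemma omega_hol n gamma eps : small n gamma -> hol (zdom eps) (omega n gamma eps).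
Proof. intro Hg. apply (omega_comp_hol (zdom eps) n gamma (fun _ => eps)); auto. apply hol_const. Qed.

Lemma hol_dsigma_comp A a f : hol A f -> Cmod a < 1 -> (forall z, A z -> Cmod (f z) <= 1) ->
  hol A (fun z => dsigma a (f z)).
Proof.
  intros Hf Ha HB. unfold dsigma.
  assert (Hd : hol A (fun z => 1 + Cconj a * f z)%C) by (apply hol_plus; [apply hol_const|now apply hol_scal]).
  apply hol_div; [apply hol_const|now apply hol_mult|].
  intros z Hz. apply Cmult_neq_0; apply sigma_den; auto.
Qed.

Lemma omega_eps_hol n : forall gamma eps, small n gamma -> hol (zdom eps) (omega_eps n gamma eps).
Proof.
  induction n as [|n IH]; intros gamma eps Hg; simpl.
  - apply (hol_dsigma_comp (zdom eps) (gamma 0%nat) (fun z => eps * z)%C).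
    + apply hol_scal, hol_id.
    + now apply small_0 in Hg.
    + intros z [_ H]. lra.
  - apply hol_mult; [|apply IH; now apply small_shift].
    apply (hol_dsigma_comp (zdom eps) (gamma 0%nat) (fun z => z * omega n (fun i => gamma (S i)) eps z)%C).
    + apply hol_mult; [apply hol_id|]. apply omega_hol. now apply small_shift.
    + now apply small_0 in Hg.
    + intros z [H1 H2]. left. apply Cmod_mult_lt1; [exact H1|]. left.
      apply omega_lt1; auto. now apply small_shift.
Qed.

Lemma omega_eps_ccont n z eps : Cmod z < 1 -> Cmod (eps * z) < 1 ->
  forall gamma, small n gamma -> ccont (fun e => omega_eps n gamma e z) eps.
Proof.
  intros A1 A2. induction n as [|m IHm]; intros gamma Hg; simpl; assert (H0 := small_0 _ _ Hg).
  - apply (ccont_comp (dsigma (gamma 0%nat)) (fun e => e * z)%C).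
    + apply ccont_mult; [apply ccont_id|apply ccont_const].
    + eapply cderiv_cont. apply cderiv_dsigma. apply sigma_den; [exact H0|lra].
  - assert (Hs := small_shift _ _ Hg). apply ccont_mult; [|now apply IHm].
    apply (ccont_comp (dsigma (gamma 0%nat)) (fun e => z * omega m (fun i => gamma (S i)) e z)%C).
    + apply ccont_mult; [apply ccont_const|]. eapply cderiv_cont. now apply omega_cderiv_eps.
    + eapply cderiv_cont. apply cderiv_dsigma. apply sigma_den; [exact H0|].
      left. apply Cmod_mult_lt1; [exact A1|]. left. now apply omega_lt1.
Qed.

Lemma omega_eps_neq0 n : forall gamma eps z, small n gamma -> Cmod z < 1 -> Cmod (eps * z) < 1 ->
  omega_eps n gamma eps z <> RtoC 0.
Proof.
  induction n as [|n IH]; intros gamma eps z Hg Hz He; simpl.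
  - apply dsigma_neq0; [now apply small_0 in Hg|lra].
  - apply Cmult_neq_0; [|apply IH; auto; now apply small_shift].
    apply dsigma_neq0; [now apply small_0 in Hg|]. left. apply Cmod_mult_lt1; [exact Hz|].
    left. apply omega_lt1; auto. now apply small_shift.
Qed.

(* With [Y = z w'(z)] and [X = Re (z d/dz log (dw/deps))], this says that
   [Re (z d/dz log (q'(w) dw/deps)) > 0] for every convex univalent [q]. *)
Definition gap (w : C) (X : R) (Y : C) : Prop :=
  2 * (Cmod Y - Re (Cconj w * Y)) < X * (1 - Cmod w ^ 2).

(** The inequality is invariant under disk automorphisms: both sides acquire the factor
    [(1 - |a|^2) / |1 + conj a u|^2], and the term that [psigma] adds to [X] offsets the change of
    [Re (conj w * Y)]. *)
Lemma gap_sigma a u X Y : Cmod a < 1 -> Cmod u < 1 -> gap u X Y ->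
  gap (sigma a u) (X + Re (psigma a u * Y)) (dsigma a u * Y)%C.
Proof.
  intros Ha Hu H. unfold gap in *. assert (Hu' : Cmod u <= 1) by lra.
  assert (Hd := sigma_den a u Ha Hu'). rewrite sigma_deficit by assumption.
  set (d := (1 + Cconj a * u)%C) in *.
  assert (Pd : 0 < Cmod d) by now apply Cmod_gt_0.
  assert (Pd2 : 0 < Cmod d ^ 2) by now apply pow_lt.
  assert (Pa : 0 < 1 - Cmod a ^ 2) by (generalize (Cmod_ge_0 a); nra).
  assert (E1 : Cmod (dsigma a u * Y) = (1 - Cmod a ^ 2) / Cmod d ^ 2 * Cmod Y).
  { unfold dsigma. fold d. rewrite Cmod_mult, Cmod_div by now apply Cmult_neq_0.
    rewrite Cmod2_conj_mult, <- RtoC_minus, Cmod_RtoC_pos, Cmod_mult by lra.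
    replace (Cmod d ^ 2) with (Cmod d * Cmod d) by ring. reflexivity. }
  assert (Cd : Cconj d <> RtoC 0) by (apply Cmod_gt_0; rewrite Cmod_conj; exact Pd).
  assert (E2 : (Cconj (sigma a u) * (dsigma a u * Y))%C =
     (RtoC ((1 - Cmod a ^ 2) / Cmod d ^ 2) * (Cconj u * Y + RtoC (1 - Cmod u ^ 2) * (Cconj a / d * Y)))%C).
  { unfold sigma, dsigma. fold d. unfold Rdiv.
    rewrite RtoC_mult, RtoC_inv by lra. rewrite <- (Cmod2_conj_mult d).
    rewrite (RtoC_minus 1 (Cmod a ^ 2)), (RtoC_minus 1 (Cmod u ^ 2)).
    rewrite <- (Cmod2_conj_mult a), <- (Cmod2_conj_mult u).
    assert (Ec : Cconj ((u + a) / d) = ((Cconj u + Cconj a) / Cconj d)%C).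
    { unfold Cdiv. rewrite Cmult_conj, Cinv_conj by exact Hd. rewrite Cplus_conj. reflexivity. }
    rewrite Ec. 
    (* This splitting isolates the factor [1 - |u|^2], which is the one that multiplies [X]. *)
    replace (Cconj u + Cconj a)%C with (Cconj u * d + Cconj a * (1 - u * Cconj u))%C by (unfold d; ring).
    field. split; assumption. }
  rewrite E1, E2, Re_scal. set (k := (1 - Cmod a ^ 2) / Cmod d ^ 2).
  assert (Pk : 0 < k) by now apply Rdiv_lt_0_compat.
  replace ((1 - Cmod a ^ 2) * (1 - Cmod u ^ 2) / Cmod d ^ 2) with (k * (1 - Cmod u ^ 2)) by (unfold k; field; lra).
  rewrite Re_plus, Re_scal.
  assert (E3 : Re (psigma a u * Y) = - 2 * Re (Cconj a / d * Y)).
  { unfold psigma. fold d.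
    replace (- (2 * Cconj a / d) * Y)%C with (RtoC (-2) * (Cconj a / d * Y))%C.
    - apply Re_scal.
    - replace (-2) with (- (2)) by ring. rewrite RtoC_opp. field. exact Hd. }
  rewrite E3. set (R1 := Re (Cconj a / d * Y)). clearbody R1 k. clear E1 E2 E3.
  replace (2 * (k * Cmod Y - k * (Re (Cconj u * Y) + (1 - Cmod u ^ 2) * R1))) with
    (k * (2 * (Cmod Y - Re (Cconj u * Y)) - 2 * (1 - Cmod u ^ 2) * R1)) by ring.
  replace ((X + - 2 * R1) * (k * (1 - Cmod u ^ 2))) with
    (k * (X * (1 - Cmod u ^ 2) - 2 * (1 - Cmod u ^ 2) * R1)) by ring.
  apply Rmult_lt_compat_l; lra.
Qed.

(** The inequality is [(1 - |u|)^2 > 0]. It starts the chain with [u = eps * z], where [X = 1] comes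
    from the factor [z] in the derivative. *)
Lemma gap_base u : Cmod u < 1 -> gap u 1 u.
Proof.
  intro Hu. unfold gap. replace (Cconj u * u)%C with (u * Cconj u)%C by ring.
  rewrite Cmod2_conj_mult, Re_RtoC. nra.
Qed.

Lemma gap_mult z v X Y : Cmod z < 1 -> Cmod v < 1 -> gap v X Y ->
  gap (z * v)%C (1 + X) (z * (v + Y))%C.
Proof.
  intros Hz Hv H. unfold gap in *.
  assert (E : Re (Cconj (z * v) * (z * (v + Y))) = Cmod z ^ 2 * (Cmod v ^ 2 + Re (Cconj v * Y))).
  { rewrite !Cmod_sqr. autorewrite with reim. ring. }
  rewrite E, !Cmod_mult.
  assert (T : Cmod (v + Y) <= Cmod v + Cmod Y) by apply Cmod_triangle.
  assert (B : Re (Cconj v * Y) <= Cmod v * Cmod Y).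
  { eapply Rle_trans; [apply Re_le_Cmod|]. rewrite Cmod_mult, Cmod_conj. lra. }
  generalize (Cmod_ge_0 z) (Cmod_ge_0 v) (Cmod_ge_0 Y). intros Z0 V0 Y0.
  set (r := Cmod z) in *. set (b := Cmod v) in *. set (x := Cmod Y) in *. set (y := Re (Cconj v * Y)) in *.
  set (S := Cmod (v + Y)) in *. clearbody r b x y S.
  (* The summand [1] of [1 + X] pays for the term [z v], as in [gap_base], and gives strictness. The
     summand [X] pays for [z Y]; this is [A2]. *)
  assert (A1 : 2 * (r * b - r ^ 2 * b ^ 2) < 1 - (r * b) ^ 2).
  { assert (r * b < 1) by nra. nra. }
  assert (A2 : 2 * (r * x - r ^ 2 * y) <= X * (1 - (r * b) ^ 2)).
  { assert (P1 : 0 < 1 - b ^ 2) by nra. assert (P2 : 0 < 1 - (r * b) ^ 2) by (assert (0 <= r * b < 1) by nra; nra).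
    assert (Q : (r * x - r ^ 2 * y) * (1 - b ^ 2) <= (x - y) * (1 - (r * b) ^ 2)).
    (* Since [y <= b x], the last factor is at least [x (1 - b) (1 - r b)]. *)
    { assert (D : (x - y) * (1 - (r * b) ^ 2) - (r * x - r ^ 2 * y) * (1 - b ^ 2) =
        (1 - r) * (x * (1 + r * b ^ 2) - y * (1 + r))) by ring.
      assert (0 <= (1 - r) * (x * (1 + r * b ^ 2) - y * (1 + r))); [|lra].
      apply Rmult_le_pos; [lra|].
      assert (y * (1 + r) <= b * x * (1 + r)) by (apply Rmult_le_compat_r; lra).
      assert (0 <= x * ((1 - b) * (1 - r * b))).
      { apply Rmult_le_pos; [lra|]. apply Rmult_le_pos; [lra|]. nra. }
      nra. }
    apply Rmult_le_reg_r with (1 - b ^ 2); [exact P1|].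
    apply Rle_trans with (2 * (x - y) * (1 - (r * b) ^ 2)); [lra|].
    replace (X * (1 - (r * b) ^ 2) * (1 - b ^ 2)) with (X * (1 - b ^ 2) * (1 - (r * b) ^ 2)) by ring.
    apply Rmult_le_compat_r; lra. }
  assert (A3 : r * S <= r * (b + x)) by (apply Rmult_le_compat_l; lra).
  lra.
Qed.

(** The summand [INR (S n)] is the logarithmic derivative of the factor [z^(n+1)] that [omega_eps]
    leaves out. Each level of the chain is a multiplication by [z] followed by an automorphism, that
    is, [gap_mult] and then [gap_sigma]. *)
Lemma omega_gap n : forall gamma eps z, small n gamma -> Cmod z < 1 -> Cmod eps <= 1 ->
  gap (omega n gamma eps z)
    (INR (S n) + Re (z * Cder (omega_eps n gamma eps) z / omega_eps n gamma eps z))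
    (z * Cder (omega n gamma eps) z)%C.
Proof.
  assert (Hez : forall eps z, Cmod z < 1 -> Cmod eps <= 1 -> Cmod (eps * z) < 1).
  { intros eps z Hz He. rewrite Cmult_comm. now apply Cmod_mult_lt1. }
  induction n as [|n IH]; intros gamma eps z Hg Hz He; assert (Hu := Hez eps z Hz He);
    assert (Hg0 := small_0 _ _ Hg).
  - assert (Hd := sigma_den (gamma 0%nat) (eps * z) Hg0 (Rlt_le _ _ Hu)).
    assert (Hs := dsigma_neq0 (gamma 0%nat) (eps * z) Hg0 (Rlt_le _ _ Hu)).
    rewrite (Cder_eq (omega_eps 0 gamma eps) z (dsigma (gamma 0%nat) (eps * z) * psigma (gamma 0%nat) (eps * z) * eps)%C).
    2:{ eapply cderiv_eq; [|apply (cderiv_comp (dsigma (gamma 0%nat)) (fun z => eps * z)%C)].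
        2:{ apply cderiv_scal, cderiv_id. } 2:{ now apply cderiv_dsigma. } ring. }
    rewrite (Cder_eq (omega 0 gamma eps) z (dsigma (gamma 0%nat) (eps * z) * eps)%C).
    2:{ eapply cderiv_eq; [|apply (cderiv_comp (sigma (gamma 0%nat)) (fun z => eps * z)%C)].
        2:{ apply cderiv_scal, cderiv_id. } 2:{ now apply cderiv_sigma. } ring. }
    simpl omega. simpl omega_eps. simpl INR.
    replace (z * (dsigma (gamma 0%nat) (eps * z) * eps))%C with (dsigma (gamma 0%nat) (eps * z) * (eps * z))%C by ring.
    replace (z * (dsigma (gamma 0%nat) (eps * z) * psigma (gamma 0%nat) (eps * z) * eps) /
       dsigma (gamma 0%nat) (eps * z))%C with (psigma (gamma 0%nat) (eps * z) * (eps * z))%C by (field; exact Hs).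
    apply gap_sigma; auto. now apply gap_base.
  - set (g' := fun i => gamma (S i)). assert (Hg' : small n g') by now apply small_shift.
    specialize (IH g' eps z Hg' Hz He).
    assert (Hv : Cmod (omega n g' eps z) < 1) by now apply omega_lt1.
    assert (Hzd : zdom eps z) by now split.
    set (v := omega n g' eps z) in *.
    assert (Huv : Cmod (z * v) < 1) by (apply Cmod_mult_lt1; lra).
    assert (Dv := hol_Cder _ _ _ (omega_hol n g' eps Hg') Hzd).
    assert (DE := hol_Cder _ _ _ (omega_eps_hol n g' eps Hg') Hzd).
    assert (HE := omega_eps_neq0 n g' eps z Hg' Hz Hu).
    set (dv := Cder (omega n g' eps) z) in *. set (dE := Cder (omega_eps n g' eps) z) in *.
    assert (Hd := sigma_den (gamma 0%nat) (z * v) Hg0 (Rlt_le _ _ Huv)).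
    assert (Hs := dsigma_neq0 (gamma 0%nat) (z * v) Hg0 (Rlt_le _ _ Huv)).
    assert (Du : cderiv (fun z => z * omega n g' eps z)%C z (v + z * dv)%C).
    { eapply cderiv_eq; [|apply cderiv_mult; [apply cderiv_id|exact Dv]]. cbv beta. fold v. ring. }
    rewrite (Cder_eq (omega_eps (S n) gamma eps) z
      (dsigma (gamma 0%nat) (z * v) * psigma (gamma 0%nat) (z * v) * (v + z * dv) * omega_eps n g' eps z
       + dsigma (gamma 0%nat) (z * v) * dE)%C).
    2:{ apply (cderiv_mult (fun z => dsigma (gamma 0%nat) (z * omega n g' eps z)%C) (omega_eps n g' eps)); [|exact DE].
        apply (cderiv_comp (dsigma (gamma 0%nat)) (fun z => z * omega n g' eps z)%C); [exact Du|].
        now apply cderiv_dsigma. }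
    rewrite (Cder_eq (omega (S n) gamma eps) z (dsigma (gamma 0%nat) (z * v) * (v + z * dv))%C).
    2:{ apply (cderiv_comp (sigma (gamma 0%nat)) (fun z => z * omega n g' eps z)%C); [exact Du|].
        now apply cderiv_sigma. }
    change (omega (S n) gamma eps z) with (sigma (gamma 0%nat) (z * v)).
    change (omega_eps (S n) gamma eps z) with (dsigma (gamma 0%nat) (z * v) * omega_eps n g' eps z)%C.
    set (E := omega_eps n g' eps z) in *.
    replace (z * (dsigma (gamma 0%nat) (z * v) * (v + z * dv)))%C with
      (dsigma (gamma 0%nat) (z * v) * (z * (v + z * dv)))%C by ring.
    replace (z * (dsigma (gamma 0%nat) (z * v) * psigma (gamma 0%nat) (z * v) * (v + z * dv) * E
       + dsigma (gamma 0%nat) (z * v) * dE) / (dsigma (gamma 0%nat) (z * v) * E))%C with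
      (z * dE / E + psigma (gamma 0%nat) (z * v) * (z * (v + z * dv)))%C by (field; auto).
    rewrite Re_plus, <- Rplus_assoc. apply gap_sigma; auto.
    rewrite S_INR. replace (INR (S n) + 1 + Re (z * dE / E)) with (1 + (INR (S n) + Re (z * dE / E))) by ring.
    now apply gap_mult.
Qed.

(** The pre-Schwarzian estimate places [(1 - |w|^2) q'' / q'] in the disc of radius [2] about
    [2 conj w]. Its product with [Y] thus has real part at least [2 Re (conj w * Y) - 2 |Y|], the
    deficit that [gap] compensates. *)
Lemma gap_convex q w X Y : cv q -> disk w -> gap w X Y ->
  0 < X + Re (Cder (Cder q) w / Cder q w * Y).
Proof.
  intros Hq Hw H. unfold gap in H. assert (S := cv_pre_schwarzian q w Hq Hw).
  assert (Rp : 0 < 1 - Cmod w ^ 2) by (unfold disk in Hw; generalize (Cmod_ge_0 w); nra).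
  set (rho := 1 - Cmod w ^ 2) in *. set (T := (Cder (Cder q) w / Cder q w)%C) in *.
  set (tau := (RtoC rho * T - 2 * Cconj w)%C) in *.
  assert (E : rho * Re (T * Y) = 2 * Re (Cconj w * Y) + Re (tau * Y)).
  { rewrite <- Re_scal. replace (RtoC rho * (T * Y))%C with (RtoC 2 * (Cconj w * Y) + tau * Y)%C by (unfold tau; ring).
    now rewrite Re_plus, Re_scal. }
  assert (B : - (2 * Cmod Y) <= Re (tau * Y)).
  { generalize (re_le_Cmod (tau * Y)). rewrite Cmod_mult. intro A.
    assert (Cmod tau * Cmod Y <= 2 * Cmod Y) by (apply Rmult_le_compat_r; [apply Cmod_ge_0|exact S]).
    assert (Rabs (Re (tau * Y)) <= 2 * Cmod Y) by lra. apply Rabs_le_between in H1. lra. }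
  apply Rmult_lt_reg_l with rho; [exact Rp|]. rewrite Rmult_0_r, Rmult_plus_distr_l, E. lra.
Qed.

(** * Integrals depending on a complex parameter *)

(** Holomorphy makes the common bound [B] control the Taylor remainders, and the Lipschitz constants
    of the derivatives, uniformly in [t]. No regularity in [t] beyond integrability enters, and the
    endpoints of [(0, 1)] are left out. *)
Lemma cint_param_hol (F dF : R -> C -> C) (I dI : C -> C) c r B : 0 < r ->
  (forall t, 0 < t < 1 -> hol (disc c r) (F t)) ->
  (forall t z, 0 < t < 1 -> disc c r z -> cderiv (F t) z (dF t z)) ->
  (forall t z, 0 < t < 1 -> disc c r z -> Cmod (F t z) <= B) ->
  (forall z, disc c r z -> cint (fun t => F t z) 0 1 (I z)) ->
  (forall z, disc c r z -> cint (fun t => dF t z) 0 1 (dI z)) ->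
  forall z, disc c r z -> cderiv I z (dI z) /\ ccont dI z.
Proof.
  intros Hr HF HdF HB HI HdI z Hz. unfold disc in Hz.
  set (rho := r - Cmod (z - c)). assert (Hrho : 0 < rho) by (unfold rho; lra).
  assert (B0 : 0 <= B).
  { eapply Rle_trans; [apply Cmod_ge_0|apply (HB (1 / 2) c)]; [lra|now apply disc_center]. }
  assert (Hsub : forall w, Cmod (w - z) < rho -> disc c r w).
  { intros w Hw. unfold disc, rho in *. generalize (Cmod_tri3 w z c). lra. }
  assert (Hnb : forall h, Cmod h < rho -> disc c r (z + h)%C).
  { intros h Hh. apply Hsub. now replace (z + h - z)%C with h by ring. }
  split.
  - set (K := 4 * B / (rho * rho)).
    assert (K0 : 0 <= K) by (apply Rdiv_le_0_compat; nra).
    assert (Q : forall h, Cmod h < rho -> Cmod (I (z + h)%C - I z - dI z * h) <= K * Cmod h ^ 2).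
    { intros h Hh.
      assert (HQ : cint (fun t => F t (z + h)%C - F t z - h * dF t z)%C 0 1 (I (z + h)%C - I z - h * dI z)%C).
      { apply cint_minus; [apply cint_minus|apply cint_Cmult]; auto. }
      replace (I (z + h)%C - I z - dI z * h)%C with (I (z + h)%C - I z - h * dI z)%C by ring.
      replace (K * Cmod h ^ 2) with ((1 - 0) * (K * Cmod h ^ 2)) by ring.
      apply cint_bound with (3 := HQ); [lra|]. intros t Ht. rewrite (Cmult_comm h).
      apply (hol_taylor2 z rho (F t) B (dF t z) h); auto.
      apply (hol_subset (disc c r)); auto. }
    apply cderiv_of_bound. intros e He. exists (Rmin rho (e / (K + 1))). split.
    { apply Rmin_pos; [exact Hrho|]. apply Rdiv_lt_0_compat; lra. }
    intros h Hh. generalize (Rmin_l rho (e / (K + 1))) (Rmin_r rho (e / (K + 1))). intros.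
    eapply Rle_trans; [apply Q; lra|]. generalize (Cmod_ge_0 h); intro.
    replace (K * Cmod h ^ 2) with (K * Cmod h * Cmod h) by ring. apply Rmult_le_compat_r; [lra|].
    assert (Cmod h * (K + 1) <= e).
    { replace e with (e / (K + 1) * (K + 1)) by (field; lra). apply Rmult_le_compat_r; lra. }
    nra.
  (* On discs of radius [s] the derivatives are at most [2 B / s], and hence Lipschitz at [z] with
     constant [K], for every [t] at once. *)
  - set (s := rho / 2). set (K := 2 * (2 * B / s) / s).
    assert (Hs : 0 < s) by (unfold s; lra).
    assert (K0 : 0 <= K).
    { apply Rdiv_le_0_compat; [|exact Hs]. apply Rmult_le_pos; [lra|]. apply Rdiv_le_0_compat; lra. }
    assert (Q : forall h, Cmod h < s -> Cmod (dI (z + h)%C - dI z) <= K * Cmod h).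
    { intros h Hh.
      assert (HQ : cint (fun t => dF t (z + h)%C - dF t z)%C 0 1 (dI (z + h)%C - dI z)%C).
      { apply cint_minus; apply HdI; [apply Hnb; unfold s in *; lra|]. apply Hsub.
        replace (z - z)%C with (RtoC 0) by ring. now rewrite Cmod_0. }
      replace (K * Cmod h) with ((1 - 0) * (K * Cmod h)) by ring.
      apply cint_bound with (3 := HQ); [lra|]. intros t Ht.
      assert (Eq : forall w, disc c r w -> Cder (F t) w = dF t w) by (intros; apply Cder_eq; auto).
      rewrite <- Eq by (apply Hnb; unfold s in *; lra). rewrite <- (Eq z) by (unfold disc; lra).
      apply hol_lipschitz; auto.
      - apply (hol_subset (disc c r)); [|apply hol_derivative; [apply copen_disc|auto]].
        intros w Hw. apply Hsub. unfold disc, s in *. lra.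
      - intros w Hw. assert (Dw : disc c r w) by (apply Hsub; unfold s in *; lra).
        rewrite Eq by exact Dw.
        apply (hol_taylor2 w s (F t) B (dF t w) 0); auto.
        + apply (hol_subset (disc c r)); auto. intros x Hx. apply Hsub. unfold disc in Hx.
          generalize (Cmod_tri3 x w z). unfold s in *. lra.
        + intros x Hx. apply HB; auto. apply Hsub.
          generalize (Cmod_tri3 x w z). unfold s in *. lra.
        + now rewrite Cmod_0. }
    intros e He. exists (Rmin s (e / (K + 1))). split.
    { apply Rmin_pos; [exact Hs|]. apply Rdiv_lt_0_compat; lra. }
    intros w Hw. generalize (Rmin_l s (e / (K + 1))) (Rmin_r s (e / (K + 1))). intros.
    replace w with (z + (w - z))%C at 1 by ring.
    eapply Rle_lt_trans; [apply Q; lra|]. generalize (Cmod_ge_0 (w - z)); intro.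
    assert (Cmod (w - z) * (K + 1) < e).
    { replace e with (e / (K + 1) * (K + 1)) by (field; lra). apply Rmult_lt_compat_r; lra. }
    nra.
Qed.

Lemma rderiv_RtoC t : rderiv RtoC t 1.
Proof.
  apply rderiv_of_quotient with (fun _ => RtoC 1); [reflexivity|apply ccont_const|].
  exists 1. split; [lra|]. intros s _. rewrite RtoC_minus. ring.
Qed.

Lemma rcont_ray f z t : ccont f (RtoC t * z) -> rcont (fun s => f (RtoC s * z)%C) t.
Proof.
  intro H. apply (rcont_comp (fun w => f (w * z)%C) RtoC); [apply rcont_RtoC|].
  apply (ccont_comp f (fun w => w * z)%C); [|exact H].
  apply ccont_mult; [apply ccont_id|apply ccont_const].
Qed.

Lemma ray_in_disc R0 z t : Cmod z < R0 -> 0 <= t <= 1 -> disc 0 R0 (RtoC t * z)%C.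
Proof.
  intros Hz Ht. apply disc0. rewrite Cmod_mult, Cmod_RtoC_pos by lra.
  generalize (Cmod_ge_0 z). nra.
Qed.

Lemma ccont_pow k z : ccont (fun w => w ^ k)%C z.
Proof. induction k; simpl; [apply ccont_const|apply ccont_mult; [apply ccont_id|assumption]]. Qed.

Lemma ray_integrable R0 f m z : hol (disc 0 R0) f -> Cmod z < R0 ->
  exists l, cint (fun t => RtoC t ^ m * f (RtoC t * z)%C)%C 0 1 l.
Proof.
  intros Hf Hz. apply rcont_cint; [lra|]. intros t Ht. apply ccont_mult.
  - apply (rcont_comp (fun w => w ^ m)%C RtoC); [apply rcont_RtoC|apply ccont_pow].
  - apply rcont_ray. apply (hol_ccont _ _ _ Hf). now apply ray_in_disc.
Qed.

(** [z^(m+1) F] is the primitive of [z^m f] vanishing at the origin. The mean along the ray presents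
    it with its zero divided out, so that [F] is holomorphic at [0] too. *)
Lemma ray_mean R0 f m : 0 < R0 -> hol (disc 0 R0) f -> exists F, hol (disc 0 R0) F /\
  (forall z, Cmod z < R0 -> cint (fun t => RtoC t ^ m * f (RtoC t * z)%C)%C 0 1 (F z)) /\
  forall z, Cmod z < R0 -> (z * Cder F z + RtoC (INR (S m)) * F z)%C = f z.
Proof.
  intros HR Hf. set (F := fun z => epsilon (inhabits (RtoC 0))
    (cint (fun t => RtoC t ^ m * f (RtoC t * z)%C)%C 0 1)).
  assert (HF : forall z, Cmod z < R0 -> cint (fun t => RtoC t ^ m * f (RtoC t * z)%C)%C 0 1 (F z)).
  { intros z Hz. unfold F. apply epsilon_spec. now apply (ray_integrable R0). }
  assert (Hdf := hol_derivative _ _ (copen_disc 0 R0) Hf).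
  set (dF := fun z => epsilon (inhabits (RtoC 0))
    (cint (fun t => RtoC t ^ S m * Cder f (RtoC t * z)%C)%C 0 1)).
  assert (HdF : forall z, Cmod z < R0 -> cint (fun t => RtoC t ^ S m * Cder f (RtoC t * z)%C)%C 0 1 (dF z)).
  { intros z Hz. unfold dF. apply epsilon_spec. now apply (ray_integrable R0). }
  assert (Main : forall z, disc 0 R0 z -> cderiv F z (dF z) /\ ccont dF z).
  { intros z Hz. rewrite disc0 in Hz. set (r := (R0 - Cmod z) / 2).
    assert (Hr : 0 < r) by (unfold r; lra).
    assert (Hsub : forall w, disc z r w -> Cmod w < R0).
    { intros w Hw. unfold disc, r in *. generalize (Cmod_tri_sub w z). generalize (Cmod_ge_0 z). lra. }
    destruct (bounded_on (fun w => Cmod (w - 0) <= Cmod z + r) f) as [B [HB Bf]].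
    { apply closed_bounded_disc. }
    { intros w Hw. apply (hol_ccont _ _ _ Hf). apply disc0. replace (w - RtoC 0)%C with w in Hw by ring.
      unfold r in *. lra. }
    apply (cint_param_hol (fun t z => RtoC t ^ m * f (RtoC t * z)%C)%C
      (fun t z => RtoC t ^ S m * Cder f (RtoC t * z)%C)%C F dF z r B); auto.
    - intros t Ht. apply hol_scal. apply (hol_comp (disc z r) (disc 0 R0) f (fun w => RtoC t * w)%C); auto.
      + apply hol_scal, hol_id.
      + intros w Hw. apply ray_in_disc; [auto|lra].
    - intros t w Ht Hw. eapply cderiv_eq; [|apply cderiv_scal; apply (cderiv_comp f (fun w => RtoC t * w)%C)].
      2:{ apply cderiv_scal, cderiv_id. }
      2:{ apply (hol_Cder (disc 0 R0)); auto. apply ray_in_disc; [auto|lra]. }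
      simpl Cpow. ring.
    - intros t w Ht Hw. rewrite Cmod_mult, Cmod_pow, Cmod_RtoC_pos by lra.
      assert (Bw : Cmod (f (RtoC t * w)%C) <= B).
      { apply Bf. replace (RtoC t * w - RtoC 0)%C with (RtoC t * w)%C by ring.
        rewrite Cmod_mult, Cmod_RtoC_pos by lra. unfold disc in Hw.
        generalize (Cmod_tri_sub w z) (Cmod_ge_0 w). nra. }
      assert (Tm : 0 <= t ^ m <= 1).
      { split; [apply pow_le; lra|]. rewrite <- (pow1 m). apply pow_incr. lra. }
      generalize (Cmod_ge_0 (f (RtoC t * w)%C)). nra.
    - now apply disc_center. }
  exists F. split; [now exists dF|]. split; [exact HF|]. intros z Hz.
  assert (Dz : disc 0 R0 z) by now apply disc0.
  rewrite (Cder_eq F z (dF z)) by now apply Main.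
  (* [dg] is the derivative in [t] of [t^(m+1) f (t z)], whose increment over [[0, 1]] is [f z]. *)
  set (dg := fun t => (z * (RtoC t ^ S m * Cder f (RtoC t * z)%C) +
     RtoC (INR (S m)) * (RtoC t ^ m * f (RtoC t * z)%C))%C).
  assert (H1 : cint dg 0 1 (z * dF z + RtoC (INR (S m)) * F z)%C).
  { apply cint_plus; apply cint_Cmult; auto. }
  set (g := fun t => (RtoC t ^ S m * f (RtoC t * z)%C)%C).
  assert (H2 : cint dg 0 1 (g 1 - g 0)%C).
  { apply cint_derive; [lra| |].
    - intros t Ht. unfold g.
      replace (dg t) with ((RtoC (INR (S m)) * RtoC t ^ m * 1 * f (RtoC t * z)%C +
        RtoC t ^ S m * (Cder f (RtoC t * z)%C * (1 * z))) * 1)%C by (unfold dg; ring).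
      apply (rderiv_comp (fun w => w ^ S m * f (w * z)%C)%C RtoC); [apply rderiv_RtoC|].
      apply (cderiv_mult (fun w => w ^ S m)%C (fun w => f (w * z)%C)); [apply (cderiv_pow (fun w => w)), cderiv_id|].
      apply (cderiv_comp f (fun w => w * z)%C).
      + eapply cderiv_eq; [|apply cderiv_mult; [apply cderiv_id|apply cderiv_const]]. cbv beta; ring.
      + apply (hol_Cder (disc 0 R0)); auto. now apply ray_in_disc.
    - intros t Ht. unfold dg.
      apply ccont_plus; (apply ccont_mult; [apply ccont_const|]); apply ccont_mult.
      + apply (rcont_comp (fun w => w ^ S m)%C RtoC); [apply rcont_RtoC|apply ccont_pow].
      + apply rcont_ray. apply (hol_ccont _ _ _ Hdf). now apply ray_in_disc.
      + apply (rcont_comp (fun w => w ^ m)%C RtoC); [apply rcont_RtoC|apply ccont_pow].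
      + apply rcont_ray. apply (hol_ccont _ _ _ Hf). now apply ray_in_disc. }
  rewrite (cint_unique _ _ _ _ _ H1 H2). unfold g.
  replace (RtoC 1 ^ S m)%C with (RtoC 1).
  2:{ clear. induction (S m); simpl; [reflexivity|]. rewrite <- IHn. ring. }
  replace (RtoC 1 * z)%C with z by ring. simpl Cpow. ring.
Qed.

(** * Starlike denominators *)

(* With [H = z^(m+1) H1], [z H' = z^(m+1) M1], this is the classical fact that convexity
   [Re (1 + z H''/H') > 0] implies starlikeness. *)
Lemma starlike_quotient m M1 H1 : hol disk M1 -> hol disk H1 ->
  (forall z, disk z -> M1 z <> RtoC 0) ->
  (forall z, disk z -> (z * Cder H1 z + RtoC (INR (S m)) * H1 z)%C = M1 z) ->
  (forall z, disk z -> 0 < Re (RtoC (INR (S m)) + z * Cder M1 z / M1 z)) ->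
  forall z, disk z -> 0 < Re (H1 z / M1 z).
Proof.
  intros HM HH Hn HE HK z Hz.
  assert (Pm : 0 < INR (S m)) by (rewrite S_INR; generalize (pos_INR m); lra).
  assert (Hj : Re (- (H1 z / M1 z)) < 0); [|rewrite Re_opp in Hj; lra].
  apply (jack (fun z => - (H1 z / M1 z))%C); auto.
  - apply hol_opp, hol_div; auto.
  - assert (E0 := HE 0 disk_0). assert (Hn0 := Hn 0 disk_0).
    assert (Nm : RtoC (INR (S m)) <> RtoC 0) by (intro E; apply RtoC_inj in E; lra).
    replace (- (H1 0 / M1 0))%C with (RtoC (- / INR (S m))).
    { rewrite Re_RtoC. generalize (Rinv_0_lt_compat _ Pm). lra. }
    rewrite RtoC_opp, RtoC_inv by lra. rewrite <- E0 in *.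
    field. split; [|exact Nm].
    intro Eh. apply Hn0. replace (RtoC 0 * Cder H1 0 + RtoC (INR (S m)) * H1 0)%C with (RtoC (INR (S m)) * H1 0)%C by ring.
    rewrite Eh. ring.
  - clear z Hz. intros z k Hz Hz0 Hre Hzp Hk.
    assert (Hnz := Hn z Hz). set (h := H1 z) in *. set (M := M1 z) in *.
    assert (DH := hol_Cder _ _ _ HH Hz). assert (DM := hol_Cder _ _ _ HM Hz).
    rewrite (Cder_eq _ _ (- ((Cder H1 z * M - h * Cder M1 z) / (M * M)))%C) in Hzp.
    2:{ apply cderiv_opp. now apply (cderiv_div H1 M1). }
    set (K := (RtoC (INR (S m)) + z * Cder M1 z / M)%C).
    assert (HKz : 0 < Re K) by exact (HK z Hz).
    (* At the Jack point [s = h / M] is purely imaginary, while [s K = 1 + k] is real and positive.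
       Then [Im (s K) = Im s * Re K = 0] with [Re K > 0] forces [s = 0], which is absurd. *)
    assert (E : ((h / M) * K)%C = RtoC (1 + k)).
    { rewrite RtoC_plus, <- Hzp. specialize (HE z Hz). fold h M in HE.
      replace (RtoC 1) with (M / M)%C by (field; exact Hnz). unfold K.
      replace (M / M)%C with ((z * Cder H1 z + RtoC (INR (S m)) * h) / M)%C by (rewrite HE; reflexivity).
      field. exact Hnz. }
    rewrite Re_opp in Hre. set (s := (h / M)%C) in *.
    assert (E1 : Re (s * K) = 1 + k) by (rewrite E; apply Re_RtoC).
    assert (E2 : Im (s * K) = 0) by (rewrite E; apply Im_RtoC).
    rewrite Re_mult in E1. rewrite Im_mult in E2.
    assert (Rs : Re s = 0) by lra. rewrite Rs in *.
    assert (Is : Im s = 0).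
    { assert (X : Im s * Re K = 0) by lra. apply Rmult_integral in X. destruct X; lra. }
    rewrite Is in E1. lra.
Qed.

(** For [r = R1 / H1] one has [G1 / M1 = r + (H1 / M1) z r']. At a Jack point of [r] the first term
    has real part [0] and [z r' = k >= 0], so starlikeness makes [Re (G1 / M1)] nonnegative, against
    the hypothesis. *)
Lemma starlike_ratio m M1 H1 G1 R1 : hol disk M1 -> hol disk H1 -> hol disk R1 ->
  (forall z, disk z -> M1 z <> RtoC 0) ->
  (forall z, disk z -> (z * Cder H1 z + RtoC (INR (S m)) * H1 z)%C = M1 z) ->
  (forall z, disk z -> (z * Cder R1 z + RtoC (INR (S m)) * R1 z)%C = G1 z) ->
  (forall z, disk z -> 0 < Re (H1 z / M1 z)) ->
  (forall z, disk z -> Re (G1 z / M1 z) < 0) ->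
  forall z, disk z -> Re (R1 z / H1 z) < 0.
Proof.
  intros HM HH HR Hn HE HE2 Hs HG.
  assert (Pm : 0 < INR (S m)) by (rewrite S_INR; generalize (pos_INR m); lra).
  assert (Hh : forall z, disk z -> H1 z <> RtoC 0).
  { intros z Hz E. specialize (Hs z Hz). rewrite E in Hs.
    replace (RtoC 0 / M1 z)%C with (RtoC 0) in Hs by (field; auto). rewrite Re_RtoC in Hs. lra. }
  apply jack.
  - now apply hol_div.
  - assert (E1 := HE 0 disk_0). assert (E2 := HE2 0 disk_0). assert (Hn0 := Hn 0 disk_0).
    specialize (HG 0 disk_0). rewrite <- E1, <- E2 in HG.
    replace (R1 0 / H1 0)%C with ((0 * Cder R1 0 + RtoC (INR (S m)) * R1 0) / (0 * Cder H1 0 + RtoC (INR (S m)) * H1 0))%C; [exact HG|].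
    field. split; [now apply Hh, disk_0|].
    intro E. apply RtoC_inj in E. lra.
  - intros z k Hz Hz0 Hre Hzp Hk.
    assert (Hnz := Hn z Hz). assert (Hhz := Hh z Hz).
    set (h := H1 z) in *. set (M := M1 z) in *. set (r := R1 z) in *.
    assert (DH := hol_Cder _ _ _ HH Hz). assert (DR := hol_Cder _ _ _ HR Hz).
    rewrite (Cder_eq _ _ ((Cder R1 z * h - r * Cder H1 z) / (h * h))%C) in Hzp.
    2:{ now apply (cderiv_div R1 H1). }
    assert (E : (G1 z / M)%C = (r / h + (h / M) * RtoC k)%C).
    { rewrite <- Hzp. specialize (HE z Hz). specialize (HE2 z Hz). fold h M r in HE, HE2.
      rewrite <- HE2. apply (Cmult_cancel_l M); [exact Hnz|].
      transitivity (z * Cder R1 z + RtoC (INR (S m)) * r)%C; [field; exact Hnz|].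
      transitivity ((r / h) * M + z * (Cder R1 z * h - r * Cder H1 z) / h)%C; [|field; auto].
      rewrite <- HE. field. exact Hhz. }
    specialize (HG z Hz). fold M in HG. rewrite E, Re_plus, Hre, Cmult_comm, Re_scal in HG.
    specialize (Hs z Hz). fold h M in Hs. nra.
Qed.

(** The support inequality degenerates at [z = 0] and is recovered there in strict form. If
    [Re (p 0) = 0], the Cayley transform [(1 + p) / (1 - p)] has modulus [1] at the origin, hence is
    constant, and this fails at [1/2]. *)
Lemma Re_neg_at_0 p : hol disk p -> (forall z, disk z -> z <> RtoC 0 -> Re (p z) < 0) -> Re (p 0) < 0.
Proof.
  intros Hp Hneg.
  assert (Hle0 : Re (p 0) <= 0).
  { apply Rnot_lt_le. intro Hpos. destruct (hol_ccont _ _ _ Hp disk_0 _ Hpos) as [d [Hd H]].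
    set (t := Rmin (1 / 2) (d / 2)).
    assert (T1 : t <= 1 / 2) by apply Rmin_l. assert (T2 : t <= d / 2) by apply Rmin_r.
    assert (T0 : 0 < t) by (apply Rmin_pos; lra).
    assert (Mt : Cmod (RtoC t) = t) by (apply Cmod_RtoC_pos; lra).
    specialize (H (RtoC t)). replace (RtoC t - RtoC 0)%C with (RtoC t) in H by ring. rewrite Mt in H.
    specialize (H ltac:(lra)). specialize (Hneg (RtoC t)).
    assert (Re (p (RtoC t)) < 0).
    { apply Hneg; [unfold disk; lra|]. intro E. apply RtoC_inj in E. lra. }
    generalize (re_le_Cmod (p (RtoC t) - p 0)). rewrite Re_minus. intro A.
    assert (B : Rabs (Re (p (RtoC t)) - Re (p 0)) < Re (p 0)) by lra. apply Rabs_def2 in B. lra. }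
  destruct Hle0 as [|E0]; [assumption|]. exfalso.
  assert (Hle : forall z, disk z -> Re (p z) <= 0).
  { intros z Hz. destruct (classic (z = RtoC 0)) as [->|n]; [lra|]. left. now apply Hneg. }
  assert (Hd : forall z, disk z -> (1 - p z)%C <> RtoC 0).
  { intros z Hz E. specialize (Hle z Hz).
    assert (X : Re (1 - p z) = 0) by (rewrite E; apply Re_RtoC). rewrite Re_minus, Re_RtoC in X. lra. }
  set (phi := fun z => ((1 + p z) / (1 - p z))%C).
  assert (Id : forall w, Cmod (1 - w) ^ 2 - Cmod (1 + w) ^ 2 = - 4 * Re w).
  { intro w. rewrite !Cmod_sqr. autorewrite with reim. ring. }
  assert (Mod : forall z, disk z -> Cmod (phi z) = Cmod (1 + p z) / Cmod (1 - p z)).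
  { intros z Hz. unfold phi. apply Cmod_div. auto. }
  assert (Pos : forall z, disk z -> 0 < Cmod (1 - p z)) by (intros; apply Cmod_gt_0; auto).
  set (h := RtoC (1 / 2)).
  assert (Hh : disk h) by (unfold disk, h; rewrite Cmod_RtoC_pos; lra).
  assert (Ec : phi h = phi 0).
  { apply unimodular_const; auto.
    - apply hol_div; auto; [apply hol_plus|apply hol_minus]; auto; apply hol_const.
    - intros z Hz. rewrite Mod by exact Hz. specialize (Pos z Hz). specialize (Hle z Hz).
      specialize (Id (p z)). apply Rmult_le_reg_r with (Cmod (1 - p z)); [exact Pos|].
      unfold Rdiv. rewrite Rmult_assoc, Rinv_l by lra.
      generalize (Cmod_ge_0 (1 + p z)). nra.
    - rewrite Mod by apply disk_0. specialize (Pos 0 disk_0). specialize (Id (p 0)). rewrite E0 in Id.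
      assert (X : Cmod (1 + p 0) = Cmod (1 - p 0)) by (generalize (Cmod_ge_0 (1 + p 0)); nra).
      rewrite X. field. lra. }
  assert (M1 : Cmod (phi 0) = 1).
  { rewrite Mod by apply disk_0. specialize (Pos 0 disk_0). specialize (Id (p 0)). rewrite E0 in Id.
    assert (X : Cmod (1 + p 0) = Cmod (1 - p 0)) by (generalize (Cmod_ge_0 (1 + p 0)); nra).
    rewrite X. field. lra. }
  rewrite <- Ec, Mod in M1 by exact Hh. specialize (Pos h Hh). specialize (Id (p h)).
  assert (Hn : Re (p h) < 0).
  { apply Hneg; auto. unfold h. intro E. apply RtoC_inj in E. lra. }
  assert (X : Cmod (1 + p h) = Cmod (1 - p h)).
  { apply Rmult_eq_reg_r with (/ Cmod (1 - p h)); [|apply Rinv_neq_0_compat; lra].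
    rewrite Rinv_r by lra. exact M1. }
  rewrite X in Id. lra.
Qed.

(* Precomposition with [sigma] and with [v |-> z v] preserves convexity, so the whole chain
   collapses to a single convex univalent [q]. *)
Lemma cv_omega n : forall P gamma z, cv P -> small n gamma -> z <> RtoC 0 -> Cmod z < 1 ->
  exists q, cv q /\ forall e, P (omega n gamma e z) = q (z * e)%C.
Proof.
  induction n as [|n IH]; intros P gamma z HP Hg Hn Hz.
  - exists (fun v => P (sigma (gamma 0%nat) v)). split; [apply cv_sigma; auto; now apply small_0 in Hg|].
    intro e. simpl. now rewrite Cmult_comm.
  - assert (H1 : cv (fun v => P (sigma (gamma 0%nat) (z * v)%C))).
    { apply (cv_scale (fun v => P (sigma (gamma 0%nat) v))); auto; [|lra].
      apply cv_sigma; auto. now apply small_0 in Hg. }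
    destruct (IH _ (fun i => gamma (S i)) z H1 (small_shift _ _ Hg) Hn Hz) as [q [Hq E]].
    exists q. split; [exact Hq|]. intro e. rewrite <- E. reflexivity.
Qed.

(** The derivative of [P (omega)] in [eps] without its factor [z^(n+1)]. *)
Definition mfun (P : C -> C) (n : nat) (gamma : nat -> C) (eps z : C) : C :=
  (Cder P (omega n gamma eps z) * omega_eps n gamma eps z)%C.

Lemma cderiv_P_omega P n gamma eps z : hol disk P -> small n gamma -> Cmod z < 1 ->
  Cmod (eps * z) < 1 ->
  cderiv (fun e => P (omega n gamma e z)) eps (z ^ S n * mfun P n gamma eps z)%C.
Proof.
  intros HP Hg Hz He. eapply cderiv_eq; [|apply (cderiv_comp P (fun e => omega n gamma e z))].
  2:{ now apply omega_cderiv_eps. }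
  2:{ apply (hol_Cder disk); auto. now apply omega_lt1. }
  unfold mfun. ring.
Qed.

Lemma mfun_hol P n gamma eps : hol disk P -> small n gamma -> hol (zdom eps) (mfun P n gamma eps).
Proof.
  intros HP Hg. apply hol_mult; [|now apply omega_eps_hol].
  apply (hol_comp (zdom eps) disk (Cder P) (omega n gamma eps)); [now apply omega_hol| |].
  - apply hol_derivative; [apply copen_disk|exact HP].
  - intros z [H1 H2]. now apply omega_lt1.
Qed.

Lemma zdom_disk eps z : Cmod eps <= 1 -> disk z -> zdom eps z.
Proof.
  intros He Hz. split; [exact Hz|]. rewrite Cmult_comm. now apply Cmod_mult_lt1.
Qed.

Lemma mfun_neq0 P n gamma eps z : univ P -> small n gamma -> zdom eps z -> mfun P n gamma eps z <> RtoC 0.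
Proof.
  intros HP Hg [H1 H2]. apply Cmult_neq_0; [|now apply omega_eps_neq0].
  apply univ_deriv; auto. now apply omega_lt1.
Qed.

(** The convexity condition asked by [starlike_quotient]. The gap inequality yields it with [n + 1],
    and the weight only adds the nonnegative [J]. *)
Lemma mfun_log_deriv P n gamma eps J z : cv P -> small n gamma -> Cmod eps <= 1 -> disk z ->
  0 < Re (RtoC (INR (S (n + J))) + z * Cder (mfun P n gamma eps) z / mfun P n gamma eps z).
Proof.
  intros HP Hg He Hz. assert (Hzd := zdom_disk eps z He Hz). destruct Hzd as [_ Hez].
  assert (Hw := omega_lt1 n gamma eps z Hg Hz Hez).
  assert (Hzd := zdom_disk eps z He Hz).
  assert (Hgap := omega_gap n gamma eps z Hg Hz He).
  assert (Hpos := gap_convex P _ _ _ HP Hw Hgap).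
  assert (DP := univ_deriv P _ (proj1 HP) Hw).
  assert (HE := omega_eps_neq0 n gamma eps z Hg Hz Hez).
  rewrite (Cder_eq (mfun P n gamma eps) z
    (Cder (Cder P) (omega n gamma eps z) * Cder (omega n gamma eps) z * omega_eps n gamma eps z +
     Cder P (omega n gamma eps z) * Cder (omega_eps n gamma eps) z)%C).
  2:{ apply (cderiv_mult (fun z => Cder P (omega n gamma eps z))).
      - apply (cderiv_comp (Cder P) (omega n gamma eps)).
        + apply (hol_Cder (zdom eps)); [now apply omega_hol|exact Hzd].
        + apply (hol_Cder disk); [|exact Hw]. apply hol_derivative; [apply copen_disk|apply HP].
      - apply (hol_Cder (zdom eps)); [now apply omega_eps_hol|exact Hzd]. }
  unfold mfun. set (w := omega n gamma eps z) in *. set (E := omega_eps n gamma eps z) in *.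
  replace (z * (Cder (Cder P) w * Cder (omega n gamma eps) z * E + Cder P w * Cder (omega_eps n gamma eps) z) /
    (Cder P w * E))%C with
    (z * Cder (omega_eps n gamma eps) z / E + Cder (Cder P) w / Cder P w * (z * Cder (omega n gamma eps) z))%C
    by (field; auto).
  rewrite !Re_plus, Re_RtoC. replace (S (n + J)) with (S n + J)%nat by lia. rewrite plus_INR.
  generalize (pos_INR J). lra.
Qed.

(** * Uniform estimates for the extremal functions near the origin *)

Lemma sigma_lip a u v : Cmod a < 1 -> Cmod u <= 1 -> Cmod v <= 1 ->
  Cmod (sigma a u - sigma a v) <= 2 / (1 - Cmod a) * Cmod (u - v).
Proof.
  intros Ha Hu Hv. assert (Hdu := sigma_den a u Ha Hu). assert (Hdv := sigma_den a v Ha Hv).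
  replace (sigma a u - sigma a v)%C with
    ((1 - a * Cconj a) * (u - v) / ((1 + Cconj a * u) * (1 + Cconj a * v)))%C
    by (unfold sigma; field; auto).
  rewrite Cmod_div by now apply Cmult_neq_0.
  rewrite !Cmod_mult, Cmod2_conj_mult, <- RtoC_minus.
  generalize (Cmod_ge_0 a) (Cmod_ge_0 (u - v)); intros A0 X0.
  rewrite Cmod_RtoC_pos by nra.
  assert (L : forall x, Cmod x <= 1 -> 1 - Cmod a <= Cmod (1 + Cconj a * x)).
  { intros x Hx. generalize (Cmod_tri_sub 1 (1 + Cconj a * x)).
    replace (1 - (1 + Cconj a * x))%C with (- (Cconj a * x))%C by ring.
    rewrite Cmod_opp, Cmod_mult, Cmod_conj, Cmod_1. generalize (Cmod_ge_0 x). nra. }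
  assert (Lu := L u Hu). assert (Lv := L v Hv).
  set (p := Cmod (1 + Cconj a * u)) in *. set (q := Cmod (1 + Cconj a * v)) in *.
  assert (Pq : 0 < p * q) by (apply Rmult_lt_0_compat; lra).
  apply Rmult_le_reg_r with (p * q); [exact Pq|].
  unfold Rdiv at 1. rewrite Rmult_assoc, Rinv_l, Rmult_1_r by lra.
  replace (2 / (1 - Cmod a) * Cmod (u - v) * (p * q)) with (2 / (1 - Cmod a) * (p * q) * Cmod (u - v)) by ring.
  apply Rmult_le_compat_r; [exact X0|].
  apply Rle_trans with (2 / (1 - Cmod a) * ((1 - Cmod a) * (1 - Cmod a))).
  - replace (2 / (1 - Cmod a) * ((1 - Cmod a) * (1 - Cmod a))) with (2 * (1 - Cmod a)) by (field; lra). nra.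
  - apply Rmult_le_compat_l; [apply Rdiv_le_0_compat; lra|]. apply Rmult_le_compat; lra.
Qed.

Lemma sigma_unif a s : Cmod a < 1 -> 0 <= s < 1 ->
  exists rho, 0 <= rho < 1 /\ forall u, Cmod u <= s -> Cmod (sigma a u) <= rho.
Proof.
  intros Ha Hs. generalize (Cmod_ge_0 a); intro A0.
  (* A lower bound for [1 - |sigma a u|^2]: the [4] bounds the squared denominator
     [|1 + conj a u|^2]. *)
  set (k := (1 - Cmod a ^ 2) * (1 - s ^ 2) / 4).
  assert (Hk : 0 < k <= 1 / 4).
  { unfold k. assert (0 < 1 - Cmod a ^ 2 <= 1) by nra. assert (0 < 1 - s ^ 2 <= 1) by nra. split; nra. }
  exists (sqrt (1 - k)). split.
  - split; [apply sqrt_pos|]. rewrite <- sqrt_1 at 2. apply sqrt_lt_1; lra.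
  - intros u Hu. generalize (Cmod_ge_0 u); intro U0. assert (Hu1 : Cmod u <= 1) by lra.
    assert (D := sigma_deficit a u Ha Hu1).
    assert (Hd : 0 < Cmod (1 + Cconj a * u)) by now apply Cmod_gt_0, sigma_den.
    assert (Hd2 : Cmod (1 + Cconj a * u) <= 2).
    { eapply Rle_trans; [apply Cmod_triangle|]. rewrite Cmod_1, Cmod_mult, Cmod_conj. nra. }
    assert (K : k <= 1 - Cmod (sigma a u) ^ 2).
    { rewrite D. unfold k, Rdiv. apply Rmult_le_compat.
      - assert (0 < 1 - Cmod a ^ 2) by nra. assert (0 < 1 - s ^ 2) by nra. nra.
      - lra.
      - apply Rmult_le_compat_l; nra.
      - apply Rinv_le_contravar; [now apply pow_lt|]. nra. }
    rewrite <- (sqrt_pow2 (Cmod (sigma a u))) by apply Cmod_ge_0. apply sqrt_le_1; [apply pow2_ge_0|lra|lra].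
Qed.

(** Every one of the [n + 1] levels multiplies the difference by [z], and the automorphisms are
    Lipschitz on the closed disk. *)
Lemma omega_close n : forall gamma, small n gamma -> exists K, 0 <= K /\ forall w e z,
  Cmod z < 1 -> Cmod w <= 1 -> Cmod e <= 1 ->
  Cmod (omega n gamma w z - omega n gamma e z) <= K * Cmod z ^ S n.
Proof.
  induction n as [|n IH]; intros gamma Hg; assert (H0 := small_0 _ _ Hg);
    assert (Kp : 0 < 2 / (1 - Cmod (gamma 0%nat))) by (apply Rdiv_lt_0_compat; lra).
  - exists (2 / (1 - Cmod (gamma 0%nat)) * 2). split; [lra|]. intros w e z Hz Hw He. simpl omega.
    eapply Rle_trans; [apply sigma_lip; auto; rewrite Cmult_comm; left; now apply Cmod_mult_lt1|].
    rewrite Rmult_assoc. apply Rmult_le_compat_l; [lra|].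
    replace (w * z - e * z)%C with ((w - e) * z)%C by ring. rewrite Cmod_mult.
    generalize (Cmod_minus_le w e) (Cmod_ge_0 z). simpl. nra.
  - destruct (IH _ (small_shift _ _ Hg)) as [K [K0 HK]].
    exists (2 / (1 - Cmod (gamma 0%nat)) * K). split; [nra|]. intros w e z Hz Hw He.
    specialize (HK w e z Hz Hw He).
    assert (Hez : forall e, Cmod e <= 1 -> Cmod (e * z) < 1) by (intros; rewrite Cmult_comm; now apply Cmod_mult_lt1).
    assert (Ho : forall e, Cmod e <= 1 -> Cmod (z * omega n (fun i => gamma (S i)) e z) <= 1).
    { intros x Hx. left. apply Cmod_mult_lt1; [exact Hz|]. left. apply omega_lt1; auto. now apply small_shift. }
    simpl omega. eapply Rle_trans; [apply sigma_lip; auto|].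
    rewrite Rmult_assoc. apply Rmult_le_compat_l; [lra|].
    set (x := omega n _ w z) in *. set (y := omega n _ e z) in *.
    replace (z * x - z * y)%C with (z * (x - y))%C by ring. rewrite Cmod_mult.
    replace (K * Cmod z ^ S (S n)) with (Cmod z * (K * Cmod z ^ S n)) by (simpl; ring).
    apply Rmult_le_compat_l; [apply Cmod_ge_0|exact HK].
Qed.

(** The argument of the outermost automorphism is [O(z)], uniformly for [e] in a bounded set that
    may reach beyond the unit circle. *)
Lemma omega_decomp n gamma e z : small n gamma -> Cmod z < 1 -> Cmod (e * z) < 1 ->
  exists u, omega n gamma e z = sigma (gamma 0%nat) u /\ Cmod u <= Rmax 1 (Cmod e) * Cmod z.
Proof.
  intros Hg Hz He. generalize (Cmod_ge_0 z) (Rmax_l 1 (Cmod e)) (Rmax_r 1 (Cmod e)); intros Z0 M1 M2.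
  destruct n as [|n].
  - exists (e * z)%C. split; [reflexivity|]. rewrite Cmod_mult. apply Rmult_le_compat_r; lra.
  - exists (z * omega n (fun i => gamma (S i)) e z)%C. split; [reflexivity|].
    assert (Cmod (omega n (fun i => gamma (S i)) e z) < 1) by (apply omega_lt1; auto; now apply small_shift).
    rewrite Cmod_mult. generalize (Cmod_ge_0 (omega n (fun i => gamma (S i)) e z)). nra.
Qed.

Lemma omega_at_0 n gamma e : omega n gamma e 0 = gamma 0%nat.
Proof.
  destruct n; simpl; [replace (e * RtoC 0)%C with (RtoC 0) by ring|
    replace (RtoC 0 * omega n (fun i => gamma (S i)) e 0)%C with (RtoC 0) by ring]; apply sigma_0.
Qed.

Lemma hol_lip_compact P rho : hol disk P -> 0 <= rho < 1 ->
  exists L, 0 <= L /\ forall u v, Cmod u <= rho -> Cmod v <= rho -> Cmod (P u - P v) <= L * Cmod (u - v).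
Proof.
  intros HP Hr. set (s := (1 - rho) / 2).
  destruct (bounded_on (fun z => Cmod (z - 0) <= rho + s) P) as [B [HB BP]].
  { apply closed_bounded_disc. }
  { intros z Hz. apply (hol_ccont _ _ _ HP). unfold disk. replace (z - RtoC 0)%C with z in Hz by ring.
    unfold s in Hz. lra. }
  assert (Hs : 0 < s) by (unfold s; lra).
  assert (L0 : 0 <= 2 * B / s) by (apply Rdiv_le_0_compat; lra).
  exists (2 * B / s). split; [exact L0|]. intros u v Hu Hv.
  assert (BP' : forall z, Cmod z <= rho + s -> Cmod (P z) <= B).
  { intros z Hz. apply BP. now replace (z - RtoC 0)%C with z by ring. }
  destruct (Rlt_le_dec (Cmod (u - v)) s) as [Hlt|Hge].
  - replace u with (v + (u - v))%C at 1 by ring. apply hol_lipschitz; auto.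
    + apply (hol_subset disk); auto. intros z Hz. unfold disk, disc in *.
      generalize (Cmod_tri_sub z v). unfold s in *. lra.
    + intros z Hz. apply BP'. generalize (Cmod_tri_sub z v). lra.
  - eapply Rle_trans; [apply Cmod_minus_le|].
    assert (Cmod (P u) <= B) by (apply BP'; lra). assert (Cmod (P v) <= B) by (apply BP'; lra).
    apply Rle_trans with (2 * B / s * s); [|now apply Rmult_le_compat_l].
    replace (2 * B / s * s) with (2 * B) by (field; lra). lra.
Qed.

(** A growth bound replaces the comparison of Taylor coefficients: the bound forces a zero at the
    origin, and division by [z] passes it on with exponent [k]. *)
Lemma hol_factor_pow k : forall D, hol disk D ->
  (exists K d, 0 < d /\ forall z, Cmod z < d -> z <> RtoC 0 -> Cmod (D z) <= K * Cmod z ^ k) ->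
  exists G, hol disk G /\ forall z, disk z -> D z = (z ^ k * G z)%C.
Proof.
  induction k as [|k IH]; intros D HD [K [d [Hd HB]]].
  - exists D. split; [exact HD|]. intros; simpl; ring.
  - assert (D0 : D 0 = RtoC 0).
    { apply Cmod_small_eq. intros e He. replace (D 0 - RtoC 0)%C with (D 0) by ring.
      destruct (hol_ccont _ _ _ HD disk_0 (e / 2)) as [d1 [Hd1 H1]]; [lra|].
      set (m := Rmin (Rmin 1 (d / 2)) (Rmin (d1 / 2) (e / (2 * (Rabs K + 1))))).
      generalize (Rabs_pos K); intro KP.
      assert (P4 : 0 < e / (2 * (Rabs K + 1))) by (apply Rdiv_lt_0_compat; lra).
      assert (M0 : 0 < m) by (unfold m; repeat apply Rmin_pos; lra).
      assert (A : m <= Rmin 1 (d / 2)) by apply Rmin_l.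
      assert (A' : m <= Rmin (d1 / 2) (e / (2 * (Rabs K + 1)))) by apply Rmin_r.
      generalize (Rmin_l 1 (d / 2)) (Rmin_r 1 (d / 2)) (Rmin_l (d1 / 2) (e / (2 * (Rabs K + 1))))
        (Rmin_r (d1 / 2) (e / (2 * (Rabs K + 1)))); intros B1 B2 B3 B4.
      assert (Mm : Cmod (RtoC m) = m) by (apply Cmod_RtoC_pos; lra).
      specialize (HB (RtoC m)). rewrite Mm in HB. specialize (HB ltac:(lra)).
      specialize (HB ltac:(intro E; apply RtoC_inj in E; lra)).
      specialize (H1 (RtoC m)). replace (RtoC m - RtoC 0)%C with (RtoC m) in H1 by ring.
      rewrite Mm in H1. specialize (H1 ltac:(lra)).
      assert (C1 : K * m ^ S k <= Rabs K * m).
      { simpl. assert (0 <= m ^ k <= 1).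
        { split; [apply pow_le; lra|]. rewrite <- (pow1 k). apply pow_incr; lra. }
        assert (K <= Rabs K) by apply Rle_abs. 
        apply Rle_trans with (Rabs K * (m * m ^ k)); [apply Rmult_le_compat_r; [nra|assumption]|].
        apply Rmult_le_compat_l; [assumption|]. nra. }
      assert (C2 : Rabs K * m <= e / 2).
      { apply Rle_trans with ((Rabs K + 1) * (e / (2 * (Rabs K + 1)))).
        - apply Rmult_le_compat; lra.
        - right. field. lra. }
      generalize (Cmod_tri_sub (D 0) (D (RtoC m))). rewrite (Cmod_sym (D 0)). lra. }
    destruct (hol_factor 1 D Rlt_0_1 (proj2 (hol_disc1 D) HD) D0) as [g [Hg Eg]].
    destruct (IH g (proj1 (hol_disc1 g) Hg)) as [G [HG EG]].
    { exists K, (Rmin d 1). split; [apply Rmin_pos; lra|]. intros z Hz Hn.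
      generalize (Rmin_l d 1) (Rmin_r d 1); intros.
      assert (Zp : 0 < Cmod z) by now apply Cmod_gt_0.
      specialize (HB z ltac:(lra) Hn). rewrite Eg in HB by lra. rewrite Cmod_mult in HB.
      apply Rmult_le_reg_l with (Cmod z); [exact Zp|].
      replace (Cmod z * (K * Cmod z ^ k)) with (K * Cmod z ^ S k) by (simpl; ring). exact HB. }
    exists G. split; [exact HG|]. intros z Hz. rewrite Eg by exact Hz. rewrite EG by exact Hz. simpl. ring.
Qed.

(** For [|z| < 1/2] all values of [omega] stay in one compact disc [|u| <= rho], on which [P] is
    Lipschitz. *)
Lemma P_omega_close P n gamma : hol disk P -> small n gamma -> exists K, forall w e z,
  Cmod z < 1 / 2 -> Cmod w <= 1 -> Cmod e <= 1 ->
  Cmod (P (omega n gamma w z) - P (omega n gamma e z)) <= K * Cmod z ^ S n.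
Proof.
  intros HP Hg. destruct (omega_close n gamma Hg) as [K [K0 HK]].
  destruct (sigma_unif (gamma 0%nat) (1 / 2) (small_0 _ _ Hg)) as [rho [Hrho Hu]]; [lra|].
  destruct (hol_lip_compact P rho HP Hrho) as [L [L0 HL]].
  exists (L * K). intros w e z Hz Hw He.
  assert (B : forall x, Cmod x <= 1 -> Cmod (omega n gamma x z) <= rho).
  { intros x Hx. destruct (omega_decomp n gamma x z Hg) as [u [E Bu]]; [lra| |].
    - rewrite Cmult_comm. apply Cmod_mult_lt1; lra.
    - rewrite E. apply Hu. rewrite Rmax_left in Bu by lra. lra. }
  eapply Rle_trans; [apply HL; auto|]. rewrite Rmult_assoc. apply Rmult_le_compat_l; [exact L0|].
  apply HK; auto. lra.
Qed.

(** * The weighted integrals *)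

(** One spare power of [zeta] turns the weight into a power with natural exponent, also for
    [j = -1]. *)
Lemma Cpowz_shift j J zeta k : j = (Z.of_nat J - 1)%Z -> zeta <> RtoC 0 ->
  (Cpowz zeta j * zeta ^ S k)%C = (zeta ^ (k + J))%C.
Proof.
  intros -> Hn. destruct J as [|J].
  - simpl Z.of_nat. unfold Z.sub. simpl Z.add. simpl Cpowz. rewrite Nat.add_0_r.
    change (Pos.to_nat 1) with 1%nat. simpl Cpow. field. exact Hn.
  - replace (Z.of_nat (S J) - 1)%Z with (Z.of_nat J) by lia.
    assert (E : Cpowz zeta (Z.of_nat J) = (zeta ^ J)%C).
    { destruct J; [reflexivity|]. unfold Z.of_nat. simpl Cpowz. rewrite SuccNat2Pos.id_succ. reflexivity. }
    rewrite E, Cmult_comm, <- Cpow_add_r. f_equal. lia.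
Qed.

(** The weight [zeta^j] on the segment together with the factor [z0] of [d zeta = z0 dt]. *)
Definition wkernel (j : Z) (z0 : C) (t : R) : C := (Cpowz (RtoC t * z0) j * z0)%C.

Lemma wkernel_pow j J z0 t k (x : C) : j = (Z.of_nat J - 1)%Z -> z0 <> RtoC 0 -> 0 < t ->
  (wkernel j z0 t * ((RtoC t * z0) ^ S k * x))%C = (z0 ^ S (k + J) * (RtoC t ^ (k + J) * x))%C.
Proof.
  intros Hj Hz Ht. unfold wkernel.
  assert (Hn : (RtoC t * z0)%C <> RtoC 0).
  { apply Cmult_neq_0; [|exact Hz]. intro E. apply RtoC_inj in E. lra. }
  transitivity ((Cpowz (RtoC t * z0) j * (RtoC t * z0) ^ S k) * z0 * x)%C; [ring|].
  rewrite (Cpowz_shift j J _ k Hj Hn), Cpow_mult_l. simpl Cpow. ring.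
Qed.

Lemma weighted_int_eq j g g0 z0 l :
  cint (fun t => wkernel j z0 t * (g (RtoC t * z0)%C - g0))%C 0 1 l -> weighted_int j g g0 z0 = l.
Proof.
  intro H. unfold weighted_int, int_from_0. apply cint_RInt.
  apply cint_ext with (3 := H); [lra|]. intros t _. unfold wkernel. ring.
Qed.

(** The zero of [g - g0] at the origin cancels the pole of the weight for [j = -1]. For [0 < t < 1]
    the integrand then equals a continuous function of [t]. *)
Lemma weighted_integrable j J R0 g g0 z0 : j = (Z.of_nat J - 1)%Z -> z0 <> RtoC 0 ->
  Cmod z0 < R0 -> hol (disc 0 R0) g -> g 0 = g0 ->
  cint (fun t => wkernel j z0 t * (g (RtoC t * z0)%C - g0))%C 0 1 (weighted_int j g g0 z0).
Proof.
  intros Hj Hz HR Hg H0. assert (RP : 0 < R0) by (generalize (Cmod_ge_0 z0); lra).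
  destruct (hol_factor R0 (fun z => g z - g0)%C RP) as [f [Hf E]].
  { apply hol_minus; [exact Hg|apply hol_const]. } { rewrite H0. ring. }
  destruct (ray_integrable R0 f (0 + J) z0 Hf HR) as [l Hl].
  assert (H : cint (fun t => wkernel j z0 t * (g (RtoC t * z0)%C - g0))%C 0 1 (z0 ^ S (0 + J) * l)%C).
  { apply cint_ext with (fun t => z0 ^ S (0 + J) * (RtoC t ^ (0 + J) * f (RtoC t * z0)%C))%C; [lra| |].
    - intros t Ht. rewrite E.
      + rewrite <- (wkernel_pow j J z0 t 0) by (auto; lra). simpl Cpow. ring.
      + apply (proj1 (disc0 R0 _)). apply ray_in_disc; [exact HR|lra].
    - now apply cint_Cmult. }
  now rewrite (weighted_int_eq _ _ _ _ _ H).
Qed.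

(* For [|eps|] below this radius, [zdom eps] contains a disc around [0] to which [z0] belongs. *)
Definition eps_radius (z0 : C) : R := 2 / (1 + Cmod z0).

Lemma eps_radius_gt1 z0 : disk z0 -> 1 < eps_radius z0 <= 2.
Proof.
  intro Hz. unfold disk in Hz. generalize (Cmod_ge_0 z0); intro H0. unfold eps_radius. split.
  - apply Rmult_lt_reg_r with (1 + Cmod z0); [lra|]. unfold Rdiv. rewrite Rmult_assoc, Rinv_l by lra. lra.
  - apply Rmult_le_reg_r with (1 + Cmod z0); [lra|]. unfold Rdiv. rewrite Rmult_assoc, Rinv_l by lra. lra.
Qed.

Lemma eps_radius_zdom z0 eps z : disk z0 -> Cmod eps < eps_radius z0 ->
  disc 0 ((1 + Cmod z0) / 2) z -> zdom eps z.
Proof.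
  intros Hz He Hd. rewrite disc0 in Hd. unfold disk in Hz. generalize (Cmod_ge_0 z0) (Cmod_ge_0 z) (Cmod_ge_0 eps); intros.
  split; [lra|]. rewrite Cmod_mult.
  assert (E : eps_radius z0 * ((1 + Cmod z0) / 2) = 1) by (unfold eps_radius; field; lra).
  nra.
Qed.

Lemma Q_integrand P n c gamma j J z0 eps : hol disk P -> small n gamma -> c 0%nat = gamma 0%nat ->
  j = (Z.of_nat J - 1)%Z -> disk z0 -> z0 <> RtoC 0 -> Cmod eps < eps_radius z0 ->
  cint (fun t => wkernel j z0 t * (P (omega n gamma eps (RtoC t * z0)%C) - P (c 0%nat)))%C 0 1
    (Q P n c gamma j z0 eps).
Proof.
  intros HP Hg Hc Hj Hz Hn He. unfold Q.
  apply (weighted_integrable j J ((1 + Cmod z0) / 2)); auto.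
  - unfold disk in Hz. lra.
  - apply (hol_comp _ disk P (omega n gamma eps)); auto.
    + apply (hol_subset (zdom eps)); [|now apply omega_hol]. intros z. now apply eps_radius_zdom.
    + intros z Hd. destruct (eps_radius_zdom z0 eps z Hz He Hd). now apply omega_lt1.
  - now rewrite omega_at_0, Hc.
Qed.

(** Differentiation under the integral on a disc of radius larger than [1]. For [j = -1] the weight
    grows like [1 / t], and the uniform bound comes from [P (omega) - P (c 0)] being [O(t)]. *)
Lemma Q_cderiv P n c gamma j J z0 : hol disk P -> small n gamma -> c 0%nat = gamma 0%nat ->
  j = (Z.of_nat J - 1)%Z -> disk z0 -> z0 <> RtoC 0 ->
  exists dQ, (forall eps, Cmod eps < eps_radius z0 ->
      cderiv (fun e => Q P n c gamma j z0 e) eps (dQ eps) /\ ccont dQ eps) /\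
    forall eps, Cmod eps < eps_radius z0 -> exists l,
      cint (fun t => RtoC t ^ (n + J) * mfun P n gamma eps (RtoC t * z0)%C)%C 0 1 l /\
      dQ eps = (z0 ^ S (n + J) * l)%C.
Proof.
  intros HP Hg Hc Hj Hz Hn. assert (HR1 := eps_radius_gt1 z0 Hz). assert (Hz' := Hz). unfold disk in Hz'.
  assert (Z0 := Cmod_ge_0 z0). assert (Zp : 0 < Cmod z0) by now apply Cmod_gt_0.
  set (R0 := (1 + Cmod z0) / 2).
  set (D := fun eps => epsilon (inhabits (RtoC 0))
     (cint (fun t => RtoC t ^ (n + J) * mfun P n gamma eps (RtoC t * z0)%C)%C 0 1)).
  assert (HD : forall eps, Cmod eps < eps_radius z0 ->
     cint (fun t => RtoC t ^ (n + J) * mfun P n gamma eps (RtoC t * z0)%C)%C 0 1 (D eps)).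
  { intros eps He. unfold D. apply epsilon_spec. apply (ray_integrable R0); [|unfold R0; lra].
    apply (hol_subset (zdom eps)); [|now apply mfun_hol]. intro z. now apply eps_radius_zdom. }
  exists (fun eps => z0 ^ S (n + J) * D eps)%C. split.
  2:{ intros eps He. exists (D eps). auto. }
  assert (Hray : forall t eps, 0 < t < 1 -> Cmod eps < eps_radius z0 -> zdom eps (RtoC t * z0)%C).
  { intros t eps Ht He. apply (eps_radius_zdom z0); auto. apply ray_in_disc; lra. }
  destruct (sigma_unif (gamma 0%nat) (Cmod z0 * (eps_radius z0)) (small_0 _ _ Hg)) as [rho [Hrho Hu]].
  { split; [nra|]. unfold eps_radius. apply Rmult_lt_reg_r with (1 + Cmod z0); [lra|].
    replace (Cmod z0 * (2 / (1 + Cmod z0)) * (1 + Cmod z0)) with (2 * Cmod z0) by (field; lra). lra. }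
  destruct (hol_lip_compact P rho HP Hrho) as [L [L0 HL]].
  set (K := 2 / (1 - Cmod (gamma 0%nat))).
  assert (G1 := small_0 _ _ Hg).
  assert (K0 : 0 < K) by (apply Rdiv_lt_0_compat; lra).
  set (F := fun t eps => (wkernel j z0 t * (P (omega n gamma eps (RtoC t * z0)%C) - P (c 0%nat)))%C).
  set (dF := fun t eps => (wkernel j z0 t * ((RtoC t * z0) ^ S n * mfun P n gamma eps (RtoC t * z0)%C))%C).
  assert (Main : forall eps, disc 0 (eps_radius z0) eps ->
     cderiv (fun e => Q P n c gamma j z0 e) eps (z0 ^ S (n + J) * D eps)%C /\
     ccont (fun eps => z0 ^ S (n + J) * D eps)%C eps).
  (* [L] and [K] are Lipschitz constants of [P] and of [sigma (gamma 0)]; the last factor comes from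
     [|u| <= eps_radius z0 * |t z0|] for the argument [u] of that automorphism. *)
  { apply (cint_param_hol F dF _ _ 0 (eps_radius z0) (L * K * eps_radius z0)).
    - lra.
    - intros t Ht. apply hol_scal. apply hol_minus; [|apply hol_const].
      exists (fun e => (RtoC t * z0) ^ S n * mfun P n gamma e (RtoC t * z0)%C)%C. intros eps He. rewrite disc0 in He.
      destruct (Hray t eps Ht He) as [A1 A2]. split; [now apply cderiv_P_omega|].
      apply ccont_mult; [apply ccont_const|]. unfold mfun. apply ccont_mult.
      + apply (ccont_comp (Cder P) (fun e => omega n gamma e (RtoC t * z0)%C)).
        * eapply cderiv_cont. now apply omega_cderiv_eps.
        * apply (hol_ccont_Cder disk); auto; [apply copen_disk|]. now apply omega_lt1.
      + now apply omega_eps_ccont.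
    - intros t eps Ht He. rewrite disc0 in He. destruct (Hray t eps Ht He) as [A1 A2]. unfold F, dF.
      apply cderiv_scal. eapply cderiv_eq; [|apply cderiv_minus; [now apply cderiv_P_omega|apply cderiv_const]]. ring.
    - intros t eps Ht He. rewrite disc0 in He. destruct (Hray t eps Ht He) as [A1 A2]. unfold F.
      assert (Tz : 0 < Cmod (RtoC t * z0)) by (rewrite Cmod_mult, Cmod_RtoC_pos by lra; nra).
      assert (Tn : (RtoC t * z0)%C <> RtoC 0) by now apply Cmod_gt_0.
      destruct (omega_decomp n gamma eps _ Hg A1 A2) as [u [Eu Bu]].
      assert (Bu' : Cmod u <= Cmod (RtoC t * z0) * eps_radius z0).
      { eapply Rle_trans; [exact Bu|]. rewrite Rmult_comm. apply Rmult_le_compat_l; [lra|].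
        apply Rmax_lub; lra. }
      assert (Tle : Cmod (RtoC t * z0) <= Cmod z0) by (rewrite Cmod_mult, Cmod_RtoC_pos by lra; nra).
      assert (Bz : Cmod z0 * eps_radius z0 < 1).
      { unfold eps_radius. apply Rmult_lt_reg_r with (1 + Cmod z0); [lra|].
        replace (Cmod z0 * (2 / (1 + Cmod z0)) * (1 + Cmod z0)) with (2 * Cmod z0) by (field; lra). lra. }
      assert (Bu2 : Cmod u <= Cmod z0 * eps_radius z0) by nra.
      assert (W1 : Cmod (wkernel j z0 t) * Cmod (RtoC t * z0) <= 1).
      { rewrite <- Cmod_mult. replace (wkernel j z0 t * (RtoC t * z0))%C with
          (wkernel j z0 t * ((RtoC t * z0) ^ 1 * 1))%C by (simpl; ring).
        rewrite (wkernel_pow j J) by (auto; lra). rewrite !Cmod_mult, !Cmod_pow, Cmod_1, Cmod_RtoC_pos by lra.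
        assert (X1 : 0 <= Cmod z0 ^ S (0 + J) <= 1).
        { split; [apply pow_le; lra|]. rewrite <- (pow1 (S (0 + J))). apply pow_incr; lra. }
        assert (X2 : 0 <= t ^ (0 + J) <= 1).
        { split; [apply pow_le; lra|]. rewrite <- (pow1 (0 + J)). apply pow_incr; lra. }
        nra. }
      assert (Dif : Cmod (P (omega n gamma eps (RtoC t * z0)%C) - P (c 0%nat)) <=
         L * (K * (Cmod (RtoC t * z0) * eps_radius z0))).
      { rewrite Eu, Hc. replace (P (gamma 0%nat)) with (P (sigma (gamma 0%nat) 0)) by now rewrite sigma_0.
        eapply Rle_trans; [apply HL|].
        - now apply Hu.
        - apply Hu. rewrite Cmod_0. nra.
        - apply Rmult_le_compat_l; [exact L0|]. eapply Rle_trans.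
          + apply sigma_lip; [exact G1|lra|rewrite Cmod_0; lra].
          + fold K. apply Rmult_le_compat_l; [lra|]. replace (u - RtoC 0)%C with u by ring. exact Bu'. }
      rewrite Cmod_mult. assert (W0 := Cmod_ge_0 (wkernel j z0 t)).
      apply Rle_trans with (Cmod (wkernel j z0 t) * (L * (K * (Cmod (RtoC t * z0) * eps_radius z0)))).
      { now apply Rmult_le_compat_l. }
      replace (Cmod (wkernel j z0 t) * (L * (K * (Cmod (RtoC t * z0) * eps_radius z0)))) with
        (Cmod (wkernel j z0 t) * Cmod (RtoC t * z0) * (L * K * eps_radius z0)) by ring.
      rewrite <- (Rmult_1_l (L * K * eps_radius z0)) at 2. apply Rmult_le_compat_r; [|exact W1].
      apply Rmult_le_pos; [apply Rmult_le_pos|]; lra.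
    - intros eps He. rewrite disc0 in He. now apply (Q_integrand P n c gamma j J).
    - intros eps He. rewrite disc0 in He.
      apply cint_ext with (fun t => z0 ^ S (n + J) * (RtoC t ^ (n + J) * mfun P n gamma eps (RtoC t * z0)%C))%C; [lra| |].
      + intros t Ht. unfold dF. symmetry. apply wkernel_pow; auto. lra.
      + apply cint_Cmult. auto. }
  intros eps He. apply Main. now apply disc0.
Qed.

Lemma mfun_hol_disk P n gamma eps : hol disk P -> small n gamma -> Cmod eps <= 1 ->
  hol disk (mfun P n gamma eps).
Proof.
  intros HP Hg He. apply (hol_subset (zdom eps)); [|now apply mfun_hol].
  intros z Hz. now apply zdom_disk.
Qed.

Lemma Q_cderiv_value P n c gamma j J z0 eps d F : cv P -> small n gamma -> c 0%nat = gamma 0%nat ->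
  j = (Z.of_nat J - 1)%Z -> disk z0 -> z0 <> RtoC 0 -> Cmod eps <= 1 ->
  cderiv (fun e => Q P n c gamma j z0 e) eps d ->
  cint (fun t => RtoC t ^ (n + J) * mfun P n gamma eps (RtoC t * z0)%C)%C 0 1 F ->
  d = (z0 ^ S (n + J) * F)%C.
Proof.
  intros HP Hg Hc Hj Hz Hn He Hd HF.
  destruct (Q_cderiv P n c gamma j J z0 (proj1 (proj1 HP)) Hg Hc Hj Hz Hn) as [dQ [H1 H2]].
  assert (He' : Cmod eps < eps_radius z0) by (generalize (eps_radius_gt1 z0 Hz); lra).
  rewrite (cderiv_unique _ _ _ _ Hd (proj1 (H1 eps He'))).
  destruct (H2 eps He') as [l [Hl E]]. rewrite E. f_equal. exact (cint_unique _ _ _ _ _ Hl HF).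
Qed.

(** [z^(n+J+1) H1 z] is the derivative in [eps] of the weighted integral up to [z]; here it is
    viewed as a function of [z], in which it is starlike. *)
Lemma mfun_ray_mean P n gamma eps J : cv P -> small n gamma -> Cmod eps <= 1 ->
  exists H1, hol disk H1 /\
    (forall z, disk z -> cint (fun t => RtoC t ^ (n + J) * mfun P n gamma eps (RtoC t * z)%C)%C 0 1 (H1 z)) /\
    (forall z, disk z -> (z * Cder H1 z + RtoC (INR (S (n + J))) * H1 z)%C = mfun P n gamma eps z) /\
    (forall z, disk z -> 0 < Re (H1 z / mfun P n gamma eps z)).
Proof.
  intros HP Hg He. assert (HM := mfun_hol_disk P n gamma eps (proj1 (proj1 HP)) Hg He).
  destruct (ray_mean 1 _ (n + J) Rlt_0_1 (proj2 (hol_disc1 _) HM)) as [H1 [HH [HI HE]]].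
  apply hol_disc1 in HH. exists H1. split; [exact HH|]. split; [exact HI|]. split; [exact HE|].
  apply (starlike_quotient (n + J)); auto.
  - intros z Hz. apply mfun_neq0; auto; [apply HP|now apply zdom_disk].
  - intros z Hz. now apply mfun_log_deriv.
Qed.

(** A starlike function has no zero except the one at the origin: [H1 z0 = 0] would contradict
    [Re (H1 / M1) > 0]. *)
Lemma Q_cderiv_neq0 P n c gamma j J z0 eps d : cv P -> small n gamma -> c 0%nat = gamma 0%nat ->
  j = (Z.of_nat J - 1)%Z -> disk z0 -> z0 <> RtoC 0 -> Cmod eps <= 1 ->
  cderiv (fun e => Q P n c gamma j z0 e) eps d -> d <> RtoC 0.
Proof.
  intros HP Hg Hc Hj Hz Hn He Hd.
  destruct (mfun_ray_mean P n gamma eps J HP Hg He) as [H1 [HH [HI [HE Hs]]]].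
  rewrite (Q_cderiv_value P n c gamma j J z0 eps d (H1 z0)); auto.
  apply Cmult_neq_0; [now apply Cpow_nz|]. intro E. specialize (Hs z0 Hz). rewrite E in Hs.
  assert (HM : mfun P n gamma eps z0 <> RtoC 0) by (apply mfun_neq0; [apply HP|auto|now apply zdom_disk]).
  replace (RtoC 0 / mfun P n gamma eps z0)%C with (RtoC 0) in Hs by (field; exact HM).
  rewrite Re_RtoC in Hs. lra.
Qed.

(** For fixed [z] the chain is [q (z e)] with [q] convex univalent, so this is [support_lt] at
    [z eps] against [z w]. The denominators agree because [z eps q' (z eps)] is [eps] times the
    derivative in [eps]. *)
Lemma support_chain P n gamma eps w z : cv P -> small n gamma -> Cmod eps <= 1 -> eps <> RtoC 0 ->
  Cmod w <= Cmod eps -> w <> eps -> disk z -> z <> RtoC 0 ->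
  Re ((P (omega n gamma w z) - P (omega n gamma eps z)) / (eps * (z ^ S n * mfun P n gamma eps z))) < 0.
Proof.
  intros HP Hg He Hen Hw Hwn Hz Hzn.
  destruct (cv_omega n P gamma z HP Hg Hzn Hz) as [q [Hq E]].
  destruct (zdom_disk eps z He Hz) as [_ Hez].
  assert (Dez : disk (z * eps)%C) by (unfold disk; rewrite Cmult_comm; exact Hez).
  assert (Dq : cderiv (fun e => P (omega n gamma e z)) eps (Cder q (z * eps)%C * (z * 1))%C).
  { apply (cderiv_ext_loc (fun e => q (z * e)%C) _ _ _ 1); [lra|intros; now rewrite E|].
    apply (cderiv_comp q (fun e => z * e)%C); [apply cderiv_scal, cderiv_id|].
    apply (hol_Cder disk); [apply Hq|exact Dez]. }
  rewrite <- (cderiv_unique _ _ _ _ Dq (cderiv_P_omega P n gamma eps z (proj1 (proj1 HP)) Hg Hz Hez)).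
  rewrite !E. replace (eps * (Cder q (z * eps)%C * (z * 1)))%C with (z * eps * Cder q (z * eps)%C)%C by ring.
  apply support_lt; auto.
  - now apply Cmult_neq_0.
  - rewrite !Cmod_mult. apply Rmult_le_compat_l; [apply Cmod_ge_0|exact Hw].
  - intro Ez. apply Hwn. now apply Cmult_cancel_l in Ez.
Qed.

Lemma variation_ineq P n c gamma j J z0 eps ws g d : cv P -> small n gamma -> c 0%nat = gamma 0%nat ->
  j = (Z.of_nat J - 1)%Z -> disk z0 -> z0 <> RtoC 0 -> Cmod eps <= 1 -> eps <> RtoC 0 ->
  hol disk ws -> (forall z, disk z -> Cmod (ws z) <= Cmod eps /\ ws z <> eps) ->
  (forall z, disk z -> g z = P (omega n gamma (ws z) z)) ->
  cderiv (fun e => Q P n c gamma j z0 e) eps d ->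
  Re ((weighted_int j g (g 0) z0 - Q P n c gamma j z0 eps) / (eps * d)) < 0.
Proof.
  intros HP Hg Hc Hj Hz Hn He Hen Hws Hwb HgE Hd. assert (HPh := proj1 (proj1 HP)).
  assert (Hw1 : forall z, disk z -> Cmod (ws z) <= 1) by (intros z Hd'; destruct (Hwb z Hd'); lra).
  set (M := mfun P n gamma eps).
  assert (HM : hol disk M) by now apply mfun_hol_disk.
  assert (HMn : forall z, disk z -> M z <> RtoC 0).
  { intros z Hz'. apply mfun_neq0; [apply HP|auto|now apply zdom_disk]. }
  destruct (mfun_ray_mean P n gamma eps J HP Hg He) as [H1 [HH [HI [HE Hs]]]].
  assert (Hgh : hol disk (fun z => P (omega n gamma (ws z) z))).
  { apply (hol_comp disk disk P (fun z => omega n gamma (ws z) z)); auto.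
    - apply omega_comp_hol; auto. intros z Hz'. apply (zdom_disk (ws z) z); auto.
    - intros z Hz'. destruct (zdom_disk (ws z) z (Hw1 z Hz') Hz'). now apply omega_lt1. }
  assert (Heh : hol disk (fun z => P (omega n gamma eps z))).
  { apply (hol_comp disk disk P (omega n gamma eps)); auto.
    - apply (hol_subset (zdom eps)); [|now apply omega_hol]. intros z Hz'. now apply zdom_disk.
    - intros z Hz'. destruct (zdom_disk eps z He Hz'). now apply omega_lt1. }
  (* The factor [eps] of the denominator is moved into [G], which leaves the plain quotients [G / M]
     and [R1 / H1]. *)
  destruct (hol_factor_pow (S n) (fun z => / eps * (P (omega n gamma (ws z) z) - P (omega n gamma eps z)))%C)
    as [G [HG EG]].
  { apply hol_scal, hol_minus; auto. }
  { destruct (P_omega_close P n gamma HPh Hg) as [K HK].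
    exists (/ Cmod eps * K), (1 / 2). split; [lra|]. intros z Hz' _.
    rewrite Cmod_mult, Cmod_inv, Rmult_assoc by exact Hen.
    assert (0 < Cmod eps) by now apply Cmod_gt_0.
    apply Rmult_le_compat_l; [left; now apply Rinv_0_lt_compat|]. apply HK; auto.
    apply Hw1. unfold disk. lra. }
  assert (ED : forall z, disk z -> (P (omega n gamma (ws z) z) - P (omega n gamma eps z))%C = (eps * (z ^ S n * G z))%C).
  { intros z Hz'. rewrite <- EG by exact Hz'. field. exact Hen. }
  assert (HGM' : forall z, disk z -> z <> RtoC 0 -> Re (G z / M z) < 0).
  { intros z Hz' Hzn. destruct (Hwb z Hz') as [B1 B2].
    assert (HS := support_chain P n gamma eps (ws z) z HP Hg He Hen B1 B2 Hz' Hzn).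
    rewrite ED in HS by exact Hz'.
    replace (G z / M z)%C with (eps * (z ^ S n * G z) / (eps * (z ^ S n * mfun P n gamma eps z)))%C; [exact HS|].
    unfold M. field. split; [now apply HMn|]. split; [now apply Cpow_nz|exact Hen]. }
  assert (HGM : forall z, disk z -> Re (G z / M z) < 0).
  { intros z Hz'. destruct (classic (z = RtoC 0)) as [->|Hzn]; [|auto].
    apply (Re_neg_at_0 (fun z => G z / M z)%C); auto. now apply hol_div. }
  destruct (ray_mean 1 G (n + J) Rlt_0_1 (proj2 (hol_disc1 _) HG)) as [R1 [HR [HRI HRE]]].
  apply hol_disc1 in HR.
  assert (Hfin := starlike_ratio (n + J) M H1 G R1 HM HH HR HMn HE HRE Hs HGM z0 Hz).
  assert (Ed : d = (z0 ^ S (n + J) * H1 z0)%C) by (apply (Q_cderiv_value P n c gamma j J z0 eps); auto).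
  assert (Hg0 : g 0 = P (c 0%nat)) by (rewrite HgE by apply disk_0; now rewrite omega_at_0, Hc).
  assert (Hgd : hol (disc 0 1) g).
  { apply hol_disc1. apply (hol_ext disk (fun z => P (omega n gamma (ws z) z))); auto; [apply copen_disk|].
    intros z Hz'. now rewrite HgE. }
  assert (I1 := weighted_integrable j J 1 g (g 0) z0 Hj Hn Hz Hgd eq_refl).
  assert (Her : Cmod eps < eps_radius z0) by (generalize (eps_radius_gt1 z0 Hz); lra).
  assert (I2 := Q_integrand P n c gamma j J z0 eps HPh Hg Hc Hj Hz Hn Her).
  assert (I3 := cint_minus _ _ _ _ _ _ I1 I2).
  assert (I4 : cint (fun t => wkernel j z0 t * (g (RtoC t * z0)%C - g 0) -
      wkernel j z0 t * (P (omega n gamma eps (RtoC t * z0)%C) - P (c 0%nat)))%C 0 1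
      (eps * z0 ^ S (n + J) * R1 z0)%C).
  { apply cint_ext with (fun t => eps * z0 ^ S (n + J) * (RtoC t ^ (n + J) * G (RtoC t * z0)%C))%C; [lra| |].
    - intros t Ht. assert (Dt : disk (RtoC t * z0)%C) by (apply disc_disk, ray_in_disc; [exact Hz|lra]).
      rewrite Hg0, HgE by exact Dt.
      transitivity (wkernel j z0 t * (P (omega n gamma (ws (RtoC t * z0)%C) (RtoC t * z0)%C) -
         P (omega n gamma eps (RtoC t * z0)%C)))%C; [|ring].
      rewrite ED by exact Dt.
      transitivity (eps * (wkernel j z0 t * ((RtoC t * z0) ^ S n * G (RtoC t * z0)%C)))%C; [|ring].
      rewrite (wkernel_pow j J) by (auto; lra). ring.
    - apply cint_Cmult. now apply HRI. }
  rewrite (cint_unique _ _ _ _ _ I3 I4), Ed.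
  assert (Hh0 : H1 z0 <> RtoC 0).
  { intro E. specialize (Hs z0 Hz). rewrite E in Hs. fold M in Hs.
    replace (RtoC 0 / M z0)%C with (RtoC 0) in Hs by (field; auto). rewrite Re_RtoC in Hs. lra. }
  replace (eps * z0 ^ S (n + J) * R1 z0 / (eps * (z0 ^ S (n + J) * H1 z0)))%C with (R1 z0 / H1 z0)%C; [exact Hfin|].
  field. split; [exact Hh0|]. split; [now apply Cpow_nz|exact Hen].
Qed.

(* The hypothesis on the circle says that [w] lies on the inner side of every tangent line of the
   image of the circle. *)
Lemma nearest_point f df r w : 0 < r -> (forall e, Cmod e <= r -> cderiv f e (df e)) ->
  (forall e, Cmod e <= r -> df e <> RtoC 0) ->
  (forall e, Cmod e = r -> Re ((w - f e) / (e * df e)) <= 0) ->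
  exists e, Cmod e <= r /\ f e = w.
Proof.
  intros Hr Hd Hn Hb.
  assert (Z : forall e, (e - RtoC 0)%C = e) by (intro; ring).
  destruct (min_modulus (fun e => Cmod (e - 0) <= r) (fun e => f e - w)%C) as [e [He Hmin]].
  { apply closed_bounded_disc. }
  { exists (RtoC 0). rewrite Z, Cmod_0. lra. }
  { intros e He. rewrite Z in He. unfold Cminus. apply ccont_plus; [|apply ccont_const].
    eapply cderiv_cont; now apply Hd. }
  rewrite Z in He. exists e. split; [exact He|]. apply NNPP. intro Hne.
  set (X := (w - f e)%C).
  assert (HX : X <> RtoC 0).
  { intro E. apply Hne. replace w with (X + f e)%C by (unfold X; ring). rewrite E. ring. }
  set (l := df e). assert (Hl : l <> RtoC 0) by now apply Hn.
  assert (NoDir : forall v, near0 (fun t => Cmod (e + RtoC t * v) <= r) -> Re (Cconj X * (l * v)) <= 0).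
  { intros v Hv. apply Rnot_lt_le. intro Hpos.
    destruct (near0_and _ _ (cderiv_dir_approach f e l w v (Hd e He) Hpos) Hv) as [t [H1 H2]].
    specialize (Hmin (e + RtoC t * v)%C). rewrite Z in Hmin. specialize (Hmin H2). lra. }
  destruct He as [Hlt|Heq].
  - assert (H : Re (Cconj X * (l * (X / l))) <= 0).
    { apply NoDir. assert (Hlt' : Cmod (e - 0) < r) by now rewrite Z.
      destruct (near0_disc e (X / l) 0 r Hlt') as [T [HT H]]. exists T. split; [exact HT|].
      intros t Ht. specialize (H t Ht). rewrite Z in H. lra. }
    replace (Cconj X * (l * (X / l)))%C with (X * Cconj X)%C in H by (field; exact Hl).
    rewrite Cmod2_conj_mult, Re_RtoC in H. assert (0 < Cmod X) by now apply Cmod_gt_0. nra.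
  (* On the circle no inward direction brings [f] closer to [w]. By duality [q = conj X * l * e] is
     real and nonnegative, so that [X / (e l) = |X|^2 / q] is positive, against [Hb]. *)
  - assert (He0 : e <> RtoC 0) by (apply Cmod_gt_0; lra).
    set (q := (Cconj X * l * e)%C).
    destruct (half_plane_dual q) as [Hi Hq].
    { intros k Hk. assert (H : Re (Cconj X * (l * - (e * k))) <= 0).
      { apply NoDir. destruct (inward_modulus e k He0 Hk) as [T [HT Hin]].
        exists T. split; [exact HT|]. intros t Ht. specialize (Hin t Ht). lra. }
      replace (Cconj X * (l * - (e * k)))%C with (- (q * k))%C in H by (unfold q; ring).
      rewrite Re_opp in H. lra. }
    assert (CX : Cconj X <> RtoC 0) by (apply Cmod_gt_0; rewrite Cmod_conj; now apply Cmod_gt_0).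
    assert (Hq0 : q <> RtoC 0) by (unfold q; repeat apply Cmult_neq_0; assumption).
    assert (Eq : q = RtoC (Re q)) by (apply C_ext; [reflexivity|rewrite Im_RtoC; exact Hi]).
    assert (Hqp : 0 < Re q).
    { destruct Hq as [|E]; [assumption|]. exfalso. apply Hq0. rewrite Eq, <- E. reflexivity. }
    specialize (Hb e Heq). fold X l in Hb.
    replace (X / (e * l))%C with (RtoC (Cmod X ^ 2 / Re q)) in Hb.
    2:{ unfold Rdiv. rewrite RtoC_mult, RtoC_inv, <- Eq, <- Cmod2_conj_mult by lra. unfold q. field. auto. }
    rewrite Re_RtoC in Hb. assert (0 < Cmod X ^ 2 / Re q); [|lra].
    apply Rdiv_lt_0_compat; [apply pow_lt; now apply Cmod_gt_0|exact Hqp].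
Qed.

(** * The Schur algorithm *)

(** The sum in the Schur recursion: the Cauchy product of [b] and [a] at index [p] without its term
    [b p * a 0]. *)
Definition conv1 (b a : nat -> C) (p : nat) : C := sum_n_m (fun l => b (p - l)%nat * a l)%C 1 p.

Lemma conv1_ext b a b' a' p : (forall l, (1 <= l <= p)%nat -> b (p - l)%nat = b' (p - l)%nat) ->
  (forall l, (1 <= l <= p)%nat -> a l = a' l) -> conv1 b a p = conv1 b' a' p.
Proof. intros H1 H2. apply sum_n_m_ext_loc. intros k Hk. now rewrite H1, H2. Qed.

(** The product is expanded only off the origin, because the shifted products to which the induction
    is applied arise there as quotients by [z]; continuity supplies the value at [0]. *)
Lemma cps_mult_coef0 a b e f h : (forall z, disk z -> cps a z (f z)) ->
  (forall z, disk z -> cps b z (h z)) ->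
  (forall z, disk z -> z <> RtoC 0 -> cps e z (f z * h z)%C) ->
  e 0%nat = (b 0%nat * a 0%nat)%C.
Proof.
  intros Hf Hh He.
  set (E := fun z => if excluded_middle_informative (z = RtoC 0) then e 0%nat else (f z * h z)%C).
  assert (HE : forall z, Cmod z < 1 -> cps e z (E z)).
  { intros z Hz. unfold E. destruct (excluded_middle_informative (z = RtoC 0)) as [->|n]; [apply cps_0|].
    now apply He. }
  assert (X : E 0 = (f 0 * h 0)%C).
  { apply (ccont_punctured_eq E (fun z => f z * h z)%C).
    - apply (hol_ccont disk); [apply hol_disc1; now apply hol_cps with e|apply disk_0].
    - apply ccont_mult; apply (hol_ccont disk); try apply disk_0; apply hol_disc1.
      + now apply hol_cps with a.
      + now apply hol_cps with b.
    - intros z _ Hz. unfold E. destruct (excluded_middle_informative (z = RtoC 0)); [contradiction|reflexivity]. }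
  unfold E in X. destruct (excluded_middle_informative (RtoC 0 = RtoC 0)); [|congruence].
  rewrite X, (cps_at0 a (f 0)), (cps_at0 b (h 0)) by (auto using disk_0). ring.
Qed.

(* By induction on [k], through [S (f h) = a_0 S h + (S f) h] for the backward shift
   [S f = (f - f 0) / z]. *)
Lemma cps_mult_coef b h : (forall z, disk z -> cps b z (h z)) -> forall k a f e,
  (forall z, disk z -> cps a z (f z)) ->
  (forall z, disk z -> z <> RtoC 0 -> cps e z (f z * h z)%C) ->
  e k = (b k * a 0%nat + conv1 b a k)%C.
Proof.
  intros Hh. induction k as [|k IH]; intros a f e Hf He.
  - replace (conv1 b a 0) with (RtoC 0).
    2:{ unfold conv1. rewrite sum_n_m_zero by lia. reflexivity. }
    rewrite (cps_mult_coef0 a b e f h Hf Hh He). ring.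
  - assert (E0 := cps_mult_coef0 a b e f h Hf Hh He).
    set (Sf := fun z => if excluded_middle_informative (z = RtoC 0) then a 1%nat else ((f z - a 0%nat) / z)%C).
    assert (HS := IH (fun k => a (S k)) Sf (fun k => e (S k) - a 0%nat * b (S k))%C).
    assert (R : (e (S k) - a 0%nat * b (S k))%C = (b k * a 1%nat + conv1 b (fun k => a (S k)) k)%C).
    { apply HS.
      - intros z Hz. unfold Sf. destruct (excluded_middle_informative (z = RtoC 0)) as [->|n].
        + apply (cps_0 (fun k => a (S k))).
        + apply cps_shift; auto.
      - intros z Hz Hn. unfold Sf. destruct (excluded_middle_informative (z = RtoC 0)) as [|_]; [contradiction|].
        replace ((f z - a 0%nat) / z * h z)%C with
          ((f z * h z - e 0%nat) / z - a 0%nat * ((h z - b 0%nat) / z))%C by (rewrite E0; field; exact Hn).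
        apply cps_minus; [apply cps_shift; auto|].
        apply (cps_scal (a 0%nat) (fun k => b (S k))). apply cps_shift; auto. }
    assert (R2 : conv1 b a (S k) = (b k * a 1%nat + conv1 b (fun k => a (S k)) k)%C).
    { unfold conv1. rewrite sum_Sn_m by lia. change plus with Cplus.
      replace (S k - 1)%nat with k by lia. f_equal. rewrite <- sum_n_m_S. reflexivity. }
    rewrite R2, <- R. ring.
Qed.

Definition ccons (x : C) (b : nat -> C) (k : nat) : C := match k with O => x | S k => b k end.

Lemma cps_cons x b z l : cps b z l -> cps (ccons x b) z (x + z * l)%C.
Proof.
  intro H. apply cps_eps. intros e He. generalize (Cmod_ge_0 z); intro Z0.
  destruct (proj1 (cps_eps _ _ _) H (e / (Cmod z + 1))) as [N HN]; [apply Rdiv_lt_0_compat; lra|].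
  exists (S N). intros [|n] Hn; [lia|]. specialize (HN n ltac:(lia)).
  assert (E : psum (ccons x b) z (S n) = (x + z * psum b z n)%C).
  { clear. induction n as [|n IH]; [simpl; ring|].
    change (psum (ccons x b) z (S (S n))) with (psum (ccons x b) z (S n) + b (S n) * z ^ S (S n))%C.
    rewrite IH. simpl. ring. }
  rewrite E. replace (x + z * psum b z n - (x + z * l))%C with (z * (psum b z n - l))%C by ring.
  rewrite Cmod_mult. generalize (Cmod_ge_0 (psum b z n - l)); intro X0.
  apply Rle_lt_trans with ((Cmod z + 1) * Cmod (psum b z n - l)); [nra|].
  replace e with ((Cmod z + 1) * (e / (Cmod z + 1))) by (field; lra). apply Rmult_lt_compat_l; lra.
Qed.

(** One step of the Schur recursion cleared of its denominator. Its separate initial case is the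
    instance [p = 0], where [conv1] is an empty sum. *)
Definition schur_rel (g0 : C) (a b : nat -> C) (p : nat) : Prop :=
  (b p * RtoC (1 - Cmod g0 ^ 2))%C = (a (S p) + Cconj g0 * conv1 b a p)%C.

Lemma schur_rel_sigma a b f h : (forall z, disk z -> cps a z (f z)) ->
  (forall z, disk z -> cps b z (h z)) -> Cmod (a 0%nat) < 1 ->
  (forall z, disk z -> Cmod (h z) <= 1) ->
  (forall z, disk z -> f z = sigma (a 0%nat) (z * h z)) -> forall p, schur_rel (a 0%nat) a b p.
Proof.
  intros Hf Hh Ha Bh E p.
  assert (HFH : hol (disc 0 1) (fun z => f z * h z)%C).
  { apply hol_mult; [now apply hol_cps with a|now apply hol_cps with b]. }
  destruct (hol_taylor 1 _ Rlt_0_1 HFH) as [e He].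
  assert (Ee := cps_mult_coef b h Hh p a f e Hf (fun z Hz _ => He z Hz)).
  assert (Ea : a (S p) = (b p - Cconj (a 0%nat) * e p)%C).
  { apply (cps_coef_unique a (ccons (a 0%nat) (fun k => b k - Cconj (a 0%nat) * e k)%C) f 1 Rlt_0_1) with (k := S p); auto.
    intros z Hz. replace (f z) with (a 0%nat + z * (h z - Cconj (a 0%nat) * (f z * h z)))%C.
    - apply cps_cons. apply cps_minus; [now apply Hh|]. apply cps_scal. now apply He.
    - assert (Hd : (1 + Cconj (a 0%nat) * (z * h z))%C <> RtoC 0).
      { apply sigma_den; [exact Ha|]. left. apply Cmod_mult_lt1; [exact Hz|now apply Bh]. }
      rewrite (E z Hz). unfold sigma. field. exact Hd. }
  unfold schur_rel. rewrite Ea, Ee, RtoC_minus, <- Cmod2_conj_mult. ring.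
Qed.

(** Solved for [b p], the relation contains only values of [b] at smaller indices, because the sum
    starts at [l = 1]. *)
Lemma schur_rel_det_b g0 n a c b c1 : Cmod g0 < 1 -> (forall k, (k <= S n)%nat -> a k = c k) ->
  (forall p, (p <= n)%nat -> schur_rel g0 a b p) -> (forall p, (p <= n)%nat -> schur_rel g0 c c1 p) ->
  forall p, (p <= n)%nat -> b p = c1 p.
Proof.
  intros Hg Hac Hb Hc p. induction p as [p IH] using lt_wf_ind. intro Hp.
  assert (Hn : RtoC (1 - Cmod g0 ^ 2) <> RtoC 0).
  { intro E. apply RtoC_inj in E. generalize (Cmod_ge_0 g0). nra. }
  apply (Cmult_cancel_l _ _ _ Hn). rewrite !(Cmult_comm (RtoC _)).
  rewrite (Hb p Hp), (Hc p Hp), Hac by lia. f_equal. f_equal. apply conv1_ext.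
  - intros l Hl. apply IH; lia.
  - intros l Hl. apply Hac. lia.
Qed.

(** The reverse reading: solved for [a (S p)], the relation contains only values of [a] up to
    [p]. *)
Lemma schur_rel_det_a g0 n a c b c1 : a 0%nat = c 0%nat -> (forall p, (p <= n)%nat -> b p = c1 p) ->
  (forall p, (p <= n)%nat -> schur_rel g0 a b p) -> (forall p, (p <= n)%nat -> schur_rel g0 c c1 p) ->
  forall k, (k <= S n)%nat -> a k = c k.
Proof.
  intros H0 Hbc Hb Hc k. induction k as [k IH] using lt_wf_ind. intro Hk.
  destruct k as [|p]; [exact H0|].
  assert (E1 := Hb p ltac:(lia)). assert (E2 := Hc p ltac:(lia)). unfold schur_rel in *.
  rewrite Hbc in E1 by lia. rewrite E1 in E2.
  assert (Ec : conv1 b a p = conv1 c1 c p).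
  { apply conv1_ext; intros l Hl; [apply Hbc|apply IH]; lia. }
  rewrite Ec in E2. replace (a (S p)) with ((a (S p) + Cconj g0 * conv1 c1 c p) - Cconj g0 * conv1 c1 c p)%C by ring.
  rewrite E2. ring.
Qed.

Lemma schur_parameter_head n c gamma : schur_parameter n c gamma -> gamma 0%nat = c 0%nat.
Proof. intros [d [H1 [H2 _]]]. rewrite H2, H1 by lia. reflexivity. Qed.

Lemma schur_parameter_tail n c gamma : schur_parameter (S n) c gamma -> Cmod (gamma 0%nat) < 1 ->
  exists c1, schur_parameter n c1 (fun i => gamma (S i)) /\
    forall p, (p <= n)%nat -> schur_rel (gamma 0%nat) c c1 p.
Proof.
  intros [d [H1 [H2 [H3 H4]]]] Hg.
  assert (Hn : RtoC (1 - Cmod (gamma 0%nat) ^ 2) <> RtoC 0).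
  { intro E. apply RtoC_inj in E. generalize (Cmod_ge_0 (gamma 0%nat)). nra. }
  exists (d 1%nat). split.
  - exists (fun i p => d (S i) p). split; [auto|]. split; [intros i Hi; apply H2; lia|].
    split; [intros i Hi; apply (H3 (S i)); lia|]. intros i p Hi Hp. apply (H4 (S i)); lia.
  - intros p Hp. unfold schur_rel. destruct p as [|p].
    + replace (conv1 (d 1%nat) c 0) with (RtoC 0).
      2:{ unfold conv1. rewrite sum_n_m_zero by lia. reflexivity. }
      rewrite (H3 0%nat), H1 by lia. field. exact Hn.
    + rewrite (H4 0%nat (S p)) by lia. rewrite H1 by lia.
      replace (conv1 (d 1%nat) c (S p)) with (conv1 (d 1%nat) (d 0%nat) (S p)).
      2:{ apply conv1_ext; auto. intros l Hl. apply H1. lia. }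
      unfold conv1. field. exact Hn.
Qed.

(** Schwarz's lemma for [sigma (- a 0)] composed with [f]. The last clause keeps the supremum below
    [1]: the automorphism maps [|u| <= rho] into a smaller disc, and division by [z] preserves the
    bound. *)
Lemma schur_step a f rho : (forall z, disk z -> cps a z (f z)) ->
  (forall z, disk z -> Cmod (f z) <= rho) -> rho <= 1 -> Cmod (a 0%nat) < 1 ->
  exists f1 b, (forall z, disk z -> cps b z (f1 z)) /\ (forall z, disk z -> Cmod (f1 z) <= 1) /\
    (forall z, disk z -> f z = sigma (a 0%nat) (z * f1 z)) /\
    (rho < 1 -> exists rho1, rho1 < 1 /\ forall z, disk z -> Cmod (f1 z) <= rho1).
Proof.
  intros Hf HB Hr Ha.
  assert (Hfh : hol disk f) by (apply hol_disc1; now apply hol_cps with a).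
  assert (HB1 : forall z, disk z -> Cmod (f z) <= 1) by (intros z Hz; specialize (HB z Hz); lra).
  assert (Hna := Cmod_opp_lt _ Ha).
  set (g := fun z => sigma (- a 0%nat) (f z)).
  assert (Hg : hol disk g) by now apply hol_sigma_comp.
  assert (F0 : f 0 = a 0%nat) by (apply cps_at0; auto using disk_0).
  assert (G0 : g 0 = RtoC 0).
  { unfold g. rewrite F0. unfold sigma. replace (a 0%nat + - a 0%nat)%C with (RtoC 0) by ring. unfold Cdiv. ring. }
  destruct (schwarz g Hg G0) as [f1 [H1 [E1 B1]]].
  { intros z Hz. apply sigma_le1; auto. }
  destruct (hol_taylor 1 f1 Rlt_0_1 (proj2 (hol_disc1 _) H1)) as [b Hb].
  exists f1, b. split; [exact Hb|]. split; [exact B1|]. split.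
  - intros z Hz. rewrite <- E1 by exact Hz. unfold g. rewrite sigma_cancel'; auto.
  - intro Hlt. destruct (sigma_unif (- a 0%nat) rho Hna) as [rho1 [Hr1 Hu]].
    { split; [|exact Hlt]. eapply Rle_trans; [apply Cmod_ge_0|apply (HB 0 disk_0)]. }
    exists rho1. split; [lra|]. intros z Hz. replace rho1 with (rho1 / 1) by field.
    apply (factor_bound 1 g f1 rho1 Rlt_0_1 (proj2 (hol_disc1 _) H1)); auto.
    intros w Hw. apply Hu. now apply HB.
Qed.

(** A supremum below [1] survives every Schur step, and each parameter is the value at [0] of the
    function reached at that step. *)
Lemma schur_small n : forall c gamma a f rho, schur_parameter n c gamma ->
  (forall z, disk z -> cps a z (f z)) -> (forall k, (k <= n)%nat -> a k = c k) ->
  (forall z, disk z -> Cmod (f z) <= rho) -> rho < 1 -> small n gamma.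
Proof.
  induction n as [|n IH]; intros c gamma a f rho Hs Hf Hac HB Hr;
    assert (E0 : gamma 0%nat = a 0%nat) by (rewrite (schur_parameter_head _ _ _ Hs), Hac by lia; reflexivity);
    assert (Ha : Cmod (a 0%nat) < 1)
      by (rewrite <- (cps_at0 a (f 0)) by (auto using disk_0); specialize (HB 0 disk_0); lra).
  - intros i Hi. replace i with 0%nat by lia. now rewrite E0.
  - assert (Hg0 : Cmod (gamma 0%nat) < 1) by now rewrite E0.
    destruct (schur_parameter_tail _ _ _ Hs Hg0) as [c1 [Hs1 Hrel]].
    destruct (schur_step a f rho Hf HB (Rlt_le _ _ Hr) Ha) as [f1 [b [Hb [B1 [E1 Hst]]]]].
    destruct (Hst Hr) as [rho1 [Hr1 Hb1]].
    assert (Hsm : small n (fun i => gamma (S i))).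
    { apply (IH c1 _ b f1 rho1); auto. intros p Hp.
      apply (schur_rel_det_b (gamma 0%nat) n a c b c1); auto. intros q _. rewrite E0.
      now apply (schur_rel_sigma a b f f1). }
    intros [|i] Hi; [exact Hg0|]. apply Hsm. lia.
Qed.

Lemma schur_represent n : forall c gamma a f, schur_parameter n c gamma -> small n gamma ->
  (forall z, disk z -> cps a z (f z)) -> (forall k, (k <= n)%nat -> a k = c k) ->
  (forall z, disk z -> Cmod (f z) <= 1) ->
  exists ws, hol disk ws /\ (forall z, disk z -> Cmod (ws z) <= 1) /\
    forall z, disk z -> f z = omega n gamma (ws z) z.
Proof.
  induction n as [|n IH]; intros c gamma a f Hs Hg Hf Hac HB;
    assert (E0 : gamma 0%nat = a 0%nat) by (rewrite (schur_parameter_head _ _ _ Hs), Hac by lia; reflexivity);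
    assert (Hg0 := small_0 _ _ Hg); assert (Ha : Cmod (a 0%nat) < 1) by (now rewrite <- E0);
    destruct (schur_step a f 1 Hf HB (Rle_refl 1) Ha) as [f1 [b [Hb [B1 [E1 _]]]]].
  - exists f1. split; [apply hol_disc1; now apply hol_cps with b|]. split; [exact B1|].
    intros z Hz. simpl. rewrite E0, Cmult_comm. auto.
  - destruct (schur_parameter_tail _ _ _ Hs Hg0) as [c1 [Hs1 Hrel]].
    destruct (IH c1 (fun i => gamma (S i)) b f1 Hs1 (small_shift _ _ Hg) Hb) as [ws [W1 [W2 W3]]]; auto.
    { intros p Hp. apply (schur_rel_det_b (gamma 0%nat) n a c b c1); auto. intros q _. rewrite E0.
      now apply (schur_rel_sigma a b f f1). }
    exists ws. split; [exact W1|]. split; [exact W2|]. intros z Hz. simpl. rewrite <- W3 by exact Hz.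
    rewrite E0. auto.
Qed.

(** The converse of the Schur algorithm: the coefficients of the inner chain are known by induction,
    and the relation, read backwards, determines those of the whole chain. *)
Lemma omega_taylor n : forall c gamma eps, schur_parameter n c gamma -> small n gamma -> Cmod eps <= 1 ->
  taylor_on_disk n c (omega n gamma eps).
Proof.
  induction n as [|n IH]; intros c gamma eps Hs Hg He;
    assert (Hh : hol (disc 0 1) (omega _ gamma eps))
      by (apply hol_disc1, (hol_subset (zdom eps)); [intros z Hz; now apply zdom_disk|exact (omega_hol _ _ _ Hg)]);
    destruct (hol_taylor 1 _ Rlt_0_1 Hh) as [a Ha];
    assert (A0 : a 0%nat = gamma 0%nat)
      by (rewrite <- (cps_at0 a _ (Ha 0 disk_0)); apply omega_at_0);
    exists a; (split; [|exact Ha]).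
  - intros k Hk. replace k with 0%nat by lia. rewrite A0. exact (schur_parameter_head _ _ _ Hs).
  - assert (Hg0 := small_0 _ _ Hg). assert (Hg' := small_shift _ _ Hg).
    destruct (schur_parameter_tail _ _ _ Hs Hg0) as [c1 [Hs1 Hrel]].
    destruct (IH c1 _ eps Hs1 Hg' He) as [b [Hbc Hb]].
    apply (schur_rel_det_a (gamma 0%nat) n a c b c1); auto.
    + rewrite A0. exact (schur_parameter_head _ _ _ Hs).
    + intros p _. rewrite <- A0.
      apply (schur_rel_sigma a b (omega (S n) gamma eps) (omega n (fun i => gamma (S i)) eps)); auto.
      * now rewrite A0.
      * intros z Hz. left. destruct (zdom_disk eps z He Hz). now apply omega_lt1.
      * intros z Hz. rewrite A0. reflexivity.
Qed.

(** Being interior, [c] may be stretched to [(1 + eta) c] inside the coefficient body; dividing the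
    resulting function by [1 + eta] gives a supremum of at most [1 / (1 + eta)]. *)
Lemma Int_coeff_body_strict n c : Int_coeff_body n c -> exists a f rho,
  (forall z, disk z -> cps a z (f z)) /\ (forall k, (k <= n)%nat -> a k = c k) /\
  (forall z, disk z -> Cmod (f z) <= rho) /\ rho < 1.
Proof.
  intros [delta [Hd H]].
  assert (HB : exists B, 0 <= B /\ forall k, (k <= n)%nat -> Cmod (c k) <= B).
  { clear. induction n as [|n [B [B0 HB]]].
    - exists (Cmod (c 0%nat)). split; [apply Cmod_ge_0|]. intros k Hk. replace k with 0%nat by lia. lra.
    - exists (B + Cmod (c (S n))). generalize (Cmod_ge_0 (c (S n))); intro. split; [lra|]. intros k Hk.
      destruct (Nat.eq_dec k (S n)) as [->|]; [lra|]. specialize (HB k ltac:(lia)). lra. }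
  (* [B] bounds the coefficients, so the stretching moves each of them by at most
     [eta B < delta]. *)
  destruct HB as [B [B0 HB]]. set (eta := delta / (2 * (B + 1))).
  assert (He : 0 < eta) by (apply Rdiv_lt_0_compat; lra).
  destruct (H (fun k => RtoC (1 + eta) * c k)%C) as [w [[Hw Bw] [a [Hac Ha]]]].
  { intros k Hk. replace (RtoC (1 + eta) * c k - c k)%C with (RtoC eta * c k)%C by (rewrite RtoC_plus; ring).
    rewrite Cmod_mult, Cmod_RtoC_pos by lra. specialize (HB k Hk).
    apply Rle_lt_trans with (eta * (B + 1)); [apply Rmult_le_compat_l; lra|].
    unfold eta. replace (delta / (2 * (B + 1)) * (B + 1)) with (delta / 2) by (field; lra). lra. }
  assert (Hn : RtoC (1 + eta) <> RtoC 0) by (intro E; apply RtoC_inj in E; lra).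
  exists (fun k => / RtoC (1 + eta) * a k)%C, (fun z => / RtoC (1 + eta) * w z)%C, (/ (1 + eta)).
  split; [intros z Hz; apply cps_scal; exact (Ha z Hz)|]. split; [intros k Hk; rewrite Hac by exact Hk; field; exact Hn|].
  split.
  - intros z Hz. rewrite Cmod_mult, Cmod_inv, Cmod_RtoC_pos by (auto; lra). specialize (Bw z Hz).
    generalize (Rinv_0_lt_compat (1 + eta) ltac:(lra)) (Cmod_ge_0 (w z)). nra.
  - rewrite <- Rinv_1. apply Rinv_lt_contravar; lra.
Qed.

Lemma weighted_int_ext j g h z0 : disk z0 -> (forall z, disk z -> g z = h z) ->
  weighted_int j g (g 0) z0 = weighted_int j h (h 0) z0.
Proof.
  intros Hz E. unfold weighted_int, int_from_0.
  refine (RInt_ext (V := C_R_CompleteNormedModule) _ _ 0 1 _). intros t Ht.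
  rewrite Rmin_left, Rmax_right in Ht by lra.
  rewrite (E 0 disk_0), (E (RtoC t * z0)%C); [reflexivity|].
  apply disc_disk, ray_in_disc; [exact Hz|lra].
Qed.

Theorem theorem2p2 (Omega : C -> Prop) (P : C -> C) (n : nat) (j : Z)
    (c gamma : nat -> C)
    (hOmega : convex_domain Omega)
    (hOmega_ne : exists w : C, ~ Omega w)
    (hP : conformal_map P Omega)
    (hj : (-1 <= j)%Z)
    (hc : Int_coeff_body n c)
    (hgamma : schur_parameter n c gamma)
    (z0 : C) (hz0 : disk z0) (hz0_ne : z0 <> RtoC 0) :
  convex_univalent (fun eps : C => Q P n c gamma j z0 eps) /\
  (forall w : C,
     V_region Omega P n c j z0 w <->
     image (fun eps : C => Q P n c gamma j z0 eps) cdisk w) /\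
  (forall (g : C -> C) (eps : C),
     F_class Omega P n c g -> Cmod eps = 1 ->
     (weighted_int j g (g (RtoC 0)) z0 = Q P n c gamma j z0 eps <->
      forall z : C, disk z -> g z = P (omega n gamma eps z))).
Proof.
  (* Here [j >= -1] is used: [J = j + 1] is a natural number. *)
  assert (Hj : j = (Z.of_nat (Z.to_nat (j + 1)) - 1)%Z) by lia.
  set (J := Z.to_nat (j + 1)) in *. clearbody J.
  destruct hP as [HPa [HPi HPo]].
  assert (HPh : hol disk P) by (apply analytic_on_hol; [apply copen_disk|exact HPa]).
  assert (HU : univ P) by now split.
  assert (HP : cv P).
  { split; [exact HU|]. intros x y t Hx Hy Ht. apply HPo. apply (proj2 (proj2 hOmega)); auto; now apply HPo. }
  assert (Hsm : small n gamma).
  { destruct (Int_coeff_body_strict n c hc) as [a [f [rho [H1 [H2 [H3 H4]]]]]].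
    now apply (schur_small n c gamma a f rho). }
  assert (Hc0 : c 0%nat = gamma 0%nat) by (symmetry; exact (schur_parameter_head _ _ _ hgamma)).
  set (q := fun eps => Q P n c gamma j z0 eps).
  destruct (Q_cderiv P n c gamma j J z0 HPh Hsm Hc0 Hj hz0 hz0_ne) as [dQ [HdQ _]].
  assert (HR := eps_radius_gt1 z0 hz0).
  assert (Hqd : forall e, Cmod e <= 1 -> cderiv q e (dQ e)) by (intros e He; apply HdQ; lra).
  assert (Hqn : forall e, Cmod e <= 1 -> dQ e <> RtoC 0).
  { intros e He. apply (Q_cderiv_neq0 P n c gamma j J z0 e); auto. }
  assert (Hqh : hol (disc 0 (eps_radius z0)) q).
  { exists dQ. intros e He. rewrite disc0 in He. now apply HdQ. }
  assert (VI : forall eps ws g, Cmod eps <= 1 -> eps <> RtoC 0 -> hol disk ws ->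
     (forall z, disk z -> Cmod (ws z) <= Cmod eps /\ ws z <> eps) ->
     (forall z, disk z -> g z = P (omega n gamma (ws z) z)) ->
     Re ((weighted_int j g (g 0) z0 - q eps) / (eps * dQ eps)) < 0).
  { intros eps ws g He Hen Hws Hwb Hg. apply (variation_ineq P n c gamma j J z0 eps ws g); auto. }
  assert (QW : forall e, q e = weighted_int j (fun z => P (omega n gamma e z)) (P (omega n gamma e 0)) z0).
  { intro e. unfold q, Q. now rewrite omega_at_0, Hc0. }
  assert (QI : forall e e', Cmod e <= 1 -> e <> RtoC 0 -> Cmod e' <= Cmod e -> e' <> e ->
     Re ((q e' - q e) / (e * dQ e)) < 0).
  { intros e e' He Hen Hle Hne. rewrite (QW e').
    apply (VI e (fun _ => e') (fun z => P (omega n gamma e' z))); auto. apply hol_const. }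
  assert (RI : forall x e, Cmod e <= 1 -> e <> RtoC 0 -> Re (x / (e * dQ e)) < 0 -> x <> RtoC 0).
  { intros x e He Hen Hx E. rewrite E in Hx.
    replace (RtoC 0 / (e * dQ e))%C with (RtoC 0) in Hx by (field; auto). rewrite Re_RtoC in Hx. lra. }
  assert (Neq : forall e e', Cmod e <= 1 -> Cmod e' <= Cmod e -> e' <> e -> q e' <> q e).
  { intros e e' He Hle Hne E.
    assert (Hen : e <> RtoC 0).
    { intro E0. apply Hne. rewrite E0 in *. apply Cmod_eq_0. rewrite Cmod_0 in Hle. generalize (Cmod_ge_0 e'). lra. }
    apply (RI (q e' - q e)%C e); auto. rewrite E. ring. }
  (* The support inequality is based at the point of larger modulus. *)
  assert (Qinj : injective_on cdisk q).
  { intros x y Hx Hy E. apply NNPP. intro Hne. destruct (Rle_lt_dec (Cmod x) (Cmod y)) as [Hle|Hlt].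
    - now apply (Neq y x).
    - apply (Neq x y); auto. lra. }
  (* Radii below [1] serve the convexity of the image of the open disk, [r = 1] the inclusion of the
     region of variability. *)
  assert (NP : forall r w, 0 < r <= 1 -> (forall e, Cmod e = r -> Re ((w - q e) / (e * dQ e)) <= 0) ->
     exists e, Cmod e <= r /\ q e = w).
  { intros r w Hr H. apply (nearest_point q dQ); try lra; auto; intros e He; [apply Hqd|apply Hqn]; lra. }
  assert (Rep : forall g, F_class Omega P n c g -> exists ws, hol disk ws /\
     (forall z, disk z -> Cmod (ws z) <= 1) /\ forall z, disk z -> g z = P (omega n gamma (ws z) z)).
  { intros g [Hga [Hgo [a [Hac Ha]]]].
    assert (Him : forall z, disk z -> image P disk (g z)) by (intros z Hz; now apply HPo, Hgo).
    destruct (schur_represent n c gamma a (fun z => disk_inv P (g z)) hgamma Hsm Ha Hac) as [ws [W1 [W2 W3]]].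
    { intros z Hz. left. now apply disk_inv_spec, Him. }
    exists ws. split; [exact W1|]. split; [exact W2|]. intros z Hz. rewrite <- W3 by exact Hz.
    symmetry. now apply disk_inv_spec, Him. }
  (* If [|ws 0| < 1], then [|ws| < 1] everywhere by Schwarz-Pick and the value [eps] is never taken;
     if [|ws 0| = 1], then [ws] is constant, equal to [eps] or different from it throughout. *)
  assert (Strict : forall g eps ws, hol disk ws -> (forall z, disk z -> Cmod (ws z) <= 1) ->
     (forall z, disk z -> g z = P (omega n gamma (ws z) z)) -> Cmod eps = 1 ->
     (forall z, disk z -> ws z = eps) \/ Re ((weighted_int j g (g 0) z0 - q eps) / (eps * dQ eps)) < 0).
  { intros g eps ws W1 W2 W3 He. assert (Hen : eps <> RtoC 0) by (apply Cmod_gt_0; lra).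
    destruct (W2 0 disk_0) as [Hlt|Heq].
    - right. apply (VI eps ws g); auto; [lra|]. intros z Hz.
      destruct (schwarz_pick ws z W1 W2 Hlt Hz) as [_ S]. split; [lra|]. intro E. rewrite E in S. lra.
    - assert (Hcst := fun z => unimodular_const ws z W1 W2 Heq).
      destruct (classic (ws 0 = eps)) as [E|E].
      + left. intros z Hz. rewrite Hcst; auto.
      + right. apply (VI eps ws g); auto; [lra|]. intros z Hz. rewrite Hcst by exact Hz. split; [lra|exact E]. }
  split; [split; [|split]|split].
  - intros e He. apply analytic_at_hol. exists (eps_radius z0 - 1). split; [lra|].
    apply (hol_subset (disc 0 (eps_radius z0))); [|exact Hqh]. intros w Hw. apply disc0.
    unfold disc, cdisk in *. generalize (Cmod_tri_sub w e). lra.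
  - exact Qinj.
  - split; [|split].
    + assert (Hop : copen (image q disk)).
      { intros w [e [He E]]. destruct (open_mapping disk q e ((1 - Cmod e) / 2)) as [m [Hm H]].
        - apply copen_disk.
        - apply (hol_subset (disc 0 (eps_radius z0))); [|exact Hqh]. intros z Hz. apply disc0. unfold disk in Hz. lra.
        - intros x y Hx Hy Exy. apply Qinj; auto; unfold disk, cdisk in *; lra.
        - intros z Hz. unfold disk in Hz. rewrite (Cder_eq q z (dQ z)) by (apply Hqd; lra). apply Hqn; lra.
        - unfold disk in He. lra.
        - intros z Hz. unfold disk in *. generalize (Cmod_tri_sub z e). lra.
        - exists m. split; [exact Hm|]. intros v Hv. rewrite <- E in Hv. destruct (H v Hv) as [x [Hx Ex]].
          exists x. split; [|exact Ex]. unfold disk in *. generalize (Cmod_tri_sub x e). lra. }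
      intros w Hw. destruct (Hop w Hw) as [d [Hd H]]. assert (Hd2 : 0 < d / 2) by lra.
      exists (mkposreal _ Hd2). intros v [Hv1 Hv2]. apply H. eapply Rle_lt_trans; [apply Cmod_le_Re_Im|].
      rewrite Re_minus, Im_minus. change (Rabs (fst v - fst w) < d / 2) in Hv1.
      change (Rabs (snd v - snd w) < d / 2) in Hv2. unfold Re, Im. lra.
    + exists (q 0), 0. split; [apply disk_0|reflexivity].
    + intros x y t [e1 [He1 E1]] [e2 [He2 E2]] Ht. rewrite <- E1, <- E2. unfold disk in *.
      set (r := Rmax (Cmod e1) (Cmod e2)).
      assert (R1 : Cmod e1 <= r) by apply Rmax_l. assert (R2 : Cmod e2 <= r) by apply Rmax_r.
      assert (R3 : r < 1) by now apply Rmax_lub_lt.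
      generalize (Cmod_ge_0 e1) (Cmod_ge_0 e2); intros P1 P2.
      destruct (Rle_lt_dec r 0) as [Hr|Hr].
      * assert (X1 : e1 = RtoC 0) by (apply Cmod_eq_0; lra). assert (X2 : e2 = RtoC 0) by (apply Cmod_eq_0; lra).
        exists 0. split; [apply disk_0|]. rewrite X1, X2, RtoC_minus. ring.
      * destruct (NP r (RtoC (1 - t) * q e1 + RtoC t * q e2)%C) as [e [He Ee]]; [lra| |].
        { intros e He. assert (Hen : e <> RtoC 0) by (apply Cmod_gt_0; lra).
          assert (Le : forall e', Cmod e' <= r -> Re ((q e' - q e) / (e * dQ e)) <= 0).
          { intros e' He'. destruct (classic (e' = e)) as [->|Hne].
            - replace ((q e - q e) / (e * dQ e))%C with (RtoC 0); [rewrite Re_RtoC; lra|].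
              field. split; [apply Hqn; lra|exact Hen].
            - left. apply QI; auto; lra. }
          (* The tangent condition is affine in the tested point and so passes to convex
             combinations. *)
          replace ((RtoC (1 - t) * q e1 + RtoC t * q e2 - q e) / (e * dQ e))%C with
            (RtoC (1 - t) * ((q e1 - q e) / (e * dQ e)) + RtoC t * ((q e2 - q e) / (e * dQ e)))%C.
          2:{ rewrite RtoC_minus. field. split; [apply Hqn; lra|exact Hen]. }
          rewrite Re_plus, !Re_scal. generalize (Le e1 R1) (Le e2 R2). nra. }
        exists e. split; [unfold disk; lra|exact Ee].
  - intro w. split.
    + intros [g [Hg Ew]]. destruct (Rep g Hg) as [ws [W1 [W2 W3]]].
      destruct (NP 1 w) as [e [He Ee]]; [lra| |exists e; auto].
      (* In the case of equality [w] is [q e] itself, and the quotient vanishes instead of being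
         negative. *)
      intros e He. destruct (Strict g e ws W1 W2 W3 He) as [Hc|Hlt].
      * assert (Hen : e <> RtoC 0) by (apply Cmod_gt_0; lra).
        replace w with (q e).
        { replace ((q e - q e) / (e * dQ e))%C with (RtoC 0); [rewrite Re_RtoC; lra|].
          field. split; [apply Hqn; lra|exact Hen]. }
        rewrite Ew, QW. symmetry. apply (weighted_int_ext j g (fun z => P (omega n gamma e z))); auto.
        intros z Hz. rewrite W3, Hc by exact Hz. reflexivity.
      * rewrite Ew. lra.
    + intros [e [He Ew]]. unfold cdisk in He.
      assert (Hod : forall z, disk z -> disk (omega n gamma e z)).
      { intros z Hz. destruct (zdom_disk e z He Hz). now apply omega_lt1. }
      exists (fun z => P (omega n gamma e z)). split.
      * split; [|split].
        -- apply analytic_on_hol; [apply copen_disk|].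
           apply (hol_comp disk disk P (omega n gamma e)); auto.
           apply (hol_subset (zdom e)); [|now apply omega_hol]. intros z Hz. now apply zdom_disk.
        -- intros z Hz. apply HPo. exists (omega n gamma e z). auto.
        -- destruct (omega_taylor n c gamma e hgamma Hsm He) as [a [Hac Ha]]. exists a. split; [exact Hac|].
           intros z Hz. rewrite disk_inv_eq; auto.
      * rewrite <- Ew. apply QW.
  - intros g eps Hg He. destruct (Rep g Hg) as [ws [W1 [W2 W3]]].
    assert (Hen : eps <> RtoC 0) by (apply Cmod_gt_0; lra). split.
    + intro E. destruct (Strict g eps ws W1 W2 W3 He) as [Hc|Hlt].
      * intros z Hz. rewrite W3, Hc by exact Hz. reflexivity.
      * exfalso. apply (RI _ eps) in Hlt; auto; [|lra]. apply Hlt. rewrite E. fold (q eps). ring.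
    + intro E. change (Q P n c gamma j z0 eps) with (q eps). rewrite QW.
      now apply (weighted_int_ext j g (fun z => P (omega n gamma eps z))).
Qed.
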